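(* Let $C$ be a finite-dimensional non-cosemisimple coalgebra over $\Bbbk$ which is admissible, i.e. there is a Hopf algebra whose underlying coalgebra is $C$. Let $G(C)$ be the set of group-like elements of $C$. Then every block system $C=\bigoplus_{n\ge 0,\,d_1,d_2\ge 1}B^{d_1,d_2}_n$ of $C$ satisfies all of the following: (i) for all $n\ge 0$ and $d_1,d_2\ge 1$, $\dim B^{d_1,d_2}_n$ is divisible by $\dim B^{1,1}_0=|G(C)|$; (ii) for all $n\ge 1$ and $d\ge 1$, $\dim B^{d,1}_n$ and $\dim B^{1,d}_n$ are divisible by $d\,|G(C)|$; (iii) if $B^{d_1,d_2}_n\ne 0$ for some $n\ge 1$ and $d_1,d_2\ge 1$, then $B^{d_2,d_1}_n\ne 0$; (iv) if $B^{d_1,d_2}_{n_1}\ne 0$ for some $n_1\ge 1$ and $d_1,d_2\ge 1$ with $d_1\ne d_2$, then there exist $d_3\ge 1$ and $n_2\ge n_1+1$ such that $B^{d_1,d_3}_{n_2}\ne 0$; (v) if $m=\max\{m'\ge 0\mid B^{1,1}_{m'}\ne 0\}$, then $\dim B^{1,1}_{m}=|G(C)|$.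
   Context: $\Bbbk$ is an algebraically closed field of characteristic $0$. A coalgebra is cosemisimple if it equals its coradical. Block systems. Let $C$ be a non-cosemisimple coalgebra with coradical filtration $\{C_n\}_{n\ge 0}$. There is a coalgebra projection $\pi:C\to C_0$ onto the coradical whose kernel $I=\ker\pi$ is a coideal with $C=C_0\oplus I$; fix such $\pi$ and $I$. Put $\rho_L=(\pi\otimes \mathrm{id})\Delta$ and $\rho_R=(\mathrm{id}\otimes\pi)\Delta$; these make $C$ a $C_0$-bicomodule. Put $P_n=C_n\cap I$, a $C_0$-subbicomodule. Let $\widehat C$ index the simple subcoalgebras $D_\tau$ of $C$, with $\dim D_\tau=d_\tau^2$; let $V_\tau$ be the simple right $D_\tau$-comodule and $V_\tau^*$ the simple left $D_\tau$-comodule. The category of $C_0$-bicomodules is semisimple, and for a $C_0$-bicomodule $M$ one writes $M^{\tau,\mu}$ for the sum of the simple subbicomodules of $M$ isomorphic to $V_\tau^*\otimes V_\mu$, so $M=\bigoplus_{\tau,\mu\in\widehat C}M^{\tau,\mu}$. For each $n\ge 1$ choose a $C_0$-subbicomodule $Q_n\subseteq P_n$ with $P_n=P_{n-1}\oplus Q_n$ (so $Q_n\cong C_n/C_{n-1}$). The blocks (derived from $I$ and $\{Q_n\}$) are: $B^{d,d}_0=\bigoplus_{\tau\in\widehat C,\,d_\tau=d}D_\tau$; $B^{d_1,d_2}_0=0$ if $d_1\neq d_2$; and, for $n\ge 1$, $B^{d_1,d_2}_n=\bigoplus_{\tau,\mu\in\widehat C,\ d_\tau=d_1,\ d_\mu=d_2}Q_n^{\tau,\mu}$.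 The decomposition $C=\bigoplus_{n\ge 0,\,d_1,d_2\ge 1}B_n^{d_1,d_2}$ is called a block system of $C$. *)

(* Defs.v *)
From HB Require Import structures.
From mathcomp Require Import all_boot all_order all_algebra.
From mathcomp Require Import finmap.
From mathcomp Require Import mathcomp_extra boolp classical_sets functions.
From mathcomp Require Import cardinality.

Set Implicit Arguments.
Unset Strict Implicit.
Unset Printing Implicit Defensive.

Import GRing.Theory.

Local Open Scope classical_set_scope.
Local Open Scope ring_scope.

Section Tensor.
Variable k : fieldType.
Implicit Types U V W : vectType k.

(* A tensor is given by its matrix of coordinates in the bases                *)
(* vbasis {:U} and vbasis {:V}; tlift_tens and tlift_unique are the universal *)
(* property.                                                                  *)
Definition tensor U V : vectType k := 'M[k]_(\dim {:U}, \dim {:V}).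

Definition tens U V (u : U) (v : V) : tensor U V :=
  \matrix_(i, j) (coord (vbasis {:U}) i u * coord (vbasis {:V}) j v).

(* tlift b is the linear map u (x) v |-> b u v, for a bilinear map b. It also *)
(* serves as Sweedler notation: tlift (fun c1 c2 => E) (comul c) is           *)
(* \sum_(c) E.                                                                *)
Definition tlift U V W (b : U -> V -> W) (t : tensor U V) : W :=
  \sum_i \sum_j (t : 'M[k]_(_, _)) i j *: b (vbasis {:U})`_i (vbasis {:V})`_j.

Lemma tlift_is_linear U V W (b : U -> V -> W) : linear (tlift b).
Proof.
move=> a s t; rewrite /tlift scaler_sumr -big_split /=; apply: eq_bigr => i _.
rewrite scaler_sumr -big_split /=; apply: eq_bigr => j _.
by rewrite !mxE scalerDl scalerA.
Qed.

HB.instance Definition _ U V W (b : U -> V -> W) :=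
  GRing.isLinear.Build k (tensor U V) W _ (tlift b) (@tlift_is_linear U V W b).

Lemma tlift_tens U V W (b : U -> V -> W) (u : U) (v : V) :
    (forall y, linear (b ^~ y)) -> (forall x, linear (b x)) ->
  tlift b (tens u v) = b u v.
Proof.
move=> bl br.
have sl n (a : 'I_n -> k) (x : 'I_n -> U) y :
    b (\sum_i a i *: x i) y = \sum_i a i *: b (x i) y.
  pose fl : {linear U -> W} :=
    HB.pack (b ^~ y) (GRing.isLinear.Build _ _ _ _ (b ^~ y) (bl y)).
  by have := linear_sum fl (index_enum 'I_n) predT (fun i => a i *: x i);
     rewrite /= => ->; apply: eq_bigr => i _; exact: (linearZ_LR fl).
have sr n (a : 'I_n -> k) x (y : 'I_n -> V) :
    b x (\sum_i a i *: y i) = \sum_i a i *: b x (y i).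
  pose fr : {linear V -> W} :=
    HB.pack (b x) (GRing.isLinear.Build _ _ _ _ (b x) (br x)).
  by have := linear_sum fr (index_enum 'I_n) predT (fun i => a i *: y i);
     rewrite /= => ->; apply: eq_bigr => i _; exact: (linearZ_LR fr).
rewrite [in RHS](coord_vbasis (memvf u)) sl; apply: eq_bigr => i _.
rewrite [in RHS](coord_vbasis (memvf v)) sr scaler_sumr.
by apply: eq_bigr => j _; rewrite scalerA mxE.
Qed.

Lemma tens_linearl U V (v : V) : linear (fun u : U => tens u v).
Proof. by move=> a x y; apply/matrixP=> i j; rewrite !mxE linearP mulrDl mulrA. Qed.

Lemma tens_linearr U V (u : U) : linear (tens u : V -> tensor U V).
Proof.
by move=> a x y; apply/matrixP=> i j; rewrite !mxE linearP mulrDr mulrCA.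
Qed.

Lemma tlift_unique U V W (f : 'Hom(tensor U V, W)) t :
  f t = tlift (fun u v => f (tens u v)) t.
Proof.
rewrite /tlift [in LHS](matrix_sum_delta t) linear_sum; apply: eq_bigr => i _.
rewrite linear_sum; apply: eq_bigr => j _; rewrite linearZ; congr (_ *: f _).
have fb (X : vectType k) : free (vbasis {:X}) by exact: basis_free (vbasisP _).
by apply/matrixP=> i' j'; rewrite !mxE !coord_free // -natrM mulnb ![_ == i']eq_sym ![_ == j']eq_sym.
Qed.

Definition tmap U V U' V' (f : 'Hom(U, U')) (g : 'Hom(V, V')) :
    'Hom(tensor U V, tensor U' V') :=
  linfun (tlift (fun u v => tens (f u) (g v))).

Lemma tmapE U V U' V' (f : 'Hom(U, U')) (g : 'Hom(V, V')) u v :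
  tmap f g (tens u v) = tens (f u) (g v).
Proof.
rewrite lfunE /= tlift_tens // => [y|x] a x1 x2.
  by rewrite linearP tens_linearl.
by rewrite linearP tens_linearr.
Qed.

(* The image of U0 (x) V0 in U (x) V. *)
Definition tensv U V (U0 : {vspace U}) (V0 : {vspace V}) :
    {vspace tensor U V} :=
  <<[seq tens u v | u <- vbasis U0, v <- vbasis V0]>>%VS.

End Tensor.

Section SumOfSubspaces.
Variables (k : fieldType) (V : vectType k).

(* The sum of all the subspaces D satisfying P, possibly infinitely many.     *)
(* The property in the definition says that W is the least subspace           *)
(* containing them all.                                                       *)
Definition sumv_of (P : {vspace V} -> Prop) : {vspace V} :=
  xget 0%VS [set W | forall U, (W <= U)%VS <-> forall D, P D -> (D <= U)%VS].

Lemma sumv_ofP P U : (sumv_of P <= U)%VS <-> forall D, P D -> (D <= U)%VS.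
Proof.
suff: exists W, [set W | forall U, (W <= U)%VS <-> forall D, P D -> (D <= U)%VS] W.
  by move=> /(xgetPex 0%VS).
pose Q W := forall U, (forall D, P D -> (D <= U)%VS) -> (W <= U)%VS.
have Q0 : Q 0%VS by move=> U' _; exact: sub0v.
have: exists W, Q W /\ (\dim {:V} - \dim W <= \dim {:V})%N.
  by exists 0%VS; split => //; rewrite leq_subr.
move: {2}(\dim {:V}) => m; elim: m => [|m IH] [W [QW dW]].
  exists W => U'; split; last exact: QW.
  move=> sWU D _; apply: subv_trans sWU.
  by have /eqP -> : W == fullv; [rewrite eqEdim subvf -subn_eq0 -leqn0|exact: subvf].
have [sPW|/existsNP[D /not_implyP[PD /negP nDW]]] :=
    pselect (forall D, P D -> (D <= W)%VS).
  exists W => U'; split; last exact: QW.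
  by move=> sWU D /sPW sDW; apply: subv_trans sWU.
apply: IH; exists (W + D)%VS; split.
  by move=> U' PU'; rewrite subv_add QW //= PU'.
rewrite -ltnS (leq_trans _ dW) //.
suff lt : (\dim W < \dim (W + D))%N.
  by rewrite ltn_sub2l // (leq_trans lt) // dimvS // subvf.
by rewrite (ltn_leqif (dimv_leqif_sup (addvSl W D))) subv_add subvv.
Qed.

End SumOfSubspaces.

Record coalgebra (k : fieldType) := Coalgebra {
  coalg_vect :> vectType k;
  comul : 'Hom(coalg_vect, tensor coalg_vect coalg_vect);
  counit : 'Hom(coalg_vect, k^o);
  comulA : forall c,
    tlift (fun c1 c2 => tlift (fun x y => tens x (tens y c2)) (comul c1))
      (comul c)
    = tlift (fun c1 c2 => tens c1 (comul c2)) (comul c);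
  counitl : forall c, tlift (fun c1 c2 => counit c1 *: c2) (comul c) = c;
  counitr : forall c, tlift (fun c1 c2 => counit c2 *: c1) (comul c) = c
}.

Arguments comul {k} C : rename.
Arguments counit {k} C : rename.

Record hopf_structure (k : fieldType) (C : coalgebra k) := HopfStructure {
  hmul : 'Hom(tensor C C, C);
  hone : C;
  antipode : 'End(C);
  hmulA : forall a b c,
    hmul (tens (hmul (tens a b)) c) = hmul (tens a (hmul (tens b c)));
  hmul1l : forall a, hmul (tens hone a) = a;
  hmul1r : forall a, hmul (tens a hone) = a;
  comulM : forall a b, comul C (hmul (tens a b)) =
    tlift (fun a1 a2 =>
      tlift (fun b1 b2 => tens (hmul (tens a1 b1)) (hmul (tens a2 b2)))
        (comul C b)) (comul C a);
  comul1 : comul C hone = tens hone hone;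
  counitM : forall a b,
    counit C (hmul (tens a b)) = (counit C a : k) * (counit C b : k);
  counit1 : counit C hone = (1 : k);
  antipodel : forall a,
    tlift (fun a1 a2 => hmul (tens (antipode a1) a2)) (comul C a)
    = counit C a *: hone;
  antipoder : forall a,
    tlift (fun a1 a2 => hmul (tens a1 (antipode a2))) (comul C a)
    = counit C a *: hone
}.

Definition admissible (k : fieldType) (C : coalgebra k) : Prop :=
  inhabited (hopf_structure C).

Section CoalgebraTheory.
Variables (k : fieldType) (C : coalgebra k).
Implicit Types D E W : {vspace C}.

Definition subcoalgebra D : Prop := (comul C @: D <= tensv D D)%VS.

Definition simple_subcoalgebra D : Prop :=
  [/\ subcoalgebra D, D != 0%VS &
      forall E, subcoalgebra E -> (E <= D)%VS -> E = 0%VS \/ E = D].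

Definition coradical : {vspace C} := sumv_of simple_subcoalgebra.

Definition cosemisimple : Prop := coradical = fullv.

Fixpoint corad_filt (n : nat) : {vspace C} :=
  if n is m.+1 then
    (comul C @^-1: (tensv fullv (corad_filt m) + tensv coradical fullv))%VS
  else coradical.

Definition grouplikes : set C :=
  [set g | comul C g = tens g g /\ counit C g = (1 : k)].

Lemma grouplikes_free (s : seq C) :
  uniq s -> (forall g, g \in s -> grouplikes g) -> free s.
Proof.
elim: s => [|g s IH] /=; first by rewrite nil_free.
move=> /andP[gNs us] Gs; rewrite free_cons.
have {IH} fs : free s by apply: IH => // h hs; apply: Gs; rewrite inE hs orbT.
rewrite fs andbT; apply/negP => gs.
have {}gs : g \in <<in_tuple s>>%VS by [].
have [cg eg] := Gs g (mem_head _ _).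
pose a i : k := coord (in_tuple s) i g.
have ga : g = \sum_i a i *: s`_i by rewrite {1}(coord_span gs).
pose f i j (x y : C) : k^o :=
  coord (in_tuple s) i x * coord (in_tuple s) j y.
have fE i j x y : tlift (f i j) (tens x y) = f i j x y.
  apply: tlift_tens => z c u v; rewrite /f linearP.
    by rewrite mulrDl -mulrA.
  by rewrite mulrDr mulrCA.
have aa i j : a i * a j = if i == j then a i else 0.
  rewrite -[LHS]/(f i j g g) -fE -cg [in LHS]ga !linear_sum /=.
  have -> : \sum_l tlift (f i j) (comul C (a l *: s`_l))
          = \sum_l (if (l == i) && (i == j) then a l else 0).
    apply: eq_bigr => l _; rewrite !linearZ /=.
    have [-> _] : grouplikes s`_l.
      by apply: Gs; rewrite inE mem_nth ?orbT.
    rewrite fE.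
    change (a l * (coord (in_tuple s) i s`_l * coord (in_tuple s) j s`_l) =
            (if (l == i) && (i == j) then a l else 0 : k)).
    rewrite !(coord_free _ _ (fs : free (in_tuple s))).
    case: (eqVneq l i) => [->|_] /=; last by rewrite mul0r mulr0.
    by rewrite mul1r; case: eqVneq; rewrite ?mulr1 ?mulr0.
  case: eqVneq => [_|_]; last by rewrite big1 // => l _; rewrite andbF.
  by rewrite -big_mkcond /= (eq_bigl (pred1 i)) ?big_pred1_eq // => l; rewrite andbT.
have [a0|/existsNP[i /eqP ai0]] := pselect (forall i, a i = 0).
  move: eg; rewrite ga big1 ?linear0 => [/esym/eqP|i _]; first by rewrite oner_eq0.
  by rewrite a0 scale0r.
have ai1 : a i = 1.
  by apply: (mulfI ai0); rewrite mulr1 aa eqxx.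
suff gi : g = s`_i by move: gNs; rewrite gi mem_nth.
rewrite ga (bigD1 i) //= ai1 scale1r big1 ?addr0 // => j ji.
have := aa i j; rewrite eq_sym (negPf ji) ai1 mul1r => ->.
by rewrite scale0r.
Qed.

Lemma grouplikes_finite : finite_set grouplikes.
Proof.
apply: contrapT => /(infinite_set_fset (\dim {:C}).+1)[B BG].
rewrite leqNgt => /negP; apply; rewrite ltnS.
have /eqP <- : free (enum_fset B).
  by apply: grouplikes_free; [exact: fset_uniq|move=> g gB; exact: BG].
by rewrite dimvS // subvf.
Qed.

(* |G(C)|; meaningful by grouplikes_finite. *)
Definition card_grouplikes : nat := #|` fset_set grouplikes|.

End CoalgebraTheory.

Section Comodules.
Variables (k : fieldType) (C : coalgebra k).

Definition right_comodule (V : vectType k) (rho : 'Hom(V, tensor V C)) : Prop :=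
  (forall v, tlift (fun v0 c => tlift (fun x y => tens x (tens y c)) (rho v0))
               (rho v)
             = tlift (fun v0 c => tens v0 (comul C c)) (rho v)) /\
  (forall v, tlift (fun v0 c => counit C c *: v0) (rho v) = v).

Definition left_comodule (V : vectType k) (lam : 'Hom(V, tensor C V)) : Prop :=
  (forall v, tlift (fun c v0 => tlift (fun x y => tens x (tens y v0)) (comul C c))
               (lam v)
             = tlift (fun c v0 => tens c (lam v0)) (lam v)) /\
  (forall v, tlift (fun c v0 => counit C c *: v0) (lam v) = v).

(* For a subcoalgebra D, a D-comodule is a C-comodule with coaction in D. *)
Definition simple_right_comodule (D : {vspace C}) (V : vectType k)
    (rho : 'Hom(V, tensor V C)) : Prop :=
  [/\ right_comodule rho, (limg rho <= tensv fullv D)%VS,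
      fullv != 0%VS :> {vspace V} &
      forall W : {vspace V}, (rho @: W <= tensv W D)%VS -> W = 0%VS \/ W = fullv].

Definition simple_left_comodule (D : {vspace C}) (V : vectType k)
    (lam : 'Hom(V, tensor C V)) : Prop :=
  [/\ left_comodule lam, (limg lam <= tensv D fullv)%VS,
      fullv != 0%VS :> {vspace V} &
      forall W : {vspace V}, (lam @: W <= tensv D W)%VS -> W = 0%VS \/ W = fullv].

End Comodules.

Section BlockSystems.
Variables (k : fieldType) (C : coalgebra k).
Implicit Types (pi : 'End(C)) (W : {vspace C}).

(* pi is seen as an endomorphism of C; that lker pi is a coideal complement   *)
(* of the coradical is then automatic.                                        *)
Definition coradical_projection pi : Prop :=
  [/\ limg pi = coradical C,
      forall c, c \in coradical C -> pi c = c,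
      forall c, comul C (pi c) = tmap pi pi (comul C c) &
      forall c, counit C (pi c) = counit C c].

Definition rhoL pi : 'Hom(C, tensor C C) := (tmap pi \1 \o comul C)%VF.
Definition rhoR pi : 'Hom(C, tensor C C) := (tmap \1 pi \o comul C)%VF.

Definition subbicomodule pi W : Prop :=
  (rhoL pi @: W <= tensv (coradical C) W)%VS /\
  (rhoR pi @: W <= tensv W (coradical C))%VS.

Definition simple_subbicomodule pi W : Prop :=
  [/\ subbicomodule pi W, W != 0%VS &
      forall X, subbicomodule pi X -> (X <= W)%VS -> X = 0%VS \/ X = W].

(* W is isomorphic to V_D^* (x) V_E, where V_D^* is the simple left           *)
(* D-comodule and V_E the simple right E-comodule: f is the isomorphism,      *)
(* composed with the inclusion of W in C.                                     *)
Definition bicomodule_type pi (D E W : {vspace C}) : Prop :=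
  exists (L R : vectType k) (lam : 'Hom(L, tensor C L))
         (rho : 'Hom(R, tensor R C)) (f : 'Hom(tensor L R, C)),
  [/\ simple_left_comodule D lam, simple_right_comodule E rho,
      lker f = 0%VS /\ limg f = W,
      forall l r, rhoL pi (f (tens l r))
        = tlift (fun c l0 => tens c (f (tens l0 r))) (lam l) &
      forall l r, rhoR pi (f (tens l r))
        = tlift (fun r0 c => tens (f (tens l r0)) c) (rho r)].

(* M^{tau,mu}, where D and E are the simple subcoalgebras of index tau and    *)
(* mu.                                                                        *)
Definition isotypic pi (M D E : {vspace C}) : {vspace C} :=
  sumv_of (fun W => [/\ (W <= M)%VS, simple_subbicomodule pi W &
                        bicomodule_type pi D E W]).

Definition P_filt pi (n : nat) : {vspace C} :=
  (corad_filt C n :&: lker pi)%VS.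

(* The value of Q at 0 is irrelevant. *)
Definition block_data pi (Q : nat -> {vspace C}) : Prop :=
  coradical_projection pi /\
  forall n, (1 <= n)%N ->
    [/\ subbicomodule pi (Q n),
        P_filt pi n = (P_filt pi n.-1 + Q n)%VS &
        (P_filt pi n.-1 :&: Q n)%VS = 0%VS].

(* Internal sums; a simple subcoalgebra D has d_D = d when \dim D = d ^ 2. *)
Definition block pi (Q : nat -> {vspace C}) (n d1 d2 : nat) : {vspace C} :=
  if n == 0 then
    if d1 == d2 then
      sumv_of (fun D => simple_subcoalgebra D /\ \dim D = (d1 ^ 2)%N)
    else 0%VS
  else
    sumv_of (fun W => exists D E : {vspace C},
      [/\ simple_subcoalgebra D /\ \dim D = (d1 ^ 2)%N,
          simple_subcoalgebra E /\ \dim E = (d2 ^ 2)%N &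
          W = isotypic pi (Q n) D E]).

End BlockSystems.

(* Main.v *)
(* Let A be the convolution algebra of C, with Jacobson radical J. It acts on C by lop
   and rop, the coradical filtration is C_n = (J^(n+1))^perp, and the central idempotents
   e_d of A/J, lifted to A through pi, cut out the blocks: B_n^{d1,d2} is the image of Q_n
   under lop e_d1 o rop e_d2. Modulo C_(n-1) this depends on e_d1 and e_d2 modulo J only,
   so (anti-)automorphisms of the coalgebra permute the graded pieces of the filtration.

   (iii) is the symmetry under the antipode, which is bijective. For (i), the graded pieces
   are Hopf modules over the group of group-likes; comparing traces on M (x) H shows that a
   group-like g <> 1 acts with trace 0, so |G(C)| divides the dimension of every Hopf
   module. For (ii), translation by group-likes permutes the |G(C)| isotypic pieces of
   B_n^{d,1} simply transitively, and matrix units show that each has dimension divisible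
   by d. For (iv) and (v), a nonzero left integral La makes A a Frobenius algebra through
   f |-> lop f La; hence the last nonzero graded piece of lop e_D C is governed by the
   Nakayama automorphism: it has right type a single simple subcoalgebra of dimension
   dim D, and it is a line when dim D = 1. *)

From HB Require Import structures.
Require Import Defs.
From mathcomp Require Import all_boot all_order all_algebra.
From mathcomp Require Import finmap boolp classical_sets cardinality.
From mathcomp Require cyclic separable cyclotomic.

Set Implicit Arguments.
Unset Strict Implicit.
Unset Printing Implicit Defensive.

Import GRing.Theory.
Local Open Scope ring_scope.

(** * Functionals and traces *)

Section Functionals.
Variables (k : fieldType).
Implicit Types U V W : vectType k.

(** Neither [pi] nor [Q] is preserved by translations or by the antipode, whereas the coradical
    filtration is. Graded pieces are therefore represented, without quotients, by subspaces
    containing C_(n-1), which only shifts dimensions by a constant. Characteristic 0 lets dimensions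
    be read off traces of idempotents.

    On H itself the trace comparison leaves two values for the trace t of a group-like g, since t^2
    = (dim H) t. The value dim H is excluded for g <> 1 because every root of unity of order
    dividing that of g occurs as an eigenvalue of g, by linear independence of group-likes.

    The integral is produced by a trace formula of Larson and Sweedler, and the Frobenius map it
    defines also yields that the antipode is injective and reverses the comultiplication. In (v),
    the Frobenius map gives one line for each group-like, hence the upper bound |G(C)| for the top
    block; as this block is nonzero, the divisibility in (i) makes the bound an equality. *)

Lemma linfunK U V (f : U -> V) : linear f -> linfun f =1 f.
Proof.
move=> lf x.
pose F : {linear U -> V} := HB.pack f (GRing.isLinear.Build _ _ _ _ f lf).
exact: (lfunE F x).
Qed.

Definition bvec V (i : 'I_(\dim {:V})) : V := (vbasis {:V})`_i.
Definition bfun V (i : 'I_(\dim {:V})) : 'Hom(V, k^o) :=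
  linfun (fun v => coord (vbasis {:V}) i v : k^o).

Lemma bfunE V i v : bfun i v = coord (vbasis {:V}) i v.
Proof. by rewrite linfunK // => a x y; rewrite linearP. Qed.

Lemma bvec_free V : free (vbasis {:V}).
Proof. exact: basis_free (vbasisP _). Qed.

Lemma bfun_bvec V (i j : 'I_(\dim {:V})) : bfun i (bvec j) = (j == i)%:R.
Proof. by rewrite bfunE coord_free ?bvec_free // eq_sym. Qed.

Lemma bvec_sum V (v : V) : v = \sum_i (bfun i v : k) *: bvec i.
Proof.
rewrite {1}(coord_vbasis (memvf v)).
by apply: eq_bigr => i _; rewrite bfunE.
Qed.

Lemma hom_sum V W (f : 'Hom(V, W)) v :
  f v = \sum_i (bfun i v : k) *: f (bvec i).
Proof. by rewrite {1}(bvec_sum v) linear_sum; apply: eq_bigr => i _; rewrite linearZ. Qed.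

Lemma bfun_sum V (f : 'Hom(V, k^o)) : f = \sum_i (f (bvec i) : k) *: bfun i.
Proof.
apply/lfunP => v; rewrite hom_sum sum_lfunE; apply: eq_bigr => i _.
by rewrite scale_lfunE; apply: mulrC.
Qed.

Lemma functional_ext V (v w : V) :
  (forall f : 'Hom(V, k^o), f v = f w) -> v = w.
Proof.
by move=> fvw; rewrite (bvec_sum v) (bvec_sum w); apply: eq_bigr => i _; rewrite fvw.
Qed.

(** Test with functionals composed with 1 - [projv U], which vanish on U and detect the part of v
    outside U. *)
Lemma functional_sep V (U : {vspace V}) (v : V) :
  (forall f : 'Hom(V, k^o), (U <= lker f)%VS -> f v = 0) -> v \in U.
Proof.
move=> H; have /eqP : v - projv U v = 0.
  apply: functional_ext => f; rewrite linear0.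
  have := H (f \o (\1 - projv U))%VF.
  rewrite comp_lfunE !lfunE /= !lfunE /=; apply.
  by apply/subvP => u uU; rewrite memv_ker comp_lfunE !lfunE /= !lfunE /= projv_id // subrr linear0.
by rewrite subr_eq0 => /eqP ->; exact: memv_proj.
Qed.

Lemma functional_nz V (v : V) : v != 0 -> exists f : 'Hom(V, k^o), f v <> 0.
Proof.
move=> v0; apply/not_existsP => H; move/negP: v0; apply; apply/eqP.
by apply: functional_ext => f; rewrite linear0; exact: contrapT (H f).
Qed.

Definition ltr V (f : 'End(V)) : k := \sum_i (bfun i (f (bvec i)) : k).

Lemma ltrD V (f g : 'End(V)) : ltr (f + g) = ltr f + ltr g.
Proof. by rewrite /ltr -big_split; apply: eq_bigr => i _; rewrite add_lfunE linearD. Qed.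

Lemma ltrZ V a (f : 'End(V)) : ltr (a *: f) = a * ltr f.
Proof. by rewrite /ltr mulr_sumr; apply: eq_bigr => i _; rewrite scale_lfunE linearZ. Qed.

Lemma ltr0 V : ltr (0 : 'End(V)) = 0.
Proof. by rewrite -(scale0r (\1%VF)) ltrZ mul0r. Qed.

Lemma ltr_sum V I (r : seq I) (P : pred I) (F : I -> 'End(V)) :
  ltr (\sum_(i <- r | P i) F i) = \sum_(i <- r | P i) ltr (F i).
Proof. by elim/big_rec2: _ => [|i x y _ <-]; rewrite ?ltr0 ?ltrD. Qed.

Lemma ltrC V W (f : 'Hom(V, W)) (g : 'Hom(W, V)) : ltr (f \o g)%VF = ltr (g \o f)%VF.
Proof.
rewrite /ltr.
under eq_bigr do rewrite comp_lfunE (hom_sum f) linear_sum /=.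
rewrite exchange_big /=; apply: eq_bigr => i _.
rewrite comp_lfunE (hom_sum g) linear_sum; apply: eq_bigr => j _.
by rewrite !linearZ; exact: mulrC.
Qed.

Lemma ltr1 V : ltr (\1%VF : 'End(V)) = (\dim {:V})%:R.
Proof.
rewrite /ltr; under eq_bigr do rewrite id_lfunE bfun_bvec eqxx.
by rewrite sumr_const card_ord.
Qed.

Lemma ltr_rank1 V (f : 'Hom(V, k^o)) (v : V) :
  ltr (linfun (fun x => (f x : k) *: v)) = f v.
Proof.
rewrite [RHS]hom_sum /ltr; apply: eq_bigr => i _.
rewrite linfunK => [|a x y]; last by rewrite linearP scalerDl scalerA.
by rewrite linearZ; exact: mulrC.
Qed.

(** Factor f through its image as i p; cyclicity turns the trace of i p into that of p i, the
    identity of the image. *)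
Lemma ltr_idem V (f : 'End(V)) :
  (f \o f)%VF = f -> ltr f = (\dim (limg f))%:R.
Proof.
move=> ff; pose U := limg f.
pose i : 'Hom(subvs_of U, V) := linfun vsval.
pose p : 'Hom(V, subvs_of U) := linfun (fun x => vsproj U (f x)).
have pE x : p x = vsproj U (f x) by rewrite linfunK // => a u v; rewrite !linearP.
have iE x : i x = vsval x by rewrite linfunK.
have fip : f = (i \o p)%VF.
  by apply/lfunP => x; rewrite comp_lfunE iE pE vsprojK // memv_img // memvf.
rewrite -/U fip ltrC.
suff -> : (p \o i)%VF = \1%VF by rewrite ltr1 dimvf.
apply/lfunP => x; rewrite comp_lfunE pE iE id_lfunE.
have /memv_imgP[y _ xE] := subvsP x.
rewrite -[RHS]vsvalK xE.
by rewrite -comp_lfunE ff.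
Qed.

End Functionals.

(** * Slices of tensors *)

Section Slices.
Variables (k : fieldType).
Implicit Types U V W X : vectType k.

Lemma eq_tlift U V W (b b' : U -> V -> W) t :
  (forall u v, b u v = b' u v) -> tlift b t = tlift b' t.
Proof. by move=> bb; do 2!apply: eq_bigr => ? _; rewrite bb. Qed.

Lemma linear_tlift U V W X (T : {linear W -> X}) (b : U -> V -> W) t :
  T (tlift b t) = tlift (fun u v => T (b u v)) t.
Proof.
rewrite /tlift linear_sum; apply: eq_bigr => i _.
by rewrite linear_sum; apply: eq_bigr => j _; rewrite linearZ.
Qed.

Lemma eq_on_tens U V W (F G : tensor U V -> W) : linear F -> linear G ->
  (forall u v, F (tens u v) = G (tens u v)) -> F =1 G.
Proof.
move=> lF lG FG t; rewrite -(linfunK lF) -(linfunK lG) !tlift_unique.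
by apply: eq_tlift => u v; rewrite !linfunK.
Qed.

(** The slices f (x) id and id (x) f. Slices on one side already separate tensors, so identities
    between tensors and membership in [tensv] are tested through dual spaces. *)
Definition lsl U V (f : 'Hom(U, k^o)) : 'Hom(tensor U V, V) :=
  linfun (tlift (fun u v => (f u : k) *: v)).
Definition rsl U V (f : 'Hom(V, k^o)) : 'Hom(tensor U V, U) :=
  linfun (tlift (fun u v => (f v : k) *: u)).

Arguments lsl {U V} f.
Arguments rsl {U V} f.

Lemma lslE U V (f : 'Hom(U, k^o)) t :
  lsl f t = tlift (fun u (v : V) => (f u : k) *: v) t.
Proof. exact: lfunE. Qed.

Lemma rslE U V (f : 'Hom(V, k^o)) t :
  rsl f t = tlift (fun (u : U) v => (f v : k) *: u) t.
Proof. exact: lfunE. Qed.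

Lemma lsl_tens U V (f : 'Hom(U, k^o)) u (v : V) : lsl f (tens u v) = (f u : k) *: v.
Proof.
rewrite lslE tlift_tens // => [y|x] a u1 u2; first by rewrite linearP scalerDl scalerA.
by rewrite scalerDr !scalerA mulrC.
Qed.

Lemma rsl_tens U V (f : 'Hom(V, k^o)) (u : U) v : rsl f (tens u v) = (f v : k) *: u.
Proof.
rewrite rslE tlift_tens // => [y|x] a u1 u2; last by rewrite linearP scalerDl scalerA.
by rewrite scalerDr !scalerA mulrC.
Qed.


Lemma tensZl U V a (u : U) (v : V) : tens (a *: u) v = a *: tens u v.
Proof. by apply/matrixP => i j; rewrite !mxE linearZ mulrA. Qed.

Lemma tensZr U V a (u : U) (v : V) : tens u (a *: v) = a *: tens u v.
Proof. by apply/matrixP => i j; rewrite !mxE linearZ mulrCA. Qed.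

Lemma tens_suml U V I (r : seq I) (F : I -> U) (v : V) :
  tens (\sum_(i <- r) F i) v = \sum_(i <- r) tens (F i) v.
Proof.
apply/matrixP => i j; rewrite !mxE summxE linear_sum mulr_suml.
by apply: eq_bigr => l _; rewrite mxE.
Qed.

Lemma tens_sumr U V I (r : seq I) (u : U) (F : I -> V) :
  tens u (\sum_(i <- r) F i) = \sum_(i <- r) tens u (F i).
Proof.
apply/matrixP => i j; rewrite !mxE summxE linear_sum mulr_sumr.
by apply: eq_bigr => l _; rewrite mxE.
Qed.

Lemma tens_expandl U V (t : tensor U V) :
  t = \sum_i tens (bvec i) (lsl (bfun i) t).
Proof.
pose F (t : tensor U V) : tensor U V := \sum_i tens (bvec i) (lsl (bfun i) t).
apply: (@eq_on_tens U V (tensor U V) id F) => [//|a x y|u v] /=.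
  rewrite /F scaler_sumr -big_split; apply: eq_bigr => i _ /=.
  by rewrite linearP tens_linearr.
rewrite /F [in LHS](bvec_sum u) tens_suml; apply: eq_bigr => i _.
by rewrite lsl_tens tensZl tensZr.
Qed.

Lemma tens_expandr U V (t : tensor U V) :
  t = \sum_i tens (rsl (bfun i) t) (bvec i).
Proof.
pose F (t : tensor U V) : tensor U V := \sum_i tens (rsl (bfun i) t) (bvec i).
apply: (@eq_on_tens U V (tensor U V) id F) => [//|a x y|u v] /=.
  rewrite /F scaler_sumr -big_split; apply: eq_bigr => i _ /=.
  by rewrite linearP tens_linearl.
rewrite /F [in LHS](bvec_sum v) tens_sumr; apply: eq_bigr => i _.
by rewrite rsl_tens tensZl tensZr.
Qed.

Lemma lsl_ext U V (t t' : tensor U V) : (forall f, lsl f t = lsl f t') -> t = t'.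
Proof.
by move=> H; rewrite (tens_expandl t) (tens_expandl t'); apply: eq_bigr => i _; rewrite H.
Qed.

Lemma rsl_ext U V (t t' : tensor U V) : (forall f, rsl f t = rsl f t') -> t = t'.
Proof.
by move=> H; rewrite (tens_expandr t) (tens_expandr t'); apply: eq_bigr => i _; rewrite H.
Qed.

Lemma lsl_tmap U V U' V' (f : 'Hom(U, U')) (g : 'Hom(V, V')) (h : 'Hom(U', k^o)) t :
  lsl h (tmap f g t) = g (lsl (h \o f)%VF t).
Proof.
move: t; apply: eq_on_tens => [a x y|a x y|u v]; rewrite ?linearP //.
by rewrite tmapE !lsl_tens linearZ comp_lfunE.
Qed.

Lemma rsl_tmap U V U' V' (f : 'Hom(U, U')) (g : 'Hom(V, V')) (h : 'Hom(V', k^o)) t :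
  rsl h (tmap f g t) = f (rsl (h \o g)%VF t).
Proof.
move: t; apply: eq_on_tens => [a x y|a x y|u v]; rewrite ?linearP //.
by rewrite tmapE !rsl_tens linearZ comp_lfunE.
Qed.

Lemma mem_tens U V (U0 : {vspace U}) (V0 : {vspace V}) u v :
  u \in U0 -> v \in V0 -> tens u v \in tensv U0 V0.
Proof.
move=> uU vV; rewrite (coord_vbasis uU) (coord_vbasis vV) tens_suml.
apply: memv_suml => i _; rewrite tens_sumr; apply: memv_suml => j _.
rewrite tensZl tensZr !memvZ //; apply/memv_span/allpairsP.
by exists ((vbasis U0)`_i, (vbasis V0)`_j); rewrite !mem_nth ?size_tuple.
Qed.

Lemma tensv_sub U V (U0 : {vspace U}) (V0 : {vspace V}) (W : {vspace tensor U V}) :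
  (forall u v, u \in U0 -> v \in V0 -> tens u v \in W) -> (tensv U0 V0 <= W)%VS.
Proof.
move=> H; apply/span_subvP => t /allpairsP[[u v] /= [uU vV ->]].
by apply: H; exact: vbasis_mem.
Qed.

Lemma limg_subP U V (f : 'Hom(U, V)) (U0 : {vspace U}) (V0 : {vspace V}) :
  (f @: U0 <= V0)%VS <-> (forall u, u \in U0 -> f u \in V0).
Proof.
split=> [/subvP H u uU|H]; first by rewrite H // memv_img.
by apply/subvP => _ /memv_imgP[u uU ->]; exact: H.
Qed.

(** If the right slices lie in U0, then t is fixed by [projv U0] (x) id; expanding t along a basis
    of U then exhibits it as a sum of tensors with both factors in place. *)
Lemma tensvP U V (U0 : {vspace U}) (V0 : {vspace V}) t :
  t \in tensv U0 V0 <-> (forall f, lsl f t \in V0) /\ (forall f, rsl f t \in U0).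
Proof.
split=> [tUV|[tV tU]].
  split=> f; rewrite memv_preim; move: t tUV; apply/subvP/tensv_sub => u v uU vV.
    by rewrite -memv_preim lsl_tens memvZ.
  by rewrite -memv_preim rsl_tens memvZ.
have -> : t = tmap (projv U0) \1%VF t.
  by apply: rsl_ext => f; rewrite rsl_tmap comp_lfun1r projv_id.
rewrite (tens_expandl t) linear_sum; apply: memv_suml => i _.
by rewrite /= tmapE id_lfunE mem_tens ?memv_proj.
Qed.

(** Split t by [projv U0] and its complement; the left slices of the complementary part are slices
    of t by functionals vanishing on U0. Applied to the wedge that defines the coradical
    filtration. *)
Lemma tensvDP U V (U0 : {vspace U}) (V0 : {vspace V}) t :
  t \in (tensv fullv V0 + tensv U0 fullv)%VS <->
  (forall f, (U0 <= lker f)%VS -> lsl f t \in V0).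
Proof.
split=> [/memv_addP[t1 t1V [t2 t2U ->]] f fU|tV].
  have [H _] := (tensvP _ _ _).1 t1V.
  suff l2 : lsl f t2 = 0 by rewrite linearD /= l2 addr0.
  apply/eqP; rewrite -memv_ker; move: t2 t2U; apply/subvP/tensv_sub => u v uU _.
  rewrite memv_ker lsl_tens; have /eqP -> : f u == 0 by rewrite -memv_ker (subvP fU).
  by rewrite scale0r.
pose t1 := tmap (\1 - projv U0)%VF \1%VF t.
pose t2 := tmap (projv U0) \1%VF t.
have -> : t = t1 + t2.
  apply: rsl_ext => f; rewrite linearD /= /t1 /t2 !rsl_tmap comp_lfun1r.
  by rewrite add_lfunE opp_lfunE id_lfunE subrK.
apply: memv_add.
  rewrite /t1 {1}(tens_expandl (tmap _ _ t)); apply: memv_suml => i _.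
  apply: mem_tens; rewrite ?memvf // lsl_tmap id_lfunE; apply: tV.
  apply/subvP => u uU.
  by rewrite memv_ker comp_lfunE add_lfunE opp_lfunE id_lfunE projv_id // subrr linear0.
by apply/tensvP; split=> f; rewrite ?memvf // /t2 rsl_tmap memv_proj.
Qed.

End Slices.

Arguments lsl {k U V} f.
Arguments rsl {k U V} f.

(** * The dual algebra and the coradical filtration *)

Section SumvOf.
Variables (k : fieldType) (V : vectType k).
Implicit Types (P : {vspace V} -> Prop) (D U W : {vspace V}).

Lemma sumv_of_sup P D : P D -> (D <= sumv_of P)%VS.
Proof. by move=> PD; apply: (sumv_ofP P _).1 PD; exact: subvv. Qed.


(** Keep adding members of P to a finite list while the sum grows; the codimension bounds the number
    of steps. *)
Lemma sumv_of_finite P : exists2 s : seq {vspace V},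
  (forall D, D \in s -> P D) & sumv_of P = (\sum_(D <- s) D)%VS.
Proof.
suff [s sP Hs] : exists2 s : seq {vspace V}, (forall D, D \in s -> P D) &
    forall D, P D -> (D <= \sum_(D <- s) D)%VS.
  exists s => //; apply: subv_anti; rewrite ((sumv_ofP _ _).2 Hs) /=.
  rewrite big_seq; elim/big_rec: _ => [|D W Ds WP]; rewrite ?sub0v //.
  by rewrite subv_add WP andbT; apply: sumv_of_sup; exact: sP.
suff H n (s : seq {vspace V}) : (forall D, D \in s -> P D) ->
    (\dim {:V} - \dim (\sum_(D <- s) D) <= n)%N ->
    exists2 s : seq {vspace V}, (forall D, D \in s -> P D) &
    forall D, P D -> (D <= \sum_(D <- s) D)%VS.
  by apply: (H (\dim {:V}) [::]) => //; rewrite leq_subr.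
elim: n s => [|n IH] s sP dn.
  exists s => // D _; apply: subv_trans (subvf _) _.
  by rewrite -(geq_leqif (dimv_leqif_sup (subvf _))) -subn_eq0 -leqn0.
have [|/existsNP[D /not_implyP[PD /negP ND]]] :=
  pselect (forall D, P D -> (D <= \sum_(D <- s) D)%VS); first by exists s.
apply: (IH (D :: s)) => [E|]; first by rewrite inE => /predU1P[->|/sP].
rewrite big_cons -ltnS; apply: leq_trans dn; rewrite ltn_sub2l //.
  rewrite (ltn_leqif (dimv_leqif_sup (subvf _))).
  by apply: contra ND; apply: subv_trans (subvf _).
rewrite (ltn_leqif (dimv_leqif_sup (addvSr _ _))) subv_add subvv andbT.
exact: ND.
Qed.

Lemma sumv_of_ind P (R : {vspace V} -> Prop) : R 0%VS ->
  (forall U W, R U -> R W -> R (U + W)%VS) -> (forall D, P D -> R D) ->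
  R (sumv_of P).
Proof.
move=> R0 RD RP; have [s sP ->] := sumv_of_finite P.
rewrite big_seq; elim/big_rec: _ => // D W Ds RW; apply: RD => //.
by apply: RP; exact: sP.
Qed.

End SumvOf.

Section CoalgebraOperators.
Variables (k : fieldType) (C : coalgebra k).
Notation A := 'Hom(C, k^o).
Implicit Types (f g h : A) (c : C) (D W : {vspace C}).

(* lop f c = f(c_1) c_2 and rop f c = c_1 f(c_2). *)
Definition lop f : 'End(C) := (lsl f \o comul C)%VF.
Definition rop f : 'End(C) := (rsl f \o comul C)%VF.

Lemma lopE f c : lop f c = lsl f (comul C c).
Proof. exact: comp_lfunE. Qed.

Lemma ropE f c : rop f c = rsl f (comul C c).
Proof. exact: comp_lfunE. Qed.

Lemma lopP f g a c : lop (a *: f + g) c = a *: lop f c + lop g c.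
Proof.
rewrite !lopE; move: (comul C c).
apply: eq_on_tens => [b x y|b x y|u v].
- by rewrite linearP.
- by rewrite ![lsl _ (_ *: _ + _)]linearP /= !scalerDr !scalerA mulrC addrACA.
- by rewrite !lsl_tens add_lfunE scale_lfunE scalerDl scalerA.
Qed.

Lemma ropP f g a c : rop (a *: f + g) c = a *: rop f c + rop g c.
Proof.
rewrite !ropE; move: (comul C c).
apply: eq_on_tens => [b x y|b x y|u v].
- by rewrite linearP.
- by rewrite ![rsl _ (_ *: _ + _)]linearP /= !scalerDr !scalerA mulrC addrACA.
- by rewrite !rsl_tens add_lfunE scale_lfunE scalerDl scalerA.
Qed.

Lemma lop_is_linear : linear lop.
Proof. by move=> a f g; apply/lfunP => c; rewrite lopP add_lfunE scale_lfunE. Qed.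
Lemma rop_is_linear : linear rop.
Proof. by move=> a f g; apply/lfunP => c; rewrite ropP add_lfunE scale_lfunE. Qed.

HB.instance Definition _ := GRing.isLinear.Build k A 'End(C) _ lop lop_is_linear.
HB.instance Definition _ := GRing.isLinear.Build k A 'End(C) _ rop rop_is_linear.

Lemma lopB f g c : lop (f - g) c = lop f c - lop g c.
Proof. by rewrite linearB /= add_lfunE opp_lfunE. Qed.

Lemma ropB f g c : rop (f - g) c = rop f c - rop g c.
Proof. by rewrite linearB /= add_lfunE opp_lfunE. Qed.

Lemma lop_sum f c : lop f c = \sum_i (f (bvec i) : k) *: lop (bfun i) c.
Proof.
rewrite [in LHS](bfun_sum f) linear_sum sum_lfunE; apply: eq_bigr => i _.
by rewrite linearZ /= scale_lfunE.
Qed.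

Lemma rop_sum f c : rop f c = \sum_i (f (bvec i) : k) *: rop (bfun i) c.
Proof.
rewrite [in LHS](bfun_sum f) linear_sum sum_lfunE; apply: eq_bigr => i _.
by rewrite linearZ /= scale_lfunE.
Qed.

(** Coassociativity sliced by f at the first factor and by g at the third. The other associativity
    laws for [conv], [lop] and [rop] are derived from it. *)
Lemma lop_rop f g c : lop f (rop g c) = rop g (lop f c).
Proof.
have := congr1 (rsl g \o lsl f)%VF (comulA c).
have lE t : (rsl g \o lsl f)%VF t = rsl g (lsl f t) by exact: comp_lfunE.
rewrite !lE !linear_tlift /=; set x := tlift _ _; set y := tlift _ _.
have -> : x = lop f (rop g c).
  rewrite ropE rslE linear_tlift; apply: eq_tlift => u v.
  rewrite !linear_tlift /= linearZ /= lopE lslE.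
  rewrite (linear_tlift ( *:%R (g v : k))) /=; apply: eq_tlift => u1 v1.
  by rewrite lsl_tens linearZ /= rsl_tens !scalerA mulrC.
move=> ->; rewrite lopE lslE linear_tlift; apply: eq_tlift => u v /=.
by rewrite lsl_tens !linearZ /= ropE.
Qed.

(** f(c_1) g(c_2). For this product [rop] is a left action and [lop] a right action of the dual
    algebra on C. *)
Definition conv f g : A := (f \o rop g)%VF.

Lemma convE f g c : conv f g c = f (rop g c).
Proof. exact: comp_lfunE. Qed.

Lemma convEl f g c : conv f g c = g (lop f c).
Proof.
rewrite convE ropE lopE rslE lslE !linear_tlift; apply: eq_tlift => u v.
by rewrite /= !linearZ; exact: mulrC.
Qed.

Lemma lop_lop f g c : lop f (lop g c) = lop (conv g f) c.
Proof.
apply: functional_ext => h.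
by rewrite -convEl convE -lop_rop -convEl -convE convEl.
Qed.

Lemma convA f g h : conv f (conv g h) = conv (conv f g) h.
Proof. by apply/lfunP => c; rewrite convEl convEl lop_lop -convEl. Qed.

Lemma rop_rop f g c : rop f (rop g c) = rop (conv f g) c.
Proof. by apply: functional_ext => h; rewrite -!convE -convA convE. Qed.

Lemma lop_counit c : lop (counit C) c = c.
Proof. by rewrite lopE lslE counitl. Qed.

Lemma rop_counit c : rop (counit C) c = c.
Proof. by rewrite ropE rslE counitr. Qed.

Lemma counit_lop f c : counit C (lop f c) = f c.
Proof. by rewrite -convEl convE rop_counit. Qed.

Lemma counit_rop f c : counit C (rop f c) = f c.
Proof. by rewrite -convE convEl lop_counit. Qed.

Lemma comul_lop c : comul C c = \sum_i tens (bvec i) (lop (bfun i) c).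
Proof.
by rewrite {1}(tens_expandl (comul C c)); apply: eq_bigr => i _; rewrite lopE.
Qed.

Lemma comul_rop c : comul C c = \sum_i tens (rop (bfun i) c) (bvec i).
Proof.
by rewrite {1}(tens_expandr (comul C c)); apply: eq_bigr => i _; rewrite ropE.
Qed.

Definition left_stable W := forall f c, c \in W -> lop f c \in W.
Definition right_stable W := forall f c, c \in W -> rop f c \in W.

Lemma subcoalgebraP D : subcoalgebra D <-> left_stable D /\ right_stable D.
Proof.
rewrite /subcoalgebra limg_subP; split=> [H|[lD rD] c cD].
  by split=> f c /H /tensvP[lD rD]; rewrite ?lopE ?ropE.
by apply/tensvP; split=> f; rewrite -?lopE -?ropE ?lD ?rD.
Qed.

Lemma subcoalgebraD U W : subcoalgebra U -> subcoalgebra W -> subcoalgebra (U + W)%VS.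
Proof.
move=> /subcoalgebraP[lU rU] /subcoalgebraP[lW rW]; apply/subcoalgebraP.
by split=> f _ /memv_addP[u uU [w wW ->]]; rewrite linearD memv_add ?lU ?lW ?rU ?rW.
Qed.

Lemma subcoalgebraI U W : subcoalgebra U -> subcoalgebra W -> subcoalgebra (U :&: W)%VS.
Proof.
move=> /subcoalgebraP[lU rU] /subcoalgebraP[lW rW]; apply/subcoalgebraP.
by split=> f c; rewrite !memv_cap => /andP[cU cW]; rewrite ?lU ?lW ?rU ?rW.
Qed.

Lemma subcoalgebra0 : subcoalgebra (0%VS : {vspace C}).
Proof.
by apply/subcoalgebraP; split=> f c; rewrite !memv0 => /eqP ->; rewrite linear0.
Qed.

Lemma coradical_subcoalgebra : subcoalgebra (coradical C).
Proof.
apply: sumv_of_ind; [exact: subcoalgebra0|exact: subcoalgebraD|by move=> D []].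
Qed.

(* The Jacobson radical of the convolution algebra. *)
Definition radfun f : Prop := (coradical C <= lker f)%VS.

Lemma radfunP f : radfun f <-> (forall c, c \in coradical C -> f c = 0).
Proof.
split=> [/subvP H c cC|H]; first by apply/eqP; rewrite -memv_ker H.
by apply/subvP => c cC; rewrite memv_ker H.
Qed.

Lemma radfun_conv f g : radfun f -> radfun (conv f g).
Proof.
move=> /radfunP fJ; apply/radfunP => c cC; rewrite convE fJ //.
by have /subcoalgebraP[_ H] := coradical_subcoalgebra; exact: H.
Qed.

Lemma conv_radfun f g : radfun g -> radfun (conv f g).
Proof.
move=> /radfunP fJ; apply/radfunP => c cC; rewrite convEl fJ //.
by have /subcoalgebraP[H _] := coradical_subcoalgebra; exact: H.
Qed.

(** The wedge condition seen through slices: the radical lowers the filtration by one. Together with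
    its mirror image below, this replaces the definition of the filtration from here on. *)
Lemma corad_filtS n c :
  c \in corad_filt C n.+1 <-> (forall f, radfun f -> lop f c \in corad_filt C n).
Proof.
rewrite /= -memv_preim tensvDP.
by split=> H f /H; rewrite lopE.
Qed.

Lemma memv_coradical c : (forall f, radfun f -> f c = 0) -> c \in coradical C.
Proof. by move=> H; apply: functional_sep => f fJ; exact: H. Qed.

(** The wedge in the definition is one-sided. In the lowest degree both sides say that products of
    two radical functionals vanish at c; the induction step works because [lop] and [rop]
    commute. *)
Lemma corad_filtSr n c :
  c \in corad_filt C n.+1 <-> (forall f, radfun f -> rop f c \in corad_filt C n).
Proof.
elim: n c => [|n IH] c.
  rewrite corad_filtS; split=> H f fJ; apply: memv_coradical => g gJ.
    by rewrite -convE convEl (radfunP f).1 //; exact: H.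
  by rewrite -convEl convE (radfunP f).1 //; exact: H.
rewrite corad_filtS; split=> H f fJ.
  apply/corad_filtS => g gJ; rewrite lop_rop.
  by apply: (IH _).1 fJ; exact: H.
apply/IH => g gJ; rewrite -lop_rop.
by apply: (corad_filtS _ _).1 fJ; exact: H.
Qed.

Lemma corad_filt_stable n :
  left_stable (corad_filt C n) /\ right_stable (corad_filt C n).
Proof.
elim: n => [|n [IHl IHr]]; first exact/subcoalgebraP/coradical_subcoalgebra.
split=> f c cC.
  apply/corad_filtS => g gJ; rewrite lop_lop.
  by apply: (corad_filtS _ _).1 => //; exact: conv_radfun.
apply/corad_filtSr => g gJ; rewrite rop_rop.
by apply: (corad_filtSr _ _).1 => //; exact: radfun_conv.
Qed.

Lemma corad_filt_sub m n : (m <= n)%N -> (corad_filt C m <= corad_filt C n)%VS.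
Proof.
move=> mn; rewrite -(subnK mn); elim: (n - m)%N => // l IH.
apply: subv_trans IH _; apply/subvP => c cC; apply/corad_filtS => f _.
by apply: (corad_filt_stable _).1.
Qed.

End CoalgebraOperators.

(** * Burnside's theorem and comatrix coalgebras *)

Section Burnside.
Variable F : closedFieldType.

Lemma closed_eigenvalue n (M : 'M[F]_n) : (0 < n)%N -> exists a, eigenvalue M a.
Proof.
move=> n0; have [|a ra] := closed_rootP (char_poly M) _.
  by rewrite size_char_poly; case: n n0 {M}.
by exists a; rewrite eigenvalue_root_char.
Qed.

Variables (n : nat) (S : {vspace 'M[F]_n}).
Hypothesis S_mul : forall a b, a \in S -> b \in S -> a *m b \in S.
Hypothesis S_trans : forall u v : 'rV[F]_n, u != 0 ->
  exists2 a, a \in S & u *m a = v.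

(* Lomonosov-Rosenthal: an element of minimal nonzero rank has rank one. *)
Lemma transitive_rank1 r (T : 'M[F]_n) : T \in S -> T != 0 -> (\rank T <= r)%N ->
  exists2 T', T' \in S & \rank T' = 1%N.
Proof.
elim: r T => [|r IH] T TS T0 rT.
  by move: T0; rewrite -mxrank_eq0 -leqn0 rT.
have [r1|r1] := eqVneq (\rank T) 1%N; first by exists T.
have /rowV0Pn[_ /submxP[x1 ->] x1T] := T0.
have /row_subPn[i Ti] : ~~ (T <= x1 *m T)%MS.
  apply: contra r1 => /mxrankS rTx; rewrite eqn_leq lt0n mxrank_eq0 T0 andbT.
  by apply: leq_trans rTx (rank_leq_row _).
have [S0 S0S Sx] := S_trans (delta_mx 0 i) x1T.
(* N acts on the row space of T, and subtracting an eigenvalue a of this action lowers the rank of T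
   (N - a). The product stays nonzero: x1 sends it to row i of T minus a multiple of x1 T, and row i
   was chosen off that line. *)
pose N := S0 *m T; pose B := row_base T.
have BN : (B *m N <= B)%MS.
  by rewrite (submx_trans (mulmx_sub _ (submxMl _ _))) // eq_row_base.
have [M BNE] := submxP BN.
have [|a /eigenvalueP[w wM w0]] := @closed_eigenvalue _ M.
  by rewrite lt0n mxrank_eq0.
pose T' := T *m (N - a%:M).
apply: (IH T').
- rewrite /T' /N mulmxBr mulmxA mul_mx_scalar; apply: memvB; last exact: memvZ.
  by apply: S_mul => //; exact: S_mul.
- apply: contra Ti => /eqP T'0; have : x1 *m T' = 0 by rewrite T'0 mulmx0.
  rewrite /T' /N mulmxBr mulmxBr !mulmxA Sx mul_mx_scalar -rowE => /eqP.
  by rewrite subr_eq0 => /eqP ->; exact: scalemx_sub.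
- rewrite -ltnS; apply: leq_trans rT.
  have -> : \rank T' = \rank ((M - a%:M) *m B).
    rewrite mulmxBl -BNE mul_scalar_mx -mul_mx_scalar -mulmxBr.
    by rewrite (eqmxMr _ (eq_row_base T)).
  apply: leq_ltn_trans (mxrankM_maxl _ _) _.
  rewrite ltn_neqAle rank_leq_row andbT; apply/negP => Mfree.
  have : w *m (M - a%:M) = 0 by rewrite mulmxBr wM mul_mx_scalar subrr.
  move/(canRL (mulmxKp Mfree)); rewrite mul0mx => wE.
  by move: w0; rewrite wE eqxx.
Qed.

(** One element c1 r1 of rank one suffices: r1 S is everything by transitivity, and so is S c1,
    because a nonzero row u killing S c1 would contradict transitivity at u. *)
Lemma burnside : S = fullv.
Proof.
apply/eqP; rewrite eqEsubv subvf; apply/subvP => M _.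
suff cr (c : 'cV[F]_n) (r : 'rV[F]_n) : c *m r \in S.
  rewrite (matrix_sum_delta M); apply: memv_suml => i _; apply: memv_suml => j _.
  by rewrite memvZ // -(@mul_delta_mx _ n 1 n 0); exact: cr.
have [->|r0] := eqVneq r 0; first by rewrite mulmx0 mem0v.
have [T TS rT] : exists2 T', T' \in S & \rank T' = 1%N.
  have [a aS ra] := S_trans r r0.
  apply: (@transitive_rank1 (\rank a) a) => //.
  by apply: contra r0 => /eqP a0; rewrite -ra a0 mulmx0.
have [c1 [r1 TE]] : exists (c : 'cV[F]_n) (r : 'rV[F]_n), T = c *m r.
  by rewrite -(mulmx_base T); move: (col_base T) (row_base T); rewrite rT => c1 r1; exists c1, r1.
have T0 : T != 0 by rewrite -mxrank_eq0 rT.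
have r10 : r1 != 0 by apply: contra T0 => /eqP r10; rewrite TE r10 mulmx0.
have c10 : c1 != 0 by apply: contra T0 => /eqP c10; rewrite TE c10 mul0mx.
have [b bS rb] := S_trans r r10.
pose ev : 'Hom('M[F]_n, 'cV[F]_n) := linfun (fun a => a *m c1).
have evE a : ev a = a *m c1 by rewrite linfunK // => x u v; rewrite mulmxDl scalemxAl.
have : c \in (ev @: S)%VS.
  apply: functional_sep => f /subvP fS.
  pose u : 'rV[F]_n := \row_j f (delta_mx j 0).
  have fE v : f v = (u *m v) 0 0.
    rewrite [in LHS](matrix_sum_delta v) linear_sum mxE; apply: eq_bigr => i _.
    by rewrite big_ord1 linearZ mxE; exact: mulrC.
  have [u0|u0] := eqVneq u 0; first by rewrite fE u0 mul0mx mxE.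
  case/negP: c10; apply/eqP/matrixP => i j; rewrite ord1 mxE.
  have [a aS ua] := S_trans (delta_mx 0 i) u0.
  have : f (ev a) = 0 by apply/eqP; rewrite -memv_ker fS // memv_img.
  by rewrite fE evE mulmxA ua -rowE mxE.
move=> /memv_imgP[a aS ->]; rewrite evE -rb mulmxA -(mulmxA a) -TE.
by rewrite S_mul // S_mul.
Qed.

End Burnside.

Section Comatrix.
Variables (k : fieldType) (C : coalgebra k).
Notation A := 'Hom(C, k^o).
Implicit Types (f g : A).

(** The relations Delta c_ij = sum_l c_il (x) c_lj, tested against pairs of functionals. Linear
    independence of the entries is carried separately by a dual system. *)
Definition comatrix n (c : 'I_n -> 'I_n -> C) : Prop :=
  (forall f g i j, conv f g (c i j) = \sum_l (f (c i l) : k) * g (c l j) :> k) /\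
  (forall i j, counit C (c i j) = (i == j)%:R :> k).

Definition dual_comatrix n (c : 'I_n -> 'I_n -> C) (u : 'I_n -> 'I_n -> A) : Prop :=
  forall i j p q, u i j (c p q) = ((i == p) && (j == q))%:R :> k.

Definition cospan n (c : 'I_n -> 'I_n -> C) : 'Hom('M[k]_n, C) :=
  linfun (fun M : 'M[k]_n => \sum_i \sum_j M i j *: c i j).

Lemma cospanE n (c : 'I_n -> 'I_n -> C) (M : 'M_n) :
  cospan c M = \sum_i \sum_j M i j *: c i j.
Proof.
rewrite linfunK // => a x y; rewrite scaler_sumr -big_split; apply: eq_bigr => i _.
rewrite scaler_sumr -big_split; apply: eq_bigr => j _.
by rewrite !mxE scalerDl scalerA.
Qed.

Lemma mem_cospan n (c : 'I_n -> 'I_n -> C) i j : c i j \in limg (cospan c).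
Proof.
apply/memv_imgP; exists (delta_mx i j); rewrite ?memvf // cospanE.
rewrite (bigD1 i) //= (bigD1 j) //= !mxE !eqxx scale1r big1 ?addr0 => [|l li].
  by rewrite big1 ?addr0 // => l li; rewrite big1 // => m _; rewrite mxE (negPf li) scale0r.
by rewrite mxE (negPf li) andbF scale0r.
Qed.

Lemma cospan_sub n (c : 'I_n -> 'I_n -> C) (W : {vspace C}) :
  (forall i j, c i j \in W) -> (limg (cospan c) <= W)%VS.
Proof.
move=> cW; apply/limg_subP => M _; rewrite cospanE.
by apply: memv_suml => i _; apply: memv_suml => j _; rewrite memvZ.
Qed.

Section Facts.
Variables (n : nat) (c : 'I_n -> 'I_n -> C) (u : 'I_n -> 'I_n -> A).
Hypotheses (cP : comatrix c) (uP : dual_comatrix c u).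

Lemma lop_comatrix f i j : lop f (c i j) = \sum_l (f (c i l) : k) *: c l j.
Proof.
apply: functional_ext => g; rewrite -convEl cP.1 linear_sum.
by apply: eq_bigr => l _; rewrite linearZ.
Qed.

Lemma rop_comatrix f i j : rop f (c i j) = \sum_l (f (c l j) : k) *: c i l.
Proof.
apply: functional_ext => g; rewrite -convE cP.1 linear_sum.
by apply: eq_bigr => l _; rewrite linearZ; exact: mulrC.
Qed.

Lemma dual_cospan i j M : u i j (cospan c M) = M i j :> k.
Proof.
rewrite cospanE linear_sum (bigD1 i) //= [X in _ + X]big1 => [|l li].
  rewrite addr0 linear_sum (bigD1 j) //= [X in _ + X]big1 => [|l li].
    by rewrite addr0 linearZ /= uP !eqxx; exact: mulr1.
  by rewrite linearZ /= uP (eq_sym j) (negPf li) andbF; exact: mulr0.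
rewrite linear_sum big1 // => m _; rewrite linearZ /= uP (eq_sym i) (negPf li).
exact: mulr0.
Qed.

Lemma cospan_expand x : x \in limg (cospan c) ->
  x = \sum_i \sum_j (u i j x : k) *: c i j.
Proof.
move=> /memv_imgP[M _ ->]; rewrite {1}cospanE; apply: eq_bigr => i _.
by apply: eq_bigr => j _; rewrite dual_cospan.
Qed.

Lemma dim_cospan : \dim (limg (cospan c)) = (n ^ 2)%N.
Proof.
have <- : \dim {:'M[k]_n} = (n ^ 2)%N by rewrite dimvf -mulnn; exact: dim_matrix.
apply: limg_dim_eq.
apply/eqP; rewrite -subv0; apply/subvP => M; rewrite memv_cap memv_ker memv0 => /andP[_ /eqP M0].
by apply/eqP/matrixP => i j; rewrite mxE -(dual_cospan i j) M0 linear0.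
Qed.

Lemma cospan_subcoalgebra : subcoalgebra (limg (cospan c)).
Proof.
apply/subcoalgebraP; split=> f x /cospan_expand ->; rewrite linear_sum;
  apply: memv_suml => i _; rewrite linear_sum; apply: memv_suml => j _;
  rewrite linearZ memvZ //= ?lop_comatrix ?rop_comatrix;
  by apply: memv_suml => l _; rewrite memvZ ?mem_cospan.
Qed.

Lemma lop_dual p r i j : lop (u p r) (c i j) = (p == i)%:R *: c r j.
Proof.
rewrite lop_comatrix (bigD1 r) //= uP eqxx andbT big1 ?addr0 // => l lr.
by rewrite uP (eq_sym r) (negPf lr) andbF scale0r.
Qed.

Lemma rop_dual s q i j : rop (u s q) (c i j) = (q == j)%:R *: c i s.
Proof.
rewrite rop_comatrix (bigD1 s) //= uP eqxx big1 ?addr0 // => l ls.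
by rewrite uP (eq_sym s) (negPf ls) scale0r.
Qed.

(** The dual system acts as matrix units: it carries a nonzero coefficient of an element to any
    prescribed entry, so a nonzero subcoalgebra contains all the entries. *)
Lemma cospan_simple : (0 < n)%N -> simple_subcoalgebra (limg (cospan c)).
Proof.
move=> n0; split; first exact: cospan_subcoalgebra.
  by rewrite -dimv_eq0 dim_cospan expn_eq0 andbT -lt0n n0.
move=> E /subcoalgebraP[lE rE] ED.
have [|E0] := eqVneq E 0%VS; [by left|right].
apply: subv_anti; rewrite ED /=; apply: cospan_sub => r s.
have eE : vpick E \in E by exact: memv_pick.
have e0 : vpick E != 0 by rewrite vpick0.
have [M _ eM] := memv_imgP (subvP ED _ eE).
have [p [q Mpq]] : exists p q, M p q != 0.
  apply: contrapT => H; move/negP: e0; apply; rewrite eM cospanE big1 // => p _.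
  rewrite big1 // => q _; have [->|] := eqVneq (M p q) 0; first exact: scale0r.
  by move=> Mpq; case: H; exists p, q.
have := memvZ (M p q)^-1 (rE (u s q) _ (lE (u p r) _ eE)).
suff -> : rop (u s q) (lop (u p r) (vpick E)) = M p q *: c r s.
  by rewrite scalerA mulVf // scale1r.
rewrite eM cospanE linear_sum (bigD1 p) //= [X in _ + X]big1 => [|i ip]; last first.
  rewrite linear_sum big1 // => j _.
  by rewrite linearZ /= lop_dual eq_sym (negPf ip) scale0r scaler0.
rewrite addr0 linear_sum linear_sum (bigD1 q) //= [X in _ + X]big1 => [|j jq]; last first.
  by rewrite linearZ /= lop_dual eqxx scale1r linearZ /= rop_dual eq_sym (negPf jq) scale0r scaler0.
by rewrite addr0 linearZ /= lop_dual eqxx scale1r linearZ /= rop_dual eqxx scale1r.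
Qed.

End Facts.
End Comatrix.

Lemma daddv_pi_ker (k : fieldType) (V : vectType k) (U W : {vspace V}) v :
  (U :&: W = 0)%VS -> v \in W -> daddv_pi U W v = 0.
Proof.
move=> UW vW; have := daddv_pi_add UW (subvP (addvSr U W) _ vW).
rewrite (@daddv_pi_id _ _ W U) 1?capvC // => /(canRL (addrK _)) ->.
by rewrite subrr.
Qed.

Section SimpleQuotient.
Variables (k : closedFieldType) (C : coalgebra k).
Notation A := 'Hom(C, k^o).
Implicit Types (f g : A).

(** Supplies a simple quotient X / X0 on which the dual algebra acts through [lop], the situation to
    which Burnside's theorem applies. *)
Lemma min_left_stable (X0 W : {vspace C}) : left_stable X0 -> left_stable W ->
  (X0 <= W)%VS -> X0 <> W ->
  exists X : {vspace C}, [/\ left_stable X, (X0 <= X <= W)%VS, X0 <> X &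
    forall Z : {vspace C}, left_stable Z -> (X0 <= Z <= X)%VS -> Z = X0 \/ Z = X].
Proof.
move=> lX0; move: {2}(\dim W) (leqnn (\dim W)) => n; elim: n W => [|n IH] W dW lW XW neq.
  by case: neq; apply: subv_anti; rewrite XW -(geq_leqif (dimv_leqif_sup XW)) (leq_trans dW).
have [H|] := pselect (forall Z : {vspace C}, left_stable Z -> (X0 <= Z <= W)%VS -> Z = X0 \/ Z = W).
  by exists W; rewrite XW subvv.
move=> /existsNP[Z /not_implyP[lZ /not_implyP[/andP[XZ ZW] /not_orP[ZX0 ZnW]]]].
have dZ : (\dim Z <= n)%N.
  rewrite -ltnS; apply: leq_trans dW; rewrite (ltn_leqif (dimv_leqif_sup ZW)).
  by apply/negP => WZ; apply: ZnW; apply: subv_anti; rewrite ZW.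
have [|X [lX /andP[X0X XZ'] nX mX]] := IH Z dZ lZ XZ; first by move=> /esym.
by exists X; split => //; rewrite X0X (subv_trans XZ' ZW).
Qed.

Variables (X0 X : {vspace C}).
Hypotheses (lX0 : left_stable X0) (lX : left_stable X) (X0X : (X0 <= X)%VS).
Hypothesis X0_neq : X0 <> X.
Hypothesis X_min : forall Z : {vspace C}, left_stable Z -> (X0 <= Z <= X)%VS ->
  Z = X0 \/ Z = X.


(** The dual algebra acts on the simple quotient X / X0, realised on the complement Y, and by
    Burnside's theorem the representation [phi] is onto all matrices. Its matrix coefficients are
    the c_ij, and preimages of the elementary matrices form the dual system. A functional that kills
    the coefficients acts by zero on X / X0. *)
Lemma simple_quotient_comatrix : exists n (c : 'I_n -> 'I_n -> C) u,
  [/\ (0 < n)%N, comatrix c, dual_comatrix c u,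
      forall f, (forall i j, f (c i j) = 0) -> forall x, x \in X -> lop f x \in X0 &
      forall D, subcoalgebra D -> (X <= D)%VS -> forall i j, c i j \in D].
Proof.
pose Y := (X :\: X0)%VS; pose n := \dim Y; pose b := vbasis Y.
have YX0 : (Y :&: X0 = 0)%VS by exact: capv_diff.
have YX : (Y + X0 = X)%VS by rewrite addv_diff; exact/addv_idPl.
have YsX : (Y <= X)%VS by exact: diffvSl.
have bY i : (i < n)%N -> b`_i \in Y by move=> ni; apply: vbasis_mem; rewrite mem_nth ?size_tuple.
pose pr := daddv_pi Y X0.
have pr_mod x : x \in X -> x - pr x \in X0.
  by rewrite -YX => /(daddv_pi_add YX0) {1}<-; rewrite addrAC subrr add0r memv_pi.
have pr0 x : x \in X0 -> pr x = 0 by exact: daddv_pi_ker.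
pose mf f : 'M[k]_n := \matrix_(i, j) coord b j (pr (lop f b`_i)).
have mf_lin : linear mf.
  by move=> a f g; apply/matrixP => i j; rewrite !mxE lopP !linearP.
pose phi : 'Hom(A, 'M[k]_n) := linfun mf.
have phiE f i j : phi f i j = coord b j (pr (lop f b`_i)).
  by rewrite linfunK // mxE.
pose vec (w : 'rV[k]_n) := \sum_i w 0 i *: b`_i.
have vecY w : vec w \in Y by apply: memv_suml => i _; rewrite memvZ ?bY.
have lop_vec f w : pr (lop f (vec w)) = vec (w *m phi f).
  rewrite linear_sum linear_sum /vec.
  under [RHS]eq_bigr do rewrite mxE scaler_suml.
  rewrite exchange_big /=; apply: eq_bigr => i _.
  rewrite !linearZ /= [in LHS](coord_vbasis (memv_pi Y X0 (lop f b`_i))) scaler_sumr.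
  by apply: eq_bigr => j _; rewrite phiE scalerA.
have vec_inj w w' : vec w = vec w' -> w = w'.
  move=> ww; apply/rowP => i.
  have cE v : coord b i (vec v) = v 0 i.
    by rewrite coord_sum_free // (basis_free (vbasisP _)).
  by rewrite -[LHS]cE ww cE.
have vec_delta (i : 'I_n) : vec (delta_mx 0 i) = b`_i.
  rewrite /vec (bigD1 i) //= mxE !eqxx scale1r big1 ?addr0 // => j ji.
  by rewrite mxE (negPf ji) scale0r.
have pr_vec w : pr (vec w) = vec w by exact: daddv_pi_id.
have phi_conv f g : phi (conv f g) = phi f *m phi g.
  apply/row_matrixP => i; rewrite !rowE mulmxA; apply: vec_inj.
  rewrite -!lop_vec -lop_lop vec_delta.
  have bX : b`_i \in X by rewrite (subvP YsX) ?bY.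
  apply/eqP; rewrite -subr_eq0 -!linearB; apply/eqP/pr0/lX0.
  exact/pr_mod/lX.
have phi1 : phi (counit C) = 1%:M.
  apply/row_matrixP => i; rewrite !rowE mulmx1; apply: vec_inj.
  by rewrite -lop_vec lop_counit pr_vec.
have phi_full : limg phi = fullv.
  apply: burnside => [_ _ /memv_imgP[f _ ->] /memv_imgP[g _ ->]|w v w0].
    by rewrite -phi_conv memv_img ?memvf.
  (* The orbit of w together with X0 is left stable between X0 and X, hence equal to one of them; it
     cannot be X0, as it contains w. *)
  pose L : 'Hom(A, C) := linfun (fun f => lop f (vec w)).
  have LE f : L f = lop f (vec w) by rewrite linfunK // => a x y; rewrite lopP.
  have [] := X_min (_ : left_stable (limg L + X0)%VS).
  - move=> f _ /memv_addP[_ /memv_imgP[g _ ->] [x xX0 ->]].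
    rewrite linearD memv_add //=; last exact: lX0.
    by rewrite LE lop_lop -LE memv_img ?memvf.
  - rewrite addvSr subv_add X0X andbT; apply/limg_subP => f _.
    by rewrite LE; apply/lX/(subvP YsX).
  - move=> LX0; have wX0 : vec w \in X0.
      by rewrite -LX0 -(lop_counit (vec w)) -LE (subvP (addvSl _ _)) // memv_img ?memvf.
    case/eqP: w0; apply: vec_inj; have := pr0 _ wX0; rewrite pr_vec => ->.
    by rewrite /vec big1 // => i _; rewrite mxE scale0r.
  - move=> LX; have := subvP YsX _ (vecY v); rewrite -LX.
    move=> /memv_addP[_ /memv_imgP[f _ ->] [x xX0 vE]].
    exists (phi f); first by rewrite memv_img ?memvf.
    by apply: vec_inj; rewrite -lop_vec -[RHS]pr_vec vE linearD /= (pr0 x) // addr0 LE.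
have n0 : (0 < n)%N.
  rewrite lt0n dimv_eq0 diffv_eq0; apply/negP => XX0; apply: X0_neq.
  by apply: subv_anti; rewrite X0X.
(* An entry of [phi] is a linear form on the dual of C, hence evaluation at this element of C. *)
pose c i j : C := \sum_l phi (bfun l) i j *: bvec l.
have fc (f : A) i j : f (c i j) = phi f i j :> k.
  rewrite linear_sum [in RHS](bfun_sum f) linear_sum summxE; apply: eq_bigr => l _.
  by rewrite !linearZ /= mxE; exact: mulrC.
have phi_inv i j : exists f, phi f = delta_mx i j.
  have := memvf (delta_mx i j : 'M[k]_n); rewrite -phi_full => /memv_imgP[f _ fE].
  by exists f.
pose u i j := projT1 (cid (phi_inv i j)).
have uE i j : phi (u i j) = delta_mx i j by rewrite /u; case: cid.
exists n, c, u; split => //.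
- split=> [f g i j|i j]; rewrite fc; last by rewrite phi1 mxE.
  by rewrite phi_conv mxE; apply: eq_bigr => l _; rewrite !fc.
- by move=> i j p q; rewrite fc uE mxE (eq_sym i) (eq_sym j).
- move=> f f0 x xX.
  have phi0 : phi f = 0 by apply/matrixP => i j; rewrite -fc f0 mxE.
  rewrite -(subrK (pr x) x) linearD memvD //; first exact/lX0/pr_mod.
  have prb : pr x = vec (\row_i coord b i (pr x)).
    rewrite {1}(coord_vbasis (memv_pi Y X0 x)).
    by apply: eq_bigr => i _; rewrite mxE.
  have prX : pr x \in X by rewrite (subvP YsX) ?memv_pi.
  have := pr_mod _ (lX f prX).
  rewrite [in pr (lop f _)]prb lop_vec phi0 mulmx0 /vec big1 ?subr0 // => i _.
  by rewrite mxE scale0r.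
- move=> D /subcoalgebraP[lD rD] XD i j; apply: functional_sep => f fD.
  rewrite fc phiE (_ : lop f b`_i = 0) ?linear0 //.
  have bD : b`_i \in D by rewrite (subvP XD) // (subvP YsX) ?bY.
  apply: functional_ext => h; rewrite linear0 -convEl convE.
  by apply/eqP; rewrite -memv_ker (subvP fD) // rD.
Qed.

End SimpleQuotient.

(** * Idempotents of the dual algebra *)

Section SimpleSubcoalgebras.
Variables (k : closedFieldType) (C : coalgebra k).
Implicit Types (D E W : {vspace C}).

(** A minimal nonzero left stable subspace of D produces a comatrix coalgebra inside D, which is D
    by simplicity. *)
Lemma simple_comatrix D : simple_subcoalgebra D ->
  exists n (c : 'I_n -> 'I_n -> C) u,
  [/\ (0 < n)%N, comatrix c, dual_comatrix c u & D = limg (cospan c)].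
Proof.
move=> [sD D0 mD]; have [lD rD] := (subcoalgebraP D).1 sD.
have l0 : left_stable (0%VS : {vspace C}) by have [] := (subcoalgebraP _).1 (subcoalgebra0 C).
have [||X [lX /andP[X0 XD] nX mX]] := min_left_stable l0 lD.
- exact: sub0v.
- by move=> D0'; rewrite -D0' eqxx in D0.
have [n [c [u [n0 cP uP _ cD]]]] := simple_quotient_comatrix l0 lX X0 nX mX.
exists n, c, u; split => //; have [sc c0 _] := cospan_simple cP uP n0.
have [c0'|//] := mD _ sc (cospan_sub (cD D sD XD)).
by rewrite c0' eqxx in c0.
Qed.

(** Suppose the filtration stops growing at C_n, short of C, and let X be minimal left stable above
    C_n. The coefficients of X / C_n span a simple subcoalgebra, so the radical acts by zero on X /
    C_n; this puts X inside C_(n+1), hence inside C_n. *)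
Lemma corad_filt_exhaust : exists n, corad_filt C n = fullv.
Proof.
apply: contrapT => H0.
have H n : corad_filt C n <> fullv by move=> Cn; apply: H0; exists n.
suff dimC n : (n <= \dim (corad_filt C n))%N.
  by have := leq_trans (dimC (\dim {:C}).+1) (dimvS (subvf _)); rewrite ltnn.
elim: n => // n IH; apply: leq_ltn_trans IH _.
rewrite (ltn_leqif (dimv_leqif_sup (corad_filt_sub C (leqnSn n)))).
apply/negP => CSn; have [lC _] := corad_filt_stable C n.
have [|||X [lX /andP[CX _] nX mX]] := @min_left_stable k C (corad_filt C n) fullv lC.
- by move=> f c _; exact: memvf.
- exact: subvf.
- exact: H.
have [m [c [u [m0 cP uP cX cD]]]] := simple_quotient_comatrix lC lX CX nX mX.
case: nX; apply: subv_anti; rewrite CX /=; apply: subv_trans CSn.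
apply/subvP => x xX; apply/corad_filtS => f /radfunP fJ.
apply: cX xX => i j; apply: fJ.
by rewrite (subvP (sumv_of_sup (cospan_simple cP uP m0))) ?mem_cospan.
Qed.

End SimpleSubcoalgebras.

Section SimpleList.
Variables (k : fieldType) (C : coalgebra k).
Implicit Types (D E U W : {vspace C}).

Lemma simple_cap D E : simple_subcoalgebra D -> simple_subcoalgebra E -> D <> E ->
  (D :&: E = 0)%VS.
Proof.
move=> [sD D0 mD] [sE E0 mE] DE.
have [//|DE'] := mD _ (subcoalgebraI sD sE) (capvSl _ _).
have [//|ED] := mE _ (subcoalgebraI sD sE) (capvSr _ _).
by case: DE; rewrite -[LHS]DE'.
Qed.

(** The functional f is the counit on U and zero on W1, so [lop f] fixes U and kills W1. An element
    w1 + w2 of U is thereby equal to [lop f w2], which lies in W2. *)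
Lemma subcoalgebra_cap_add U W1 W2 :
  subcoalgebra U -> subcoalgebra W1 -> subcoalgebra W2 ->
  (U :&: W1 = 0)%VS -> (U :&: W2 = 0)%VS -> (U :&: (W1 + W2) = 0)%VS.
Proof.
move=> /subcoalgebraP[lU rU] /subcoalgebraP[lW rW] sW2 UW1 UW2.
apply/eqP; rewrite -subv0; apply/subvP => x; rewrite memv_cap => /andP[xU].
move=> /memv_addP[w1 w1W [w2 w2W xE]].
pose f : 'Hom(C, k^o) := (counit C \o daddv_pi U W1)%VF.
have fx : lop f x = x.
  apply: functional_ext => h.
  by rewrite -convEl convE comp_lfunE daddv_pi_id ?counit_rop // rU.
have f1 : lop f w1 = 0.
  apply: functional_ext => h.
  by rewrite -convEl convE comp_lfunE daddv_pi_ker ?linear0 // rW.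
have xw2 : x = lop f w2 by move: fx; rewrite {1}xE linearD /= f1 add0r => <-.
have /subcoalgebraP[lW2 _] := sW2.
by rewrite -UW2 memv_cap xU xw2 lW2.
Qed.

(** Finitely many simple subcoalgebras have the coradical as their sum; any other one would meet
    that sum trivially although it is contained in it. *)
Lemma simple_list : exists2 s : seq {vspace C}, uniq s &
  forall D, D \in s <-> simple_subcoalgebra D.
Proof.
have [s0 s0P cE] := sumv_of_finite (@simple_subcoalgebra k C).
exists (undup s0); rewrite ?undup_uniq // => D; rewrite mem_undup; split; first exact: s0P.
move=> sD; apply: contrapT => /negP Ds.
suff [_ D0] : subcoalgebra (\sum_(E <- s0) E)%VS /\ (D :&: (\sum_(E <- s0) E) = 0)%VS.
  have : (D <= 0)%VS by rewrite -D0 -cE subv_cap subvv; exact: sumv_of_sup.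
  by rewrite subv0; apply/negP; case: sD.
rewrite big_seq; elim/big_rec: _ => [|E W Es [sW DW]].
  by split; [exact: subcoalgebra0|rewrite capv0].
have sE := s0P _ Es; split; first by apply: subcoalgebraD => //; case: sE.
apply: subcoalgebra_cap_add => //; [by case: sD|by case: sE|].
by apply: simple_cap => // DE; rewrite DE Es in Ds.
Qed.

End SimpleList.

Section Idempotents.
Variables (k : fieldType) (C : coalgebra k).
Variables (pi : 'End(C)) (piP : coradical_projection pi).
Variables (s : seq {vspace C}) (s_uniq : uniq s).
Hypothesis sP : forall D, D \in s <-> simple_subcoalgebra D.
Notation A := 'Hom(C, k^o).
Implicit Types (f g h : A) (D E : {vspace C}) (P : pred {vspace C}).

Lemma simple_stable D : D \in s -> left_stable D /\ right_stable D.
Proof. by move=> /sP[/subcoalgebraP]. Qed.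

Lemma simple_coradical D : D \in s -> (D <= coradical C)%VS.
Proof. by move=> /sP; exact: sumv_of_sup. Qed.

Lemma pi_id x : x \in coradical C -> pi x = x.
Proof. by have [_ H _ _] := piP; exact: H. Qed.

Lemma mem_pi x : pi x \in coradical C.
Proof. by have [<- _ _ _] := piP; rewrite memv_img ?memvf. Qed.

Lemma rop_pi f c : rop f (pi c) = pi (rop (f \o pi)%VF c).
Proof. by have [_ _ H _] := piP; rewrite ropE H rsl_tmap -ropE. Qed.

(** As [pi] is a coalgebra map, these functionals form a subalgebra, and it contains exactly one
    element of each class modulo the radical: a lift of the semisimple quotient. *)
Definition pifun f := (f \o pi)%VF = f.

Lemma pifunE f c : pifun f -> f (pi c) = f c.
Proof. by move=> fp; rewrite -comp_lfunE fp. Qed.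

Lemma pifun_comp f : pifun (f \o pi)%VF.
Proof. by apply/lfunP => c; rewrite !comp_lfunE (pi_id (mem_pi c)). Qed.

Lemma pifun_counit : pifun (counit C).
Proof. by have [_ _ _ H] := piP; apply/lfunP => c; rewrite comp_lfunE. Qed.

Lemma pifun_conv f g : pifun f -> pifun g -> pifun (conv f g).
Proof.
move=> fp gp; apply/lfunP => c.
by rewrite comp_lfunE !convE rop_pi gp pifunE.
Qed.

Lemma pifun_lin f g a : pifun f -> pifun g -> pifun (a *: f + g).
Proof.
move=> fp gp; apply/lfunP => c.
by rewrite comp_lfunE !add_lfunE !scale_lfunE !pifunE.
Qed.

Lemma pifun0 : pifun 0.
Proof. exact: comp_lfun0l. Qed.

Lemma pifunZ f a : pifun f -> pifun (a *: f).
Proof. by move=> fp; rewrite -[_ *: f]addr0; apply: pifun_lin => //; exact: pifun0. Qed.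

Lemma pifunD f g : pifun f -> pifun g -> pifun (f + g).
Proof. by move=> fp gp; rewrite -[f]scale1r; exact: pifun_lin. Qed.

Lemma pifun_sum I (r : seq I) (Pr : pred I) (F : I -> A) :
  (forall i, Pr i -> pifun (F i)) -> pifun (\sum_(i <- r | Pr i) F i).
Proof. by move=> H; elim/big_rec: _ => [|i f /H Fi fp]; [exact: pifun0|exact: pifunD]. Qed.

Lemma coradical_ext f g : (forall D x, D \in s -> x \in D -> f x = g x) ->
  radfun (f - g).
Proof.
move=> fg; apply/sumv_ofP => D /sP Ds.
by apply/subvP => x xD; rewrite memv_ker add_lfunE opp_lfunE (fg D) ?subrr.
Qed.

Lemma pifun_ext f g : pifun f -> pifun g ->
  (forall D x, D \in s -> x \in D -> f x = g x) -> f = g.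
Proof.
move=> fp gp /coradical_ext/radfunP fg; apply/lfunP => c.
apply/eqP; rewrite -(pifunE _ fp) -(pifunE _ gp) -subr_eq0 -opp_lfunE -add_lfunE.
by rewrite fg // mem_pi.
Qed.

Definition other D : {vspace C} := (\sum_(E <- s | E != D) E)%VS.

Lemma other_cap D : D \in s -> (D :&: other D = 0)%VS.
Proof.
move=> Ds; have sD := (sP D).1 Ds.
suff [] : subcoalgebra (other D) /\ (D :&: other D = 0)%VS by [].
rewrite /other big_seq_cond; elim/big_rec: _ => [|E W /andP[Es /eqP ED] [sW DW]].
  by split; [exact: subcoalgebra0|rewrite capv0].
have sE := (sP _).1 Es; split; first by apply: subcoalgebraD => //; case: sE.
apply: subcoalgebra_cap_add => //; [by case: sD|by case: sE|].
by apply: simple_cap => // /esym.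
Qed.

Lemma sub_other D E : E \in s -> E != D -> (E <= other D)%VS.
Proof. by move=> Es ED; rewrite /other (big_rem E) //= ED addvSl. Qed.

Definition extfun D f : A := (f \o daddv_pi D (other D) \o pi)%VF.

Lemma pifun_ext_fun D f : pifun (extfun D f).
Proof. exact: pifun_comp. Qed.

Lemma extfunE D E f x : D \in s -> E \in s -> x \in E ->
  extfun D f x = if E == D then f x else 0.
Proof.
move=> Ds Es xE; rewrite !comp_lfunE pi_id ?(subvP (simple_coradical Es)) //.
have [ED|ED] := eqVneq E D; first by rewrite daddv_pi_id ?other_cap // -ED.
by rewrite daddv_pi_ker ?linear0 ?other_cap // (subvP (sub_other Es ED)).
Qed.

(** Indexing by a predicate covers with one construction the idempotent of a single simple
    subcoalgebra, that of all those of a given dimension, and the identity. *)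
Definition eidem P : A := \sum_(D <- s | P D) extfun D (counit C).

Lemma pifun_eidem P : pifun (eidem P).
Proof. by apply: pifun_sum => D _; exact: pifun_ext_fun. Qed.

Lemma eidemE P E x : E \in s -> x \in E ->
  eidem P x = if P E then counit C x else 0.
Proof.
move=> Es xE; rewrite sum_lfunE big_seq_cond.
rewrite (eq_bigr (fun D => if D == E then counit C x else 0)); last first.
  by move=> D /andP[Ds _]; rewrite (extfunE _ Ds Es) // eq_sym.
rewrite -big_mkcondr /=; have [PE|PE] := boolP (P E).
  rewrite -big_filter (_ : [seq _ <- _ | _] = [:: E]) ?big_seq1 //.
  rewrite -(filter_pred1_uniq s_uniq Es); apply: eq_in_filter => D Ds.
  by rewrite Ds /=; case: eqP => [->|_]; rewrite ?PE ?andbF.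
by rewrite big1 // => D /andP[/andP[_ PD] /eqP DE]; rewrite -DE PD in PE.
Qed.

Lemma lop_eidem P E x : E \in s -> x \in E -> lop (eidem P) x = if P E then x else 0.
Proof.
move=> Es xE; have [_ rE] := simple_stable Es.
apply: functional_ext => h; rewrite -convEl convE (eidemE _ Es) ?rE //.
by case: (P E); rewrite ?linear0 // counit_rop.
Qed.

Lemma rop_eidem P E x : E \in s -> x \in E -> rop (eidem P) x = if P E then x else 0.
Proof.
move=> Es xE; have [lE _] := simple_stable Es.
apply: functional_ext => h; rewrite -convE convEl (eidemE _ Es) ?lE //.
by case: (P E); rewrite ?linear0 // counit_lop.
Qed.

Lemma conv_eidem P Q : conv (eidem P) (eidem Q) = eidem (predI P Q).
Proof.
apply: pifun_ext => [||E x Es xE]; [|exact: pifun_eidem|].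
  by apply: pifun_conv; exact: pifun_eidem.
rewrite convE (rop_eidem _ Es xE) (eidemE (predI P Q) Es xE) /=.
by case: (Q E); rewrite ?linear0 ?andbF // (eidemE _ Es xE) andbT.
Qed.

Lemma eidemT : eidem predT = counit C.
Proof.
apply: pifun_ext => [||E x Es xE]; [exact: pifun_eidem|exact: pifun_counit|].
by rewrite (eidemE _ Es).
Qed.

Lemma eq_eidem P Q : {in s, P =1 Q} -> eidem P = eidem Q.
Proof.
move=> PQ; rewrite /eidem big_seq_cond [RHS]big_seq_cond; apply: eq_bigl => D.
by case Ds: (D \in s) => //=; rewrite PQ.
Qed.

Lemma eidem_sum1 P : eidem P = \sum_(D <- s | P D) eidem (pred1 D).
Proof.
rewrite /eidem big_seq_cond [RHS]big_seq_cond; apply: eq_bigr => D /andP[Ds _].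
by rewrite -big_filter filter_pred1_uniq // big_seq1.
Qed.

(** Centrality holds only modulo the radical, which is enough on graded pieces. *)
Lemma eidem_central f P : radfun (conv f (eidem P) - conv (eidem P) f).
Proof.
apply: coradical_ext => E x Es xE.
rewrite convE (rop_eidem _ Es) // convEl (lop_eidem _ Es) //.
Qed.

End Idempotents.

Section MatrixUnits.
Variables (k : fieldType) (C : coalgebra k).
Variables (pi : 'End(C)) (piP : coradical_projection pi).
Variables (s : seq {vspace C}) (s_uniq : uniq s).
Hypothesis sP : forall D, D \in s <-> simple_subcoalgebra D.
Notation A := 'Hom(C, k^o).
Implicit Types (f g h : A).

Variables (D : {vspace C}) (n : nat) (c : 'I_n -> 'I_n -> C) (u : 'I_n -> 'I_n -> A).
Hypotheses (Ds : D \in s) (cP : comatrix c) (uP : dual_comatrix c u).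
Hypothesis Dc : D = limg (cospan c).

(** The matrix units of the factor dual to D in the semisimple quotient, lifted along [pi]. *)
Definition munit i j : A := extfun pi s D (u i j).

Lemma comatrix_in i j : c i j \in D.
Proof. by rewrite Dc mem_cospan. Qed.

Lemma pifun_munit i j : pifun pi (munit i j).
Proof. exact: pifun_ext_fun. Qed.

Lemma munit_comatrix i j p q : munit i j (c p q) = ((i == p) && (j == q))%:R :> k.
Proof. by rewrite /munit (extfunE piP sP _ Ds Ds) ?comatrix_in // eqxx uP. Qed.

Lemma munit_out E x i j : E \in s -> x \in E -> E != D -> munit i j x = 0.
Proof. by move=> Es xE /negPf ED; rewrite /munit (extfunE piP sP _ Ds Es) // ED. Qed.

Lemma comatrix_ext f g : pifun pi f -> pifun pi g ->
  (forall E x, E \in s -> x \in E -> E != D -> f x = g x) ->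
  (forall i j, f (c i j) = g (c i j)) -> f = g.
Proof.
move=> fp gp fgE fgc; apply: (pifun_ext piP sP) => // E x Es xE.
have [ED|/fgE] := eqVneq E D; last exact.
move: xE; rewrite ED Dc => /(cospan_expand uP) ->; rewrite !linear_sum.
by apply: eq_bigr => i _; rewrite !linear_sum; apply: eq_bigr => j _; rewrite !linearZ /= fgc.
Qed.

Lemma munit_conv i j p q :
  conv (munit i j) (munit p q) = if j == p then munit i q else 0.
Proof.
apply: comatrix_ext => [||E x Es xE ED|a b].
- by apply: (pifun_conv piP); exact: pifun_munit.
- by case: eqP => _; [exact: pifun_munit|exact: pifun0].
- have [lE _] := simple_stable sP Es.
  rewrite convEl (munit_out _ _ Es) ?lE //.
  by case: eqP => _; rewrite ?zero_lfunE // (munit_out _ _ Es).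
- rewrite cP.1 (bigD1 j) //= [X in _ + X]big1 => [|l lj].
    rewrite addr0 !munit_comatrix eqxx andbT (eq_sym j).
    case: (p == j); rewrite ?zero_lfunE ?mulr0 // munit_comatrix.
    by case: (i == a); rewrite ?mul0r ?mul1r.
  by rewrite !munit_comatrix (eq_sym j) (negPf lj) andbF mul0r.
Qed.

Lemma munit_sum : \sum_i munit i i = eidem pi s (pred1 D).
Proof.
apply: comatrix_ext => [||E x Es xE ED|a b].
- by apply: pifun_sum => i _; exact: pifun_munit.
- exact: pifun_eidem.
- rewrite (eidemE piP s_uniq sP _ Es) //= (negPf ED) sum_lfunE big1 // => i _.
  exact: munit_out xE ED.
- rewrite (eidemE piP s_uniq sP _ Ds) ?comatrix_in //= eqxx cP.2 sum_lfunE.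
  rewrite (bigD1 a) //= [X in _ + X]big1 => [|l la].
    by rewrite addr0 munit_comatrix eqxx.
  by rewrite munit_comatrix (negPf la).
Qed.

Lemma munit_expand f : pifun pi f ->
  conv (eidem pi s (pred1 D)) f = \sum_i \sum_j (f (c i j) : k) *: munit i j.
Proof.
move=> fp; apply: comatrix_ext => [||E x Es xE ED|a b].
- by apply: (pifun_conv piP) => //; exact: pifun_eidem.
- by do 2!apply: pifun_sum => ? _; apply: pifunZ => //; exact: pifun_munit.
- rewrite convEl (lop_eidem piP s_uniq sP _ Es) //= (negPf ED) linear0.
  rewrite sum_lfunE big1 // => i _; rewrite sum_lfunE big1 // => j _.
  by rewrite scale_lfunE (munit_out _ _ Es xE ED) scaler0.
- rewrite convEl (lop_eidem piP s_uniq sP _ Ds) ?comatrix_in //= eqxx.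
  rewrite sum_lfunE (bigD1 a) //= [X in _ + X]big1 => [|l la]; last first.
    by rewrite sum_lfunE big1 // => m _; rewrite scale_lfunE munit_comatrix (negPf la) scaler0.
  rewrite addr0 sum_lfunE (bigD1 b) //= [X in _ + X]big1 => [|l lb].
    by rewrite addr0 scale_lfunE munit_comatrix !eqxx /=; symmetry; exact: mulr1.
  by rewrite scale_lfunE munit_comatrix (negPf lb) andbF scaler0.
Qed.

Lemma munit_expandr f : pifun pi f ->
  conv f (eidem pi s (pred1 D)) = \sum_i \sum_j (f (c i j) : k) *: munit i j.
Proof.
move=> fp; rewrite -munit_expand //; apply: (pifun_ext piP sP).
- by apply: (pifun_conv piP) => //; exact: pifun_eidem.
- by apply: (pifun_conv piP) => //; exact: pifun_eidem.
move=> E x Es xE; rewrite convE convEl (rop_eidem piP s_uniq sP _ Es) //.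
by rewrite (lop_eidem piP s_uniq sP _ Es).
Qed.

End MatrixUnits.

(** * Subbicomodules of C and the simple ones of a given type *)

Section Subbicomodules.
Variables (k : fieldType) (C : coalgebra k) (pi : 'End(C)).
Hypothesis piP : coradical_projection pi.
Implicit Types (f : 'Hom(C, k^o)) (M : {vspace C}).

Lemma lsl_rhoL f x : lsl f (rhoL pi x) = lop (f \o pi)%VF x.
Proof. by rewrite comp_lfunE lsl_tmap id_lfunE lopE. Qed.

Lemma rsl_rhoR f x : rsl f (rhoR pi x) = rop (f \o pi)%VF x.
Proof. by rewrite comp_lfunE rsl_tmap id_lfunE ropE. Qed.

(** Slicing the coactions by f gives the actions of f \o pi, so bicomodules over the coradical
    amount to bimodules over the functionals that factor through [pi]. *)
Lemma subbicomoduleP M : subbicomodule pi M <->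
  (forall f c, pifun pi f -> c \in M -> lop f c \in M /\ rop f c \in M).
Proof.
split=> [[/limg_subP lM /limg_subP rM] f c fp cM|H].
  have [l _] := (tensvP _ _ _).1 (lM _ cM); have [_ r] := (tensvP _ _ _).1 (rM _ cM).
  by move: (l f) (r f); rewrite lsl_rhoL rsl_rhoR fp.
split; apply/limg_subP => c cM; apply/tensvP; split=> f.
- by rewrite lsl_rhoL; have [? _] := H _ _ (pifun_comp piP f) cM.
- by rewrite comp_lfunE rsl_tmap (mem_pi piP).
- by rewrite comp_lfunE lsl_tmap (mem_pi piP).
- by rewrite rsl_rhoR; have [_ ?] := H _ _ (pifun_comp piP f) cM.
Qed.

Lemma left_comoduleP (V : vectType k) (lam : 'Hom(V, tensor C V)) :
  (forall f g v, lsl g (lam (lsl f (lam v))) = lsl (conv f g) (lam v)) ->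
  (forall v, lsl (counit C) (lam v) = v) -> left_comodule lam.
Proof.
move=> lamA lam1; split=> [v|v]; last by rewrite -lslE lam1.
apply: lsl_ext => f; apply: lsl_ext => g; rewrite !linear_tlift /=.
transitivity (lsl (conv f g) (lam v)).
  rewrite lslE; apply: eq_tlift => c v0; rewrite !linear_tlift /=.
  rewrite convEl lopE lslE linear_tlift /= /tlift scaler_suml.
  apply: eq_bigr => i _; rewrite scaler_suml; apply: eq_bigr => j _.
  rewrite lsl_tens linearZ /= lsl_tens linearZ /= !scalerA.
  by rewrite linearZ /= -mulrA; congr (_ *: _); exact: mulrCA.
rewrite -lamA [lsl f _]lslE !linear_tlift; apply: eq_tlift => c v0 /=.
by rewrite lsl_tens !linearZ.
Qed.

Lemma right_comoduleP (V : vectType k) (rho : 'Hom(V, tensor V C)) :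
  (forall f g v, rsl f (rho (rsl g (rho v))) = rsl (conv f g) (rho v)) ->
  (forall v, rsl (counit C) (rho v) = v) -> right_comodule rho.
Proof.
move=> rhoA rho1; split=> [v|v]; last by rewrite -rslE rho1.
apply: lsl_ext => h; apply: lsl_ext => f; apply: functional_ext => g.
rewrite !linear_tlift /=.
transitivity (h (rsl (conv f g) (rho v))).
  rewrite -rhoA [rsl g _]rslE !linear_tlift; apply: eq_tlift => v0 c /=.
  rewrite !linearZ /= rslE !linear_tlift /=; apply: eq_tlift => x y.
  rewrite lsl_tens !linearZ /= lsl_tens !linearZ /=.
  have E (a b d : k) : a * (b * d) = d * (a * b) by rewrite mulrA mulrC.
  exact: E.
rewrite rslE !linear_tlift; apply: eq_tlift => v0 c /=.
by rewrite lsl_tens !linearZ /= -lopE -convEl; exact: mulrC.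
Qed.

End Subbicomodules.

Section RowComodules.
Variables (k : fieldType) (C : coalgebra k).
Implicit Types (f g : 'Hom(C, k^o)).
Variables (n : nat) (c : 'I_n -> 'I_n -> C) (u : 'I_n -> 'I_n -> 'Hom(C, k^o)).
Hypotheses (n0 : (0 < n)%N) (cP : comatrix c) (uP : dual_comatrix c u).

Definition evmx f : 'M[k]_n := \matrix_(i, j) f (c i j).

Lemma evmx_conv f g : evmx (conv f g) = evmx f *m evmx g.
Proof. by apply/matrixP => i j; rewrite !mxE cP.1; apply: eq_bigr => l _; rewrite !mxE. Qed.

Lemma evmx_counit : evmx (counit C) = 1%:M.
Proof. by apply/matrixP => i j; rewrite !mxE cP.2. Qed.

Lemma evmx_dual i j : evmx (u i j) = delta_mx i j.
Proof. by apply/matrixP => p q; rewrite !mxE uP (eq_sym p) (eq_sym q). Qed.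

Definition row_coact : 'Hom('rV[k]_n, tensor C 'rV[k]_n) :=
  linfun (fun l : 'rV[k]_n =>
    \sum_q tens (\sum_i l 0 i *: c i q) (delta_mx 0 q : 'rV[k]_n)).

Lemma row_coactE l :
  row_coact l = \sum_q tens (\sum_i l 0 i *: c i q) (delta_mx 0 q : 'rV[k]_n).
Proof.
rewrite linfunK // => a x y; rewrite scaler_sumr -big_split; apply: eq_bigr => q _ /=.
rewrite -tens_linearl scaler_sumr -big_split; congr (tens _ _); apply: eq_bigr => i _ /=.
by rewrite !mxE scalerDl scalerA.
Qed.

Lemma lsl_row_coact f l : lsl f (row_coact l) = l *m evmx f.
Proof.
rewrite row_coactE linear_sum [RHS]row_sum_delta; apply: eq_bigr => q _ /=.
rewrite lsl_tens; congr (_ *: _); rewrite linear_sum mxE; apply: eq_bigr => i _.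
by rewrite linearZ mxE.
Qed.

Definition col_coact : 'Hom('rV[k]_n, tensor 'rV[k]_n C) :=
  linfun (fun r : 'rV[k]_n =>
    \sum_q tens (delta_mx 0 q : 'rV[k]_n) (\sum_j r 0 j *: c q j)).

Lemma col_coactE r :
  col_coact r = \sum_q tens (delta_mx 0 q : 'rV[k]_n) (\sum_j r 0 j *: c q j).
Proof.
rewrite linfunK // => a x y; rewrite scaler_sumr -big_split; apply: eq_bigr => q _ /=.
rewrite -tens_linearr scaler_sumr -big_split; congr (tens _ _); apply: eq_bigr => i _ /=.
by rewrite !mxE scalerDl scalerA.
Qed.

Lemma rsl_col_coact f r : rsl f (col_coact r) = r *m (evmx f)^T.
Proof.
rewrite col_coactE linear_sum [RHS]row_sum_delta; apply: eq_bigr => q _ /=.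
rewrite rsl_tens; congr (_ *: _); rewrite linear_sum mxE; apply: eq_bigr => i _.
by rewrite linearZ !mxE.
Qed.

Let rowV_neq0 : fullv != 0%VS :> {vspace 'rV[k]_n}.
Proof.
have d : \dim {:'rV[k]_n} = n by rewrite dimvf -[RHS]mul1n; exact: dim_matrix.
by rewrite -dimv_eq0 d -lt0n.
Qed.

(** Matrix units carry a nonzero coordinate of a vector of W to any position, so W contains every
    basis vector. *)
Lemma row_simple : simple_left_comodule (limg (cospan c)) row_coact.
Proof.
split=> //.
- apply: left_comoduleP => [f g v|v]; rewrite !lsl_row_coact.
    by rewrite evmx_conv mulmxA.
  by rewrite evmx_counit mulmx1.
- apply/limg_subP => l _; rewrite row_coactE; apply: memv_suml => q _.
  apply: mem_tens; rewrite ?memvf //; apply: memv_suml => i _.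
  by rewrite memvZ ?mem_cospan.
move=> W /limg_subP WD; have [|W0] := eqVneq W 0%VS; [by left|right].
pose x := vpick W; have xW : x \in W := memv_pick W.
have x0 : x != 0 by rewrite vpick0.
have /rV0Pn[p xp] := x0.
apply: subv_anti; rewrite subvf; apply/subvP => y _.
rewrite (row_sum_delta y); apply: memv_suml => q _; rewrite memvZ //.
have [/(_ (u p q)) + _] := (tensvP _ _ _).1 (WD _ xW).
rewrite lsl_row_coact evmx_dual => H.
have := memvZ (x 0 p)^-1 H; congr (_ \in W).
by apply/rowP => j; rewrite !mxE (bigD1 p) //= big1 => [|i ip]; rewrite !mxE ?eqxx
  ?addr0 ?mulKf // (negPf ip) mulr0.
Qed.

Lemma col_simple : simple_right_comodule (limg (cospan c)) col_coact.
Proof.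
split=> //.
- apply: right_comoduleP => [f g v|v]; rewrite !rsl_col_coact.
    by rewrite evmx_conv trmx_mul mulmxA.
  by rewrite evmx_counit trmx1 mulmx1.
- apply/limg_subP => l _; rewrite col_coactE; apply: memv_suml => q _.
  apply: mem_tens; rewrite ?memvf //; apply: memv_suml => i _.
  by rewrite memvZ ?mem_cospan.
move=> W /limg_subP WD; have [|W0] := eqVneq W 0%VS; [by left|right].
pose x := vpick W; have xW : x \in W := memv_pick W.
have x0 : x != 0 by rewrite vpick0.
have /rV0Pn[p xp] := x0.
apply: subv_anti; rewrite subvf; apply/subvP => y _.
rewrite (row_sum_delta y); apply: memv_suml => q _; rewrite memvZ //.
have [_ /(_ (u q p)) +] := (tensvP _ _ _).1 (WD _ xW).
rewrite rsl_col_coact evmx_dual => H.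
have := memvZ (x 0 p)^-1 H; congr (_ \in W).
by apply/rowP => j; rewrite !mxE (bigD1 p) //= big1 => [|i ip]; rewrite !mxE ?eqxx
  ?addr0 ?andbT ?mulKf // (negPf ip) andbF mulr0.
Qed.

End RowComodules.

Section Generated.
Variables (k : fieldType) (C : coalgebra k).
Variables (pi : 'End(C)) (piP : coradical_projection pi).
Variables (s : seq {vspace C}) (s_uniq : uniq s).
Hypothesis sP : forall D, D \in s <-> simple_subcoalgebra D.
Notation A := 'Hom(C, k^o).
Implicit Types (f g h : A).

Variables (D E : {vspace C}) (n m : nat).
Variables (c : 'I_n -> 'I_n -> C) (u : 'I_n -> 'I_n -> A).
Variables (b : 'I_m -> 'I_m -> C) (v : 'I_m -> 'I_m -> A).
Hypotheses (Ds : D \in s) (cP : comatrix c) (uP : dual_comatrix c u).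
Hypotheses (Dc : D = limg (cospan c)).
Hypotheses (Es : E \in s) (bP : comatrix b) (vP : dual_comatrix b v).
Hypotheses (Eb : E = limg (cospan b)).

Let U := munit pi s D u.
Let V := munit pi s E v.
Let Uconv := munit_conv piP sP Ds cP uP Dc.
Let Vconv := munit_conv piP sP Es bP vP Eb.

Variables (i0 : 'I_n) (j0 : 'I_m) (w : C).
Hypotheses (w0 : w != 0) (wU : lop (U i0 i0) w = w) (wV : rop (V j0 j0) w = w).

(** The seed w occupies position (i0, j0); the matrix units spread it to a family that transforms
    like the basis e_i (x) e_j of V_D^* (x) V_E. *)
Definition gvec i j : C := lop (U i0 i) (rop (V j j0) w).

Lemma lop_gvec p q i j : lop (U p q) (gvec i j) = if i == p then gvec q j else 0.
Proof.
rewrite /gvec lop_lop Uconv; case: (i == p) => //.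
by rewrite linear0 zero_lfunE.
Qed.

Lemma rop_gvec p q i j : rop (V p q) (gvec i j) = if q == j then gvec i p else 0.
Proof.
rewrite /gvec -lop_rop rop_rop Vconv; case: (q == j) => //.
by rewrite linear0 zero_lfunE linear0.
Qed.

Lemma gvec0 : gvec i0 j0 = w.
Proof. by rewrite /gvec wV wU. Qed.

Lemma gvec_eidemD i j : lop (eidem pi s (pred1 D)) (gvec i j) = gvec i j.
Proof.
rewrite -(munit_sum piP s_uniq sP Ds cP uP Dc) linear_sum sum_lfunE (bigD1 i) //=.
by rewrite lop_gvec eqxx big1 ?addr0 // => l li; rewrite lop_gvec eq_sym (negPf li).
Qed.

Lemma gvec_eidemE i j : rop (eidem pi s (pred1 E)) (gvec i j) = gvec i j.
Proof.
rewrite -(munit_sum piP s_uniq sP Es bP vP Eb) linear_sum sum_lfunE (bigD1 j) //=.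
by rewrite rop_gvec eqxx big1 ?addr0 // => l lj; rewrite rop_gvec (negPf lj).
Qed.

Lemma lop_pi_gvec f i j :
  lop (f \o pi)%VF (gvec i j) = \sum_q (f (c i q) : k) *: gvec q j.
Proof.
have fp := pifun_comp piP f.
have fc p q : (f \o pi)%VF (c p q) = f (c p q).
  by rewrite comp_lfunE (pi_id piP) // (subvP (simple_coradical sP Ds)) // (comatrix_in Dc).
rewrite -[in LHS](gvec_eidemD i j) lop_lop (munit_expand piP s_uniq sP Ds uP Dc fp).
rewrite linear_sum sum_lfunE (bigD1 i) //= [X in _ + X]big1 => [|l li].
  rewrite addr0 linear_sum sum_lfunE; apply: eq_bigr => q _.
  by rewrite linearZ /= scale_lfunE lop_gvec eqxx fc.
rewrite linear_sum sum_lfunE big1 // => q _.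
by rewrite linearZ /= scale_lfunE lop_gvec eq_sym (negPf li) scaler0.
Qed.

Lemma rop_pi_gvec f i j :
  rop (f \o pi)%VF (gvec i j) = \sum_q (f (b q j) : k) *: gvec i q.
Proof.
have fp := pifun_comp piP f.
have fc p q : (f \o pi)%VF (b p q) = f (b p q).
  by rewrite comp_lfunE (pi_id piP) // (subvP (simple_coradical sP Es)) // (comatrix_in Eb).
rewrite -[in LHS](gvec_eidemE i j) rop_rop (munit_expandr piP s_uniq sP Es vP Eb fp).
rewrite linear_sum sum_lfunE; apply: eq_bigr => q _.
rewrite linear_sum sum_lfunE (bigD1 j) //= [X in _ + X]big1 => [|l lj].
  by rewrite addr0 linearZ /= scale_lfunE rop_gvec eqxx fc.
by rewrite linearZ /= scale_lfunE rop_gvec (negPf lj) scaler0.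
Qed.

Definition gmap : 'Hom(tensor 'rV[k]_n 'rV[k]_m, C) :=
  linfun (tlift (fun (l : 'rV[k]_n) (r : 'rV[k]_m) =>
    \sum_i \sum_j (l 0 i * r 0 j) *: gvec i j)).

Lemma gmap_tens l r : gmap (tens l r) = \sum_i \sum_j (l 0 i * r 0 j) *: gvec i j.
Proof.
rewrite lfunE /= tlift_tens // => [y|x] a z t; rewrite scaler_sumr -big_split;
  apply: eq_bigr => i _; rewrite scaler_sumr -big_split; apply: eq_bigr => j _ /=;
  by rewrite !mxE scalerA -scalerDl; congr (_ *: _); rewrite ?mulrDl ?mulrDr ?mulrA // (mulrC a).
Qed.

Let cf (i : 'I_n) : 'Hom('rV[k]_n, k^o) := linfun (fun l : 'rV[k]_n => l 0 i : k^o).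
Let cfE (i : 'I_n) l : cf i l = l 0 i.
Proof. by rewrite linfunK // => a x y; rewrite !mxE. Qed.

Let tc i j (t : tensor 'rV[k]_n 'rV[k]_m) : k := lsl (cf i) t 0 j.

Lemma gmapE t : gmap t = \sum_i \sum_j tc i j t *: gvec i j.
Proof.
move: t; apply: eq_on_tens => [a x y|a x y|l r].
- by rewrite linearP.
- rewrite scaler_sumr -big_split; apply: eq_bigr => i _ /=.
  rewrite scaler_sumr -big_split; apply: eq_bigr => j _ /=.
  by rewrite /tc linearP !mxE scalerDl scalerA.
- rewrite gmap_tens; apply: eq_bigr => i _; apply: eq_bigr => j _.
  by rewrite /tc lsl_tens cfE mxE.
Qed.

(** Moving position (i, j) back to the seed isolates one coefficient. Both the injectivity of [gmap]
    and the simplicity of its image rest on this. *)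
Lemma gmap_coord i j t : lop (U i i0) (rop (V j0 j) (gmap t)) = tc i j t *: w.
Proof.
rewrite gmapE linear_sum linear_sum (bigD1 i) //= [X in _ + X]big1 => [|l li].
  rewrite addr0 linear_sum linear_sum (bigD1 j) //= [X in _ + X]big1 => [|l lj].
    by rewrite addr0 !linearZ /= rop_gvec eqxx lop_gvec eqxx gvec0.
  by rewrite !linearZ /= rop_gvec eq_sym (negPf lj) linear0 scaler0.
rewrite linear_sum linear_sum big1 // => q _; rewrite !linearZ /= rop_gvec.
by case: (j == q); rewrite ?linear0 ?scaler0 // lop_gvec (negPf li) scaler0.
Qed.

Lemma gmap_ker : lker gmap = 0%VS.
Proof.
apply/eqP; rewrite -subv0; apply/subvP => t; rewrite memv_ker memv0 => /eqP t0.
have tc0 i j : tc i j t = 0.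
  have /eqP := gmap_coord i j t; rewrite t0 !linear0 eq_sym scaler_eq0 (negPf w0) orbF.
  by move/eqP.
apply/eqP/lsl_ext => f; rewrite linear0; apply/rowP => j; rewrite mxE.
have -> : f = \sum_i (f (delta_mx 0 i) : k) *: cf i.
  apply/lfunP => l; rewrite sum_lfunE {1}(row_sum_delta l) linear_sum.
  apply: eq_bigr => i _; rewrite scale_lfunE cfE linearZ; exact: mulrC.
have lslD (g h : 'Hom('rV[k]_n, k^o)) a :
    lsl (a *: g + h) t = a *: lsl g t + lsl h t :> 'rV[k]_m.
  move: t {t0 tc0}; apply: eq_on_tens => [a' x y|a' x y|l r].
  - by rewrite linearP.
  - by rewrite ![lsl _ (_ *: _ + _)]linearP /= !scalerDr !scalerA mulrC addrACA.
  - by rewrite !lsl_tens add_lfunE scale_lfunE scalerDl scalerA.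
elim/big_rec: _ => [|i g _ IH]; last by rewrite lslD !mxE IH -/(tc i j t) tc0 mulr0 addr0.
(* With a = -1 and zero functionals, [lslD] says that the slice by 0 is zero. *)
by have := lslD 0 0 (-1); rewrite scaler0 addr0 scaleN1r addNr => ->; rewrite mxE.
Qed.

Lemma gvec_in i j : gvec i j \in limg gmap.
Proof.
rewrite (_ : gvec i j = gmap (tens (delta_mx 0 i) (delta_mx 0 j))) ?memv_img ?memvf //.
rewrite gmap_tens (bigD1 i) //= [X in _ + X]big1 => [|l li].
  rewrite addr0 (bigD1 j) //= [X in _ + X]big1 => [|l lj]; rewrite !mxE ?eqxx.
    by rewrite mulr1 scale1r addr0.
  by rewrite (negPf lj) mulr0 scale0r.
by rewrite big1 // => q _; rewrite !mxE (negPf li) mul0r scale0r.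
Qed.

Lemma gmap_sub (M : {vspace C}) : (forall i j, gvec i j \in M) -> (limg gmap <= M)%VS.
Proof.
move=> H; apply/limg_subP => t _; rewrite gmapE; apply: memv_suml => i _.
by apply: memv_suml => j _; rewrite memvZ.
Qed.

Lemma gmap_simple : simple_subbicomodule pi (limg gmap).
Proof.
split.
- apply/(subbicomoduleP piP) => f x fp /memv_imgP[t _ ->]; rewrite gmapE !linear_sum.
  rewrite -fp; split; apply: memv_suml => i _; rewrite linear_sum;
  apply: memv_suml => j _; rewrite linearZ memvZ //=.
    by rewrite lop_pi_gvec; apply: memv_suml => q _; rewrite memvZ ?gvec_in.
  by rewrite rop_pi_gvec; apply: memv_suml => q _; rewrite memvZ ?gvec_in.
- by apply: contraNneq w0 => g0; rewrite -memv0 -g0 -gvec0 gvec_in.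
move=> X /(subbicomoduleP piP) sX XM.
have [|X0] := eqVneq X 0%VS; [by left|right].
have /memv_imgP[t _ tE] := subvP XM _ (memv_pick X).
have [i [j tij]] : exists i j, tc i j t != 0.
  apply: contrapT => H; case/negP: X0; rewrite -vpick0 tE gmapE big1 // => i _.
  rewrite big1 // => j _; have [->|tij] := eqVneq (tc i j t) 0; first exact: scale0r.
  by case: H; exists i, j.
have Up p q := pifun_munit piP s D u p q; have Vp p q := pifun_munit piP s E v p q.
have wX : w \in X.
  have [_ H] := sX _ _ (Vp j0 j) (memv_pick X).
  have [+ _] := sX _ _ (Up i i0) H; rewrite tE gmap_coord => /(memvZ (tc i j t)^-1).
  by rewrite scalerA mulVf // scale1r.
apply: subv_anti; rewrite XM /=; apply: gmap_sub => p q.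
have [_ H] := sX _ _ (Vp q j0) wX.
by have [] := sX _ _ (Up i0 p) H.
Qed.

Lemma gmap_type : bicomodule_type pi D E (limg gmap).
Proof.
have n0 : (0 < n)%N by exact: leq_ltn_trans (ltn_ord i0).
have m0 : (0 < m)%N by exact: leq_ltn_trans (ltn_ord j0).
exists 'rV[k]_n, 'rV[k]_m, (row_coact c), (col_coact b), gmap; split.
- by rewrite Dc; exact: row_simple cP uP.
- by rewrite Eb; exact: col_simple bP vP.
- by split=> //; exact: gmap_ker.
- move=> l r; apply: lsl_ext => f; rewrite lsl_rhoL [RHS]linear_tlift.
  transitivity (gmap (tens (lsl f (row_coact c l)) r)).
    rewrite lsl_row_coact !gmap_tens linear_sum /=.
    under [RHS]eq_bigr => q _.
      under eq_bigr => j _ do rewrite mxE mulr_suml scaler_suml.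
      rewrite exchange_big; over.
    rewrite exchange_big; apply: eq_bigr => i _ /=.
    rewrite linear_sum exchange_big; apply: eq_bigr => j _ /=.
    rewrite linearZ /= lop_pi_gvec scaler_sumr; apply: eq_bigr => q _.
    by rewrite scalerA !mxE mulrAC.
  rewrite [lsl f _]lslE.
  pose F : 'Hom('rV[k]_n, C) := linfun (fun x : 'rV[k]_n => gmap (tens x r)).
  have FE x : gmap (tens x r) = F x.
    by rewrite [RHS]linfunK // => a y z; rewrite tens_linearl linearP.
  rewrite FE linear_tlift; apply: eq_tlift => x y /=.
  by rewrite lsl_tens linearZ /= FE.
- move=> l r; apply: rsl_ext => f; rewrite rsl_rhoR [RHS]linear_tlift.
  transitivity (gmap (tens l (rsl f (col_coact b r)))).
    rewrite rsl_col_coact !gmap_tens linear_sum /=; apply: eq_bigr => i _.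
    under [RHS]eq_bigr => q _ do rewrite mxE mulr_sumr scaler_suml.
    rewrite linear_sum exchange_big; apply: eq_bigr => j _ /=.
    rewrite linearZ /= rop_pi_gvec scaler_sumr; apply: eq_bigr => q _.
    by rewrite scalerA !mxE mulrA.
  rewrite [rsl f _]rslE.
  pose F : 'Hom('rV[k]_m, C) := linfun (fun x : 'rV[k]_m => gmap (tens l x)).
  have FE x : gmap (tens l x) = F x.
    by rewrite [RHS]linfunK // => a y z; rewrite tens_linearr linearP.
  rewrite FE linear_tlift; apply: eq_tlift => x y /=.
  by rewrite rsl_tens linearZ /= FE.
Qed.

End Generated.

(** * Blocks *)

Section GradedPieces.
Variables (k : fieldType) (C : coalgebra k).
Notation A := 'Hom(C, k^o).
Implicit Types (f g : A) (n : nat).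

(* Stands for the image of C_(n+1) / C_n under lop f o rop g; unlike the blocks, it does
   not involve the choice of pi and Q. *)
Definition layer n f g : {vspace C} :=
  ((lop f \o rop g) @: corad_filt C n.+1 + corad_filt C n)%VS.

Lemma radfunN f g : radfun (f - g) -> radfun (g - f).
Proof.
by move=> /radfunP H; apply/radfunP => c /H /eqP; rewrite -opprB opp_lfunE oppr_eq0 => /eqP.
Qed.

Lemma lop_layer n f g x : x \in corad_filt C n.+1 ->
  lop f (rop g x) \in layer n f g.
Proof. by move=> xC; rewrite -comp_lfunE (subvP (addvSl _ _)) // memv_img. Qed.

Lemma layer_sub n f g (W : {vspace C}) : (corad_filt C n <= W)%VS ->
  (forall x, x \in corad_filt C n.+1 -> lop f (rop g x) \in W) -> (layer n f g <= W)%VS.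
Proof.
move=> CW fW; rewrite subv_add CW andbT; apply/limg_subP => x xC.
by rewrite comp_lfunE fW.
Qed.

Lemma corad_filt_layer n f g : (corad_filt C n <= layer n f g)%VS.
Proof. exact: addvSr. Qed.

Lemma lop_mod n f f' x : radfun (f - f') -> x \in corad_filt C n.+1 ->
  lop f x - lop f' x \in corad_filt C n.
Proof. by move=> ff xC; rewrite -lopB; exact: (corad_filtS _ _).1 xC _ ff. Qed.

Lemma rop_mod n f f' x : radfun (f - f') -> x \in corad_filt C n.+1 ->
  rop f x - rop f' x \in corad_filt C n.
Proof. by move=> ff xC; rewrite -ropB; exact: (corad_filtSr _ _).1 xC _ ff. Qed.

Lemma lop_rop_mod n f f' g g' x : radfun (f - f') -> radfun (g - g') ->
  x \in corad_filt C n.+1 ->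
  lop f (rop g x) - lop f' (rop g' x) \in corad_filt C n.
Proof.
move=> ff gg xC; have [_ r] := corad_filt_stable C n.+1.
have [l _] := corad_filt_stable C n.
rewrite -(subrK (lop f' (rop g x)) (lop f _)) -addrA memvD //; first exact/lop_mod/r.
by rewrite -linearB; exact/l/rop_mod.
Qed.

Lemma layer_mod_sub n f f' g g' : radfun (f - f') -> radfun (g - g') ->
  (layer n f g <= layer n f' g')%VS.
Proof.
move=> ff gg; apply: layer_sub => [|x xC]; first exact: corad_filt_layer.
rewrite -(subrK (lop f' (rop g' x)) (lop f _)) memvD ?lop_layer //.
exact/(subvP (corad_filt_layer _ _ _))/lop_rop_mod.
Qed.

Lemma layer_mod n f f' g g' : radfun (f - f') -> radfun (g - g') ->
  layer n f g = layer n f' g'.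
Proof. by move=> ff gg; apply: subv_anti; rewrite !layer_mod_sub //; exact: radfunN. Qed.

End GradedPieces.

Section Blocks.
Variables (k : closedFieldType) (C : coalgebra k).
Variables (pi : 'End(C)) (Q : nat -> {vspace C}) (piQ : block_data pi Q).
Variables (s : seq {vspace C}) (s_uniq : uniq s).
Hypothesis sP : forall D, D \in s <-> simple_subcoalgebra D.
Notation A := 'Hom(C, k^o).
Implicit Types (f g h : A) (D E : {vspace C}) (P R : pred {vspace C}).
Let piP : coradical_projection pi := piQ.1.

Definition eproj P R : 'End(C) := (lop (eidem pi s P) \o rop (eidem pi s R))%VF.

Lemma eprojE P R x : eproj P R x = lop (eidem pi s P) (rop (eidem pi s R) x).
Proof. exact: comp_lfunE. Qed.

Lemma eproj_eproj P P' R R' x :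
  eproj P R (eproj P' R' x) = eproj (predI P P') (predI R R') x.
Proof.
rewrite !eprojE -[rop _ (lop _ _)]lop_rop lop_lop rop_rop !(conv_eidem piP s_uniq sP).
congr (lop _ _); apply: eq_eidem => D _; exact: andbC.
Qed.

Lemma eq_eproj P P' R R' : {in s, P =1 P'} -> {in s, R =1 R'} -> eproj P R = eproj P' R'.
Proof. by move=> PP RR; rewrite /eproj (eq_eidem pi PP) (eq_eidem pi RR). Qed.

Lemma eproj_sum P R x :
  eproj P R x = \sum_(D <- s | P D) \sum_(E <- s | R E) eproj (pred1 D) (pred1 E) x.
Proof.
rewrite eprojE (eidem_sum1 pi s_uniq P) linear_sum sum_lfunE; apply: eq_bigr => D _.
rewrite (eidem_sum1 pi s_uniq R) [rop _]linear_sum sum_lfunE.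
rewrite [LHS]linear_sum; apply: eq_bigr => E _ /=.
by rewrite eprojE.
Qed.

Lemma eproj_sub M P R : subbicomodule pi M -> (eproj P R @: M <= M)%VS.
Proof.
move=> /(subbicomoduleP piP) sM; apply/limg_subP => x xM; rewrite eprojE.
have [_ rM] := sM _ _ (pifun_eidem piP s R) xM.
by have [] := sM _ _ (pifun_eidem piP s P) rM.
Qed.

(** A simple bicomodule of this type is fixed by both idempotents, since its coactions lie in D and
    E, where the idempotents agree with the counit. Conversely, decompose the idempotents into
    diagonal matrix units: each component of an element of M is zero or lies in the simple
    bicomodule generated by a seed. *)
Lemma isotypic_eproj M D E : subbicomodule pi M -> D \in s -> E \in s ->
  isotypic pi M D E = (eproj (pred1 D) (pred1 E) @: M)%VS.
Proof.
move=> sM Ds Es; apply: subv_anti; apply/andP; split.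
  apply/sumv_ofP => W [WM _ [L [R [lam [rho [f [sL sR [_ fW] fl fr]]]]]]].
  suff fE x : eproj (pred1 D) (pred1 E) (f x) = f x.
    rewrite -fW; apply/limg_subP => x _; rewrite -fE memv_img //.
    by rewrite (subvP WM) // -fW memv_img ?memvf.
  rewrite eprojE.
  have fD t : lop (eidem pi s (pred1 D)) (f t) = f t.
    move: t; apply: eq_on_tens => [a x1 x2|a x1 x2|l r]; rewrite ?linearP //.
    have ep := pifun_eidem piP s (pred1 D).
    rewrite -[in LHS]ep -lsl_rhoL fl [LHS]linear_tlift.
    have [[_ lam1] /limg_subP lamD _ _] := sL.
    pose F : 'Hom(L, C) := linfun (fun x : L => f (tens x r)).
    have FE y : f (tens y r) = F y.
      by rewrite [RHS]linfunK // => a y1 y2; rewrite tens_linearl linearP.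
    rewrite [RHS]FE -[in RHS](lam1 l) -[in RHS]lslE.
    have -> : lsl (counit C) (lam l) = lsl (eidem pi s (pred1 D)) (lam l).
      have : lam l \in tensv D fullv by apply: lamD; exact: memvf.
      move: (lam l) => t tD; apply/eqP; rewrite -subr_eq0 -opp_lfunE -add_lfunE -memv_ker.
      move: t tD; apply/subvP/tensv_sub => d y dD _.
      rewrite memv_ker add_lfunE opp_lfunE !lsl_tens.
      by rewrite (eidemE piP s_uniq sP _ Ds dD) /= eqxx subrr.
    rewrite [in RHS]lslE [RHS]linear_tlift; apply: eq_tlift => d y /=.
    by rewrite lsl_tens linearZ /= FE.
  have fE t : rop (eidem pi s (pred1 E)) (f t) = f t.
    move: t; apply: eq_on_tens => [a x1 x2|a x1 x2|l r]; rewrite ?linearP //.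
    have ep := pifun_eidem piP s (pred1 E).
    rewrite -[in LHS]ep -rsl_rhoR fr [LHS]linear_tlift.
    have [[_ rho1] /limg_subP rhoE _ _] := sR.
    pose F : 'Hom(R, C) := linfun (fun x : R => f (tens l x)).
    have FE y : f (tens l y) = F y.
      by rewrite [RHS]linfunK // => a y1 y2; rewrite tens_linearr linearP.
    rewrite [RHS]FE -[in RHS](rho1 r) -[in RHS]rslE.
    have -> : rsl (counit C) (rho r) = rsl (eidem pi s (pred1 E)) (rho r).
      have : rho r \in tensv fullv E by apply: rhoE; exact: memvf.
      move: (rho r) => t tD; apply/eqP; rewrite -subr_eq0 -opp_lfunE -add_lfunE -memv_ker.
      move: t tD; apply/subvP/tensv_sub => y d _ dD.
      rewrite memv_ker add_lfunE opp_lfunE !rsl_tens.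
      by rewrite (eidemE piP s_uniq sP _ Es dD) /= eqxx subrr.
    rewrite [in RHS]rslE [RHS]linear_tlift; apply: eq_tlift => d y /=.
    by rewrite rsl_tens linearZ /= FE.
  by rewrite fE fD.
have [n [c [u [n0 cP uP Dc]]]] := simple_comatrix ((sP D).1 Ds).
have [m [b [v [m0 bP vP Eb]]]] := simple_comatrix ((sP E).1 Es).
pose i0 := Ordinal n0; pose j0 := Ordinal m0.
pose U := munit pi s D u; pose V := munit pi s E v.
have Uconv := munit_conv piP sP Ds cP uP Dc.
have Vconv := munit_conv piP sP Es bP vP Eb.
have Up p q := pifun_munit piP s D u p q; have Vp p q := pifun_munit piP s E v p q.
have sM' := (subbicomoduleP piP _).1 sM.
apply/limg_subP => x xM; rewrite eprojE.
rewrite -(munit_sum piP s_uniq sP Ds cP uP Dc) -(munit_sum piP s_uniq sP Es bP vP Eb).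
rewrite linear_sum sum_lfunE; apply: memv_suml => i _.
rewrite linear_sum sum_lfunE linear_sum; apply: memv_suml => j _ /=.
(* The (i, j) component of x moved to position (i0, j0): the seed of the bicomodule that contains
   this component. *)
pose w := lop (U i i0) (rop (V j0 j) x).
have wM : w \in M.
  have [_ H] := sM' _ _ (Vp j0 j) xM.
  by have [] := sM' _ _ (Up i i0) H.
have xE : lop (U i i) (rop (V j j) x) = gvec pi s D E u v i0 j0 w i j.
  by rewrite /gvec /w -lop_rop rop_rop lop_lop Vconv Uconv !eqxx.
have [w0|w0] := eqVneq w 0; first by rewrite xE /gvec w0 !linear0 mem0v.
have wU : lop (U i0 i0) w = w by rewrite /w lop_lop Uconv eqxx.
have wV : rop (V j0 j0) w = w by rewrite /w -lop_rop rop_rop Vconv eqxx.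
rewrite [X in X \in _]xE.
pose W := limg (gmap pi s D E u v i0 j0 w).
suff H : (W <= isotypic pi M D E)%VS by apply: (subvP H); exact: gvec_in.
apply: sumv_of_sup; split.
- apply: gmap_sub => p q; rewrite /gvec.
  have [_ H] := sM' _ _ (Vp q j0) wM.
  by have [] := sM' _ _ (Up i0 p) H.
- exact: (gmap_simple piP s_uniq sP Ds cP uP Dc Es bP vP Eb w0 wU wV).
- exact: (gmap_type piP s_uniq sP Ds cP uP Dc Es bP vP Eb w0 wU wV).
Qed.

Definition dimsq d : pred {vspace C} := fun D => \dim D == (d ^ 2)%N.

Lemma block_subbicomodule n : (0 < n)%N -> subbicomodule pi (Q n).
Proof. by move=> /(piQ.2)[]. Qed.

Lemma block_eproj n d1 d2 : (0 < n)%N ->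
  block pi Q n d1 d2 = (eproj (dimsq d1) (dimsq d2) @: Q n)%VS.
Proof.
move=> n0; have sQ := block_subbicomodule n0.
rewrite /block eqn0Ngt n0 /=; apply: subv_anti; apply/andP; split.
  apply/sumv_ofP => W [D [E [[/sP Ds dD] [/sP Es dE] ->]]].
  rewrite isotypic_eproj //; apply/limg_subP => x xQ.
  apply/memv_imgP; exists (eproj (pred1 D) (pred1 E) x).
    by apply: (subvP (eproj_sub _ _ sQ)); exact: memv_img.
  rewrite eproj_eproj.
  by rewrite (@eq_eproj _ (pred1 D) _ (pred1 E)) // => F _ /=; case: eqP => [->|];
     rewrite ?andbF ?andbT /dimsq ?dD ?dE ?eqxx.
apply/limg_subP => x xQ; rewrite eproj_sum big_seq_cond.
apply: memv_suml => D /andP[Ds /eqP dD]; rewrite big_seq_cond.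
apply: memv_suml => E /andP[Es /eqP dE].
have : eproj (pred1 D) (pred1 E) x \in isotypic pi (Q n) D E.
  by rewrite isotypic_eproj // memv_img.
apply/subvP/sumv_of_sup; exists D, E; split => //; split => //; exact/sP.
Qed.

Lemma block0 d : block pi Q 0 d d = (\sum_(D <- s | dimsq d D) D)%VS.
Proof.
rewrite /block !eqxx; apply: subv_anti; apply/andP; split.
  apply/sumv_ofP => D [/sP Ds dD].
  by rewrite (big_rem D) //= /dimsq dD eqxx addvSl.
rewrite big_seq_cond; elim/big_rec: _ => [|D W /andP[/sP Ds /eqP dD] WB]; first exact: sub0v.
by rewrite subv_add WB andbT; exact: sumv_of_sup.
Qed.

Lemma coradical_filt n : (coradical C <= corad_filt C n)%VS.
Proof. exact: (@corad_filt_sub k C 0). Qed.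

(** Q n is given only as a complement inside the kernel of [pi]. Subtracting pi x, which lies in the
    coradical and so in C_(n-1), reduces an element x of C_n to that case. *)
Lemma corad_filt_split n : (0 < n)%N ->
  corad_filt C n = (corad_filt C n.-1 + Q n)%VS /\ (corad_filt C n.-1 :&: Q n = 0)%VS.
Proof.
move=> n0; have [_ PE Pcap] := piQ.2 _ n0.
have QP : (Q n <= P_filt pi n)%VS by rewrite PE addvSr.
have [QC Qker] : (Q n <= corad_filt C n)%VS /\ (Q n <= lker pi)%VS.
  by split; apply: subv_trans QP _; [exact: capvSl|exact: capvSr].
split; last first.
  apply/eqP; rewrite -subv0 -Pcap subv_cap capvSr andbT.
  by rewrite subv_cap capvSl (subv_trans (capvSr _ _) Qker).
apply: subv_anti; rewrite subv_add QC andbT corad_filt_sub ?leq_pred // andbT.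
apply/subvP => x xC; rewrite -(subrK (pi x) x).
rewrite memvD //; last first.
  by rewrite (subvP (addvSl _ _)) // (subvP (coradical_filt _)) // (mem_pi piP).
have : x - pi x \in P_filt pi n.
  rewrite memv_cap memvB //=; last by rewrite (subvP (coradical_filt _)) // (mem_pi piP).
  by rewrite memv_ker linearB /= (pi_id piP (mem_pi piP _)) subrr.
rewrite PE; apply/subvP/addvS => //; exact: capvSl.
Qed.

(** The two idempotents preserve both C_n and Q_(n+1), so the image of Q_(n+1) is a complement of
    C_n in the layer. This trades blocks, which depend on choices, for layers, on which
    automorphisms act. *)
Lemma dim_eproj n P R :
  (\dim (eproj P R @: Q n.+1) + \dim (corad_filt C n))%N =
  \dim (layer n (eidem pi s P) (eidem pi s R)).
Proof.
have [] := corad_filt_split (ltn0Sn n); rewrite -pred_Sn => CE Ccap.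
rewrite /layer -/(eproj _ _) CE limgD.
have eC : (eproj P R @: corad_filt C n <= corad_filt C n)%VS.
  have [l r] := corad_filt_stable C n.
  by apply/limg_subP => x xC; rewrite eprojE; exact/l/r.
rewrite -addvA (addvC (_ @: Q _)%VS) addvA (addv_idPr eC).
rewrite addnC dimv_disjoint_sum //.
apply/eqP; rewrite -subv0 -Ccap; apply: capvS => //.
exact/eproj_sub/block_subbicomodule.
Qed.

Lemma dim_block n d1 d2 :
  (\dim (block pi Q n.+1 d1 d2) + \dim (corad_filt C n))%N =
  \dim (layer n (eidem pi s (dimsq d1)) (eidem pi s (dimsq d2))).
Proof. by rewrite block_eproj // dim_eproj. Qed.

End Blocks.

(** * Automorphisms and anti-automorphisms acting on the graded pieces *)

Section Comorphisms.
Variables (k : fieldType) (C : coalgebra k).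
Notation A := 'Hom(C, k^o).
Implicit Types (a b : bool) (f g : A) (D E W : {vspace C}) (phi : 'End(C)).

(** A boolean for the side allows both kinds of maps to be treated at once: [a (+) b] exchanges the
    sides exactly when b holds. *)
Definition xop a f : 'End(C) := if a then rop f else lop f.

(* Coalgebra automorphisms (b = false) and anti-automorphisms (b = true). *)
Definition comorph b phi : Prop := lker phi == 0%VS /\
  forall a f c, xop a f (phi c) = phi (xop (a (+) b) (f \o phi)%VF c).

Lemma subcoalgebra_xop D : subcoalgebra D <->
  (forall a f c, c \in D -> xop a f c \in D).
Proof.
rewrite subcoalgebraP; split=> [[l r] [] f c cD|H]; [exact: r|exact: l|].
by split=> f c cD; [exact: (H false)|exact: (H true)].
Qed.

Lemma corad_filtS_xop a n c :
  c \in corad_filt C n.+1 <-> (forall f, radfun f -> xop a f c \in corad_filt C n).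
Proof. by case: a; [exact: corad_filtSr|exact: corad_filtS]. Qed.

Lemma comorph_inv b phi : comorph b phi -> comorph b phi^-1%VF.
Proof.
move=> [phi0 phiX]; have phiK := lker0_lfunK phi0; have phiV := lker0_lfunVK phi0.
split=> [|a f c]; first by apply/lker0P => x y xy; rewrite -(phiV x) xy phiV.
apply: (can_inj phiK); rewrite phiV.
have -> : f = ((f \o phi^-1) \o phi)%VF by rewrite lker0_compfVK.
rewrite -{1}[a](addbK b) -phiX phiV; congr (xop _ _ _).
by rewrite lker0_compfVK.
Qed.

Section Facts.
Variables (b : bool) (phi : 'End(C)) (phiP : comorph b phi).

(** Acting by the counit on phi c and cancelling phi gives c = [lop (counit C \o phi) c]; apply the
    counit to this. *)
Lemma counit_comorph : (counit C \o phi)%VF = counit C.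
Proof.
have [phi0 phiX] := phiP; apply/lfunP => c.
have := phiX b (counit C) c; rewrite addbb /=.
have -> : xop b (counit C) (phi c) = phi c.
  by rewrite /xop; case: (b); rewrite ?rop_counit ?lop_counit.
move/(can_inj (lker0_lfunK phi0)) => {2}->.
by rewrite counit_lop.
Qed.

Lemma comorph_subcoalgebra D : subcoalgebra D -> subcoalgebra (phi @: D)%VS.
Proof.
move=> /subcoalgebra_xop sD; apply/subcoalgebra_xop => a f _ /memv_imgP[c cD ->].
by rewrite phiP.2 memv_img // sD.
Qed.

Lemma comorph_dim D : \dim (phi @: D) = \dim D.
Proof. by apply: limg_dim_eq; rewrite (eqP phiP.1) capv0. Qed.

End Facts.

Lemma comorph_imgV b phi D : comorph b phi -> (phi @: (phi^-1 @: D))%VS = D.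
Proof. by move=> [phi0 _]; rewrite -limg_comp lker0_compfV // lim1g. Qed.

Lemma comorph_simple b phi D : comorph b phi -> simple_subcoalgebra D ->
  simple_subcoalgebra (phi @: D)%VS.
Proof.
move=> phiP [sD D0 mD]; split; first exact: (comorph_subcoalgebra phiP).
  by rewrite -dimv_eq0 (comorph_dim phiP) dimv_eq0.
move=> E sE ED; have [||V0|VD] := mD (phi^-1 @: E)%VS.
- exact: comorph_subcoalgebra (comorph_inv phiP) _ sE.
- by rewrite -(limg_ker0 _ _ phiP.1) (comorph_imgV _ phiP).
- by left; rewrite -(comorph_imgV E phiP) V0 limg0.
- by right; rewrite -VD (comorph_imgV _ phiP).
Qed.

Lemma comorph_coradical b phi c : comorph b phi ->
  c \in coradical C -> phi c \in coradical C.
Proof.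
move=> phiP; rewrite memv_preim; move: c; apply/subvP/sumv_ofP => D sD.
apply/subvP => x xD; rewrite -memv_preim.
have := sumv_of_sup (comorph_simple phiP sD); move/subvP; apply; exact: memv_img.
Qed.

Lemma comorph_radfun b phi f : comorph b phi -> radfun f -> radfun (f \o phi)%VF.
Proof.
move=> phiP /radfunP fJ; apply/radfunP => c cC.
by rewrite comp_lfunE fJ // (comorph_coradical phiP).
Qed.

Lemma comorph_filt b phi n c : comorph b phi ->
  c \in corad_filt C n -> phi c \in corad_filt C n.
Proof.
move=> phiP; elim: n c => [|n IH] c cC; first exact: comorph_coradical phiP cC.
apply/(corad_filtS_xop false) => f fJ; rewrite phiP.2; apply: IH.
exact: (corad_filtS_xop _ _ _).1 cC _ (comorph_radfun phiP fJ).
Qed.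

Lemma comorph_layer_sub b phi n f g : comorph b phi ->
  (phi @: layer n (f \o phi)%VF (g \o phi)%VF <=
   if b then layer n g f else layer n f g)%VS.
Proof.
move=> phiP; apply/limg_subP => y; rewrite memv_preim; move: y; apply/subvP.
apply: layer_sub => [|x xC].
  apply/subvP => x xC; rewrite -memv_preim.
  have := comorph_filt phiP xC; apply/subvP.
  by case: (b); exact: corad_filt_layer.
rewrite -memv_preim; have pxC := comorph_filt phiP xC.
have [_ H] := phiP; move: H; case: (b) => H.
  rewrite -(H true f) -(H false g) /= -lop_rop; exact: lop_layer.
rewrite -(H false f) -(H true g); exact: lop_layer.
Qed.

(** One inequality comes from the inclusion for phi, the other from the inclusion for its
    inverse. *)
Lemma comorph_layer_dim b phi n f g : comorph b phi ->
  \dim (layer n (f \o phi)%VF (g \o phi)%VF) =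
  \dim (if b then layer n g f else layer n f g).
Proof.
move=> phiP; apply/eqP; rewrite eqn_leq; apply/andP; split.
  rewrite -(comorph_dim phiP); apply/dimvS; exact: comorph_layer_sub.
have phiP' := comorph_inv phiP.
have E h : h = ((h \o phi) \o phi^-1)%VF by rewrite lker0_compfK // phiP.1.
rewrite -(comorph_dim phiP'); apply: dimvS.
move: phiP'; case: (b) => phiP'.
  by have := comorph_layer_sub n (g \o phi)%VF (f \o phi)%VF phiP'; rewrite -!E.
by have := comorph_layer_sub n (f \o phi)%VF (g \o phi)%VF phiP'; rewrite -!E.
Qed.

Section Simples.
Variables (pi : 'End(C)) (piP : coradical_projection pi).
Variables (s : seq {vspace C}) (s_uniq : uniq s).
Hypothesis sP : forall D, D \in s <-> simple_subcoalgebra D.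

(** Since phi need not commute with [pi], the idempotents are permuted only modulo the radical,
    where comparing values on the simple subcoalgebras is enough. *)
Lemma comorph_eidem b phi P : comorph b phi ->
  radfun ((eidem pi s P \o phi)%VF - eidem pi s (fun D => P (phi @: D)%VS)).
Proof.
move=> phiP; apply: (coradical_ext sP) => D x Ds xD.
have phiD : (phi @: D)%VS \in s by apply/sP/(comorph_simple phiP)/sP.
rewrite comp_lfunE (eidemE piP s_uniq sP P phiD) ?memv_img //.
by rewrite (eidemE piP s_uniq sP _ Ds xD) -[counit C (phi x)]comp_lfunE (counit_comorph phiP).
Qed.

Lemma comorph_block_dim b phi n P R : comorph b phi ->
  \dim (layer n (eidem pi s (fun D => P (phi @: D)%VS)) (eidem pi s (fun D => R (phi @: D)%VS))) =
  \dim (if b then layer n (eidem pi s R) (eidem pi s P)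
             else layer n (eidem pi s P) (eidem pi s R)).
Proof.
move=> phiP; rewrite -(comorph_layer_dim _ _ _ phiP).
by congr (\dim _); apply: layer_mod; apply: radfunN; exact: comorph_eidem phiP.
Qed.

End Simples.

End Comorphisms.

(** * The Frobenius property *)

Section Frobenius.
Variables (k : fieldType) (C : coalgebra k) (La : C).
Notation A := 'Hom(C, k^o).
Implicit Types (f g h : A).

Definition lam_map : 'Hom(A, C) := linfun (fun f => lop f La).

Lemma lam_mapE f : lam_map f = lop f La.
Proof. by rewrite linfunK // => a x y; rewrite lopP. Qed.

Hypothesis La_full : limg lam_map = fullv.

Lemma lam_mapP c : exists f, c = lop f La.
Proof.
have := memvf c; rewrite -La_full => /memv_imgP[f _ ->].
by exists f; rewrite lam_mapE.
Qed.

Lemma lam_map_inj f g : lop f La = lop g La -> f = g.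
Proof.
rewrite -!lam_mapE; move: f g; apply/lker0P; rewrite -dimv_eq0.
have := limg_ker_dim lam_map fullv; rewrite capfv La_full => /eqP.
have -> : \dim {:A} = \dim {:C}.
  by rewrite dimvf [RHS]dimvf -[RHS]muln1.
by rewrite -{2}[\dim {:C}]add0n eqn_add2r.
Qed.

Lemma rop_lam_inj f : rop f La = 0 -> f = 0.
Proof.
move=> f0; apply/lfunP => c; have [h ->] := lam_mapP c.
by rewrite -convEl convE f0 linear0 zero_lfunE.
Qed.

(* The transpose of the Nakayama automorphism of the dual algebra. *)
Definition nakayama : 'End(C) :=
  linfun (fun c => \sum_i ((lam_map^-1%VF (rop (bfun i) La) : A) c : k) *: bvec i).

Lemma nakayamaE h c : h (nakayama c) = (lam_map^-1%VF (rop h La) : A) c.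
Proof.
rewrite linfunK => [|a x y]; last first.
  rewrite scaler_sumr -big_split; apply: eq_bigr => i _.
  by rewrite linearP scalerDl scalerA.
rewrite [in RHS]rop_sum !linear_sum sum_lfunE; apply: eq_bigr => i _.
by rewrite !linearZ /= scale_lfunE; exact: mulrC.
Qed.

Lemma rop_nakayama h : rop h La = lop (h \o nakayama)%VF La.
Proof.
rewrite -lam_mapE; have -> : (h \o nakayama)%VF = lam_map^-1%VF (rop h La).
  by apply/lfunP => c; rewrite comp_lfunE nakayamaE.
by rewrite limg_lfunVK // La_full memvf.
Qed.

(** Transfer the two factors from [rop] to [lop] at La one after the other; commuting the operators
    between the transfers compensates for the opposite order of composition. *)
Lemma nakayama_conv f g :
  (conv f g \o nakayama)%VF = conv (f \o nakayama)%VF (g \o nakayama)%VF.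
Proof.
apply: lam_map_inj; rewrite -rop_nakayama -rop_rop rop_nakayama -lop_rop.
by rewrite rop_nakayama lop_lop.
Qed.

(** A functional f that vanishes on the image satisfies [rop f La = 0], hence is zero; so the map is
    onto and, by dimension, injective. Compatibility with both actions is multiplicativity of the
    transpose. *)
Lemma nakayama_comorph : comorph false nakayama.
Proof.
split=> [|a f c].
  have /eqP := limg_ker_dim nakayama fullv; rewrite capfv.
  suff -> : limg nakayama = fullv.
    by rewrite -{2}[\dim {:C}]add0n eqn_add2r dimv_eq0.
  apply/eqP; rewrite eqEsubv subvf; apply/subvP => c _.
  apply: functional_sep => f /subvP fN.
  suff -> : f = 0 by rewrite zero_lfunE.
  apply: rop_lam_inj; rewrite rop_nakayama.
  have -> : (f \o nakayama)%VF = 0.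
    apply/lfunP => x; rewrite comp_lfunE zero_lfunE; apply/eqP.
    by rewrite -memv_ker fN // memv_img ?memvf.
  by rewrite linear0 zero_lfunE.
rewrite addbF; apply: functional_ext => h; case: a => /=.
  by rewrite -convE -2![_ (nakayama _)]comp_lfunE nakayama_conv convE.
by rewrite -convEl -2![_ (nakayama _)]comp_lfunE nakayama_conv convEl.
Qed.

Section Top.
Variables (pi : 'End(C)) (piP : coradical_projection pi).
Variables (s : seq {vspace C}) (s_uniq : uniq s).
Hypothesis sP : forall D, D \in s <-> simple_subcoalgebra D.
Local Notation e := (eidem pi s).
Variables (D : {vspace C}) (n : nat).
Hypothesis Ds : D \in s.
Hypothesis Dtop : forall c, lop (e (pred1 D)) c \in corad_filt C n.+1.

(** The Nakayama map rewrites [lop j La] as [rop h La] with h again in the radical. The idempotent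
    of D can then be applied to La first, which lands in C_(n+1), and h lowers the result to C_n. *)
Lemma radfun_lam j : radfun j -> conv j (e (pred1 D)) = j ->
  lop j La \in corad_filt C n.
Proof.
move=> jJ je; have tP := comorph_inv nakayama_comorph.
pose h := (j \o nakayama^-1)%VF.
have hJ : radfun h by exact: comorph_radfun tP jJ.
have jE : lop j La = rop h La.
  by rewrite rop_nakayama /h lker0_compfVK ?nakayama_comorph.1.
rewrite -je -lop_lop jE lop_rop.
exact: (corad_filtSr _ _).1 (Dtop La) _ hJ.
Qed.

(** With c = [lop f La], everything becomes one functional acting on La: the product of e_E \o
    nakayama, f and e_D. On D the first factor vanishes, because the Nakayama map sends D to a
    simple subcoalgebra other than E; so the product is in the radical. *)
Lemma top_layer E c : E \in s -> E != (nakayama @: D)%VS ->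
  rop (e (pred1 E)) (lop (e (pred1 D)) c) \in corad_filt C n.
Proof.
move=> Es ED; have [f ->] := lam_mapP c.
have eD := conv_eidem piP s_uniq sP (pred1 D) (pred1 D).
have eDD : conv (e (pred1 D)) (e (pred1 D)) = e (pred1 D).
  by rewrite eD; apply: eq_eidem => F _ /=; exact: andbb.
pose h := (e (pred1 E) \o nakayama)%VF.
have -> : rop (e (pred1 E)) (lop (e (pred1 D)) (lop f La)) =
    lop (conv (conv h f) (e (pred1 D))) La.
  by rewrite -lop_rop -lop_rop rop_nakayama !lop_lop convA.
apply: radfun_lam; last by rewrite -convA eDD.
rewrite -[X in radfun X]subr0; apply: (coradical_ext sP) => F x Fs xF.
rewrite zero_lfunE convE (rop_eidem piP s_uniq sP _ Fs xF) /=.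
case: eqP => [FD|_]; last by rewrite linear0.
have [_ rF] := simple_stable sP Fs.
have tD : (nakayama @: D)%VS \in s by apply/sP/(comorph_simple nakayama_comorph)/sP.
rewrite convE comp_lfunE (eidemE piP s_uniq sP _ tD) /=; last by rewrite memv_img // -FD rF.
by rewrite eq_sym (negPf ED).
Qed.

(** For D of dimension one, f e_D is a scalar multiple of e_D modulo the radical, so all of
    [lop f La] contributes just one line modulo C_n. *)
Lemma top_line c : \dim D = 1%N ->
  lop (e (pred1 D)) c \in (<[lop (e (pred1 D)) La]> + corad_filt C n)%VS.
Proof.
move=> D1; have [f ->] := lam_mapP c.
have eDD : conv (e (pred1 D)) (e (pred1 D)) = e (pred1 D).
  by rewrite (conv_eidem piP s_uniq sP); apply: eq_eidem => F _ /=; exact: andbb.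
pose g := vpick D; have gD : g \in D := memv_pick D.
have g0 : g != 0 by rewrite vpick0 -dimv_eq0 D1.
have Dg x : x \in D -> exists a, x = a *: g.
  have -> : D = <[g]>%VS.
    by apply/esym/eqP; rewrite eqEdim -memvE gD D1 dim_vline g0.
  by move=> /vlineP.
have [lD rD] := simple_stable sP Ds.
have eg : (counit C g : k) != 0.
  apply: contra g0 => /eqP eg; apply/eqP/functional_ext => h.
  rewrite linear0 -counit_lop; have [a ->] := Dg _ (lD h g gD).
  by rewrite linearZ /= eg scaler0.
(* The value of f at the group-like element of the line D, obtained by normalising g. *)
pose a : k := (f g : k) / (counit C g : k).
pose j := conv f (e (pred1 D)) - a *: e (pred1 D).
have -> : lop (e (pred1 D)) (lop f La) = a *: lop (e (pred1 D)) La + lop j La.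
  by rewrite lop_lop /j lopB linearZ /= scale_lfunE addrC subrK.
apply: memv_add; first by rewrite memvZ ?memv_line.
apply: radfun_lam.
  apply: (coradical_ext sP) => F x Fs xF.
  rewrite convE (rop_eidem piP s_uniq sP _ Fs xF) scale_lfunE.
  rewrite (eidemE piP s_uniq sP _ Fs xF) /=; case: eqP => [FD|_]; last by rewrite linear0 scaler0.
  have [b ->] : exists b, x = b *: g by apply: Dg; rewrite -FD.
  have E : b * (f g : k) = a * (b * (counit C g : k)) by rewrite mulrCA divfK.
  by rewrite [LHS]linearZ [counit C _]linearZ; exact: E.
apply/lfunP => x; rewrite convE /j !add_lfunE !opp_lfunE !scale_lfunE.
by rewrite -[conv f _ (rop _ x)]convE -[e _ (rop _ x)]convE -convA eDD.
Qed.

End Top.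
End Frobenius.

(** * The last nonzero blocks *)

Section TopBlocks.
Variables (k : closedFieldType) (C : coalgebra k).
Variables (pi : 'End(C)) (Q : nat -> {vspace C}) (piQ : block_data pi Q).
Variables (s : seq {vspace C}) (s_uniq : uniq s).
Hypothesis sP : forall D, D \in s <-> simple_subcoalgebra D.
Implicit Types (D E : {vspace C}) (P R : pred {vspace C}).
Let piP : coradical_projection pi := piQ.1.
Local Notation e := (eidem pi s).
Local Notation B := (block pi Q).

Lemma block_eq0 n d1 d2 : B n.+1 d1 d2 = 0%VS <->
  (forall x, x \in corad_filt C n.+1 ->
     eproj pi s (dimsq d1) (dimsq d2) x \in corad_filt C n).
Proof.
have dE := dim_block piQ s_uniq sP n d1 d2; split=> [B0 x xC|H].
  move: dE; rewrite B0 dimv0 add0n => dE.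
  suff -> : corad_filt C n = layer n (e (dimsq d1)) (e (dimsq d2)).
    by rewrite eprojE lop_layer.
  by apply/eqP; rewrite eqEdim corad_filt_layer dE leqnn.
have le : (layer n (e (dimsq d1)) (e (dimsq d2)) <= corad_filt C n)%VS.
  by apply: layer_sub => // x /H; rewrite eprojE.
have := dimvS le; rewrite -dE -{2}[\dim (corad_filt C n)]add0n leq_add2r leqn0.
by rewrite dimv_eq0 => /eqP.
Qed.

Lemma simple_dimsq D : D \in s -> exists2 d, (0 < d)%N & dimsq d D.
Proof.
move=> /sP/simple_comatrix[n [c [u [n0 cP uP ->]]]].
by exists n => //; rewrite /dimsq (dim_cospan uP).
Qed.

Lemma lop_eidem_sub P R n x : {in s, subpred P R} ->
  lop (e R) x \in corad_filt C n -> lop (e P) x \in corad_filt C n.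
Proof.
move=> PR xC; have [l _] := corad_filt_stable C n.
have -> : lop (e P) x = lop (e P) (lop (e R) x).
  rewrite lop_lop (conv_eidem piP s_uniq sP); congr (lop _ _).
  by apply: eq_eidem => D Ds /=; case PD: (P D); rewrite ?andbF ?(PR D Ds PD).
exact: l.
Qed.

Lemma mem_split P n x : lop (e P) x \notin corad_filt C n ->
  exists D E, [/\ D \in s, P D, E \in s &
    rop (e (pred1 E)) (lop (e (pred1 D)) x) \notin corad_filt C n].
Proof.
move=> xC; apply: contrapT => H; case/negP: xC.
have -> : lop (e P) x = eproj pi s P predT x.
  by rewrite eprojE (eidemT piP s_uniq sP) rop_counit.
rewrite (eproj_sum _ s_uniq) big_seq_cond; apply: memv_suml => D /andP[Ds PD].
rewrite big_seq; apply: memv_suml => E Es; rewrite eprojE lop_rop.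
by apply: contrapT => /negP DE; apply: H; exists D, E.
Qed.

Variables (La : C) (La_full : limg (lam_map La) = fullv).

Lemma top_block_dim n D E x : D \in s -> E \in s ->
  (forall c, lop (e (pred1 D)) c \in corad_filt C n.+1) ->
  rop (e (pred1 E)) (lop (e (pred1 D)) x) \notin corad_filt C n ->
  \dim E = \dim D.
Proof.
move=> Ds Es Dtop; have tP := nakayama_comorph La_full.
have [-> _|ED] := eqVneq E (nakayama La @: D)%VS; first exact: comorph_dim tP _.
by rewrite (top_layer La_full piP s_uniq sP Ds Dtop x Es ED).
Qed.

(** If no block of left type d1 occurred above degree n + 1, the part of C of left type d1 would lie
    in C_(n+1). For each D of dimension d1^2, degree n + 1 could then carry only right types of
    dimension d1^2, against d1 <> d2. *)
Lemma block_next n d1 d2 : (0 < d1)%N -> (0 < d2)%N -> d1 <> d2 ->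
  B n.+1 d1 d2 != 0%VS ->
  exists d3 m, [/\ (0 < d3)%N, (n.+1 < m)%N & B m d1 d3 != 0%VS].
Proof.
move=> d10 d20 d12 Bn; apply: contrapT => H.
have step m x : (n < m)%N -> x \in corad_filt C m.+1 -> lop (e (dimsq d1)) x \in corad_filt C m.
  move=> nm xC; apply: contrapT => /negP /mem_split[D [E [Ds dD Es]]].
  have [d3 d30 dE] := simple_dimsq Es.
  suff -> : rop (e (pred1 E)) (lop (e (pred1 D)) x) =
      eproj pi s (pred1 D) (pred1 E) (eproj pi s (dimsq d1) (dimsq d3) x).
    have [l r] := corad_filt_stable C m.
    suff B0 : B m.+1 d1 d3 = 0%VS.
      by rewrite eprojE; move/negP; apply; apply/l/r; exact: ((block_eq0 _ _ _).1 B0).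
    by apply: contrapT => /eqP Bm; apply: H; exists d3, m.+1.
  rewrite (eproj_eproj piQ s_uniq sP) -lop_rop -eprojE.
  by congr (fun_of_lfun _ x); apply: eq_eproj => F Fs /=; case: eqP => // ->; rewrite ?dD ?dE.
have [N CN] := corad_filt_exhaust C.
have top x : lop (e (dimsq d1)) x \in corad_filt C n.+1.
  have xN : x \in corad_filt C (n.+1 + N).
    by apply: (subvP (corad_filt_sub C (leq_addl _ _))); rewrite CN memvf.
  elim: N {CN} x xN => [|N IH] x xN.
    by rewrite addn0 in xN; have [l _] := corad_filt_stable C n.+1; exact: l.
  (* Each descent by one degree consumes one application of the idempotent. *)
  have -> : lop (e (dimsq d1)) x = lop (e (dimsq d1)) (lop (e (dimsq d1)) x).
    rewrite lop_lop (conv_eidem piP s_uniq sP); congr (lop _ _).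
    by apply: eq_eidem => D _ /=; rewrite andbb.
  by apply: IH; apply: step; rewrite ?leq_addr // -addnS.
case/eqP: Bn; apply/block_eq0 => x xC.
rewrite (eproj_sum _ s_uniq) big_seq_cond; apply: memv_suml => D /andP[Ds dD].
rewrite big_seq_cond; apply: memv_suml => E /andP[Es dE].
apply: contrapT => /negP xE; apply: d12.
rewrite eprojE lop_rop in xE.
have := top_block_dim Ds Es _ xE; rewrite (eqP dD) (eqP dE) => H2.
apply/esym/eqP; rewrite -eqn_sqr; apply/eqP/H2 => c.
by apply: lop_eidem_sub (top c) => F Fs /eqP ->.
Qed.

(** Take the least m such that C_m contains the part of C whose left types are group-likes. By
    minimality some component survives in degree m > 0, and its right type has dimension one as
    well. Each group-like D spans at most the line of [lop e_D La] there. *)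
Lemma top_block : exists m,
  (forall m', B m'.+1 1%N 1%N != 0%VS -> (m'.+1 <= m)%N) /\
  (m <> 0 -> B m 1%N 1%N != 0%VS /\ (\dim (B m 1%N 1%N) <= count (dimsq 1) s)%N).
Proof.
pose top m := (limg (lop (e (dimsq 1))) <= corad_filt C m)%VS.
have topE : exists m, top m by have [N CN] := corad_filt_exhaust C; exists N; rewrite /top CN subvf.
case: (ex_minnP topE) => m mtop mmin; exists m.
have mtop' x : lop (e (dimsq 1)) x \in corad_filt C m.
  by rewrite (subvP mtop) // memv_img ?memvf.
split=> [m' Bm'|m0].
  rewrite leqNgt; apply: contra Bm' => mm'; apply/eqP/block_eq0 => x xC.
  by rewrite eprojE; apply: (subvP (@corad_filt_sub _ C m m' mm')); exact: mtop'.
case: m m0 mtop mmin mtop' => // p _ mtop mmin mtop'.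
have Dtop D : D \in s -> dimsq 1 D -> forall c, lop (e (pred1 D)) c \in corad_filt C p.+1.
  by move=> Ds dD c; apply: lop_eidem_sub (mtop' c) => F Fs /eqP ->.
split.
  have [x xC] : exists x, lop (e (dimsq 1)) x \notin corad_filt C p.
    apply: contrapT => H; suff /mmin : top p by rewrite ltnn.
    by apply/limg_subP => x _; apply: contrapT => /negP xp; apply: H; exists x.
  have [D [E [Ds dD Es xDE]]] := mem_split xC.
  have dE : dimsq 1 E by rewrite /dimsq (top_block_dim Ds Es (Dtop D Ds dD) xDE).
  apply/eqP => /block_eq0 H; case/negP: xDE.
  have yC : rop (e (pred1 E)) (lop (e (pred1 D)) x) \in corad_filt C p.+1.
    by have [_ r] := corad_filt_stable C p.+1; apply/r/Dtop.
  have := H _ yC; rewrite -lop_rop -eprojE (eproj_eproj piQ s_uniq sP).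
  rewrite (@eq_eproj _ _ pi s _ (pred1 D) _ (pred1 E)) // => F Fs /=;
    by rewrite andbC; case: eqP => // ->; rewrite ?dD ?dE.
have := dim_block piQ s_uniq sP p 1 1.
pose S := <<[seq lop (e (pred1 D)) La | D <- s & dimsq 1 D]>>%VS.
have : (layer p (e (dimsq 1)) (e (dimsq 1)) <= S + corad_filt C p)%VS.
  apply: layer_sub => [|x xC]; first exact: addvSr.
  move: (rop _ x) => y; rewrite (eidem_sum1 pi s_uniq) linear_sum sum_lfunE big_seq_cond.
  apply: memv_suml => D /andP[Ds dD].
  have D1 : \dim D = 1%N by rewrite (eqP dD).
  have := top_line La_full piP s_uniq sP Ds (Dtop D Ds dD) y D1.
  suff lS : (<[lop (e (pred1 D)) La]> <= S)%VS by apply/subvP; exact: addvS lS (subvv _).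
  rewrite -memvE memv_span //.
  by apply/mapP; exists D => //; rewrite mem_filter dD.
move=> /dimvS le dE; rewrite -(leq_add2r (\dim (corad_filt C p))) dE.
apply: leq_trans le _; apply: leq_trans (dimv_add_leqif _ _) _.
by rewrite leq_add2r (leq_trans (dim_span _)) // size_map size_filter.
Qed.

End TopBlocks.

(** * Hopf algebras *)

Section SweedlerSums.
Variables (k : fieldType) (C : coalgebra k).

Lemma linear_bigZ (V W : vectType k) (f : V -> W) I (r : seq I) (a : I -> k) (v : I -> V) :
  linear f -> f (\sum_(i <- r) a i *: v i) = \sum_(i <- r) a i *: f (v i).
Proof.
move=> lf; rewrite -(linfunK lf) linear_sum; apply: eq_bigr => i _.
by rewrite linearZ /= (linfunK lf).
Qed.

(** Sweedler notation in coordinates: c_1 runs over the fixed basis and c_2 over the slices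
    [lop (bfun i) c]. The computations in Hopf algebras below use this form. *)
Lemma tlift_lop (W : vectType k) (b : C -> C -> W) c :
  (forall y, linear (b ^~ y)) -> (forall x, linear (b x)) ->
  tlift b (comul C c) = \sum_i b (bvec i) (lop (bfun i) c).
Proof.
move=> bl br; rewrite comul_lop linear_sum; apply: eq_bigr => i _ /=.
exact: tlift_tens.
Qed.

(* Both sides are \sum F c_1 c_2 c_3 in Sweedler notation. *)
Lemma coassoc_sum (W : vectType k) (F : C -> C -> C -> W) c :
  (forall x z, linear (fun y => F x y z)) -> (forall x y, linear (F x y)) ->
  \sum_i \sum_j F (bvec i) (bvec j) (lop (bfun j) (lop (bfun i) c)) =
  \sum_p \sum_i F (bvec i) (lop (bfun i) (bvec p)) (lop (bfun p) c).
Proof.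
move=> l2 l3; rewrite [RHS]exchange_big; apply: eq_bigr => i _ /=.
under [RHS]eq_bigr => p _.
  rewrite (bvec_sum (lop (bfun i) (bvec p))) (linear_bigZ _ _ _ (l2 _ _)); over.
rewrite [RHS]exchange_big; apply: eq_bigr => j _ /=.
rewrite lop_lop lop_sum (linear_bigZ _ _ _ (l3 _ _)); apply: eq_bigr => p _.
by rewrite convEl.
Qed.

End SweedlerSums.

Section HopfBasics.
Variables (k : fieldType) (C : coalgebra k) (H : hopf_structure C).
Notation A := 'Hom(C, k^o).
Implicit Types (a b c x y : C) (f g : A).

Definition mul a b : C := hmul H (tens a b).
Local Notation "a ** b" := (mul a b) (at level 40, left associativity).
Local Notation S := (antipode H).
Local Notation one := (hone H).

Lemma mul_linl b : linear (fun a => a ** b).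
Proof. by move=> t x y; rewrite /mul tens_linearl linearP. Qed.

Lemma mul_linr a : linear (mul a).
Proof. by move=> t x y; rewrite /mul tens_linearr linearP. Qed.

Definition lmul a : 'End(C) := linfun (mul a).
Definition rmul b : 'End(C) := linfun (fun a => a ** b).

Lemma lmulE a b : lmul a b = a ** b.
Proof. by rewrite linfunK //; exact: mul_linr. Qed.

Lemma rmulE a b : rmul b a = a ** b.
Proof. by rewrite linfunK //; exact: mul_linl. Qed.

Lemma mulZl t a b : (t *: a) ** b = t *: (a ** b).
Proof. by rewrite -!rmulE linearZ. Qed.

Lemma mulZr t a b : a ** (t *: b) = t *: (a ** b).
Proof. by rewrite -!lmulE linearZ. Qed.

Lemma mul_suml I (r : seq I) (F : I -> C) b :
  (\sum_(i <- r) F i) ** b = \sum_(i <- r) F i ** b.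
Proof. by rewrite -rmulE linear_sum; apply: eq_bigr => i _; rewrite -rmulE. Qed.

Lemma mul_sumr I (r : seq I) a (F : I -> C) :
  a ** (\sum_(i <- r) F i) = \sum_(i <- r) a ** F i.
Proof. by rewrite -lmulE linear_sum; apply: eq_bigr => i _; rewrite -lmulE. Qed.

Lemma mulmA a b c : a ** b ** c = a ** (b ** c).
Proof. exact: hmulA. Qed.

Lemma mul1m a : one ** a = a.
Proof. exact: hmul1l. Qed.

Lemma mulm1 a : a ** one = a.
Proof. exact: hmul1r. Qed.

Lemma lmul_is_linear : linear lmul.
Proof.
move=> t a b; apply/lfunP => x.
by rewrite add_lfunE scale_lfunE !lmulE mul_linl.
Qed.

HB.instance Definition _ := GRing.isLinear.Build k C 'End(C) _ lmul lmul_is_linear.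

Lemma lmulM a b : lmul (a ** b) = (lmul a \o lmul b)%VF.
Proof. by apply/lfunP => x; rewrite comp_lfunE !lmulE mulmA. Qed.

Lemma lmul1 : lmul one = \1%VF.
Proof. by apply/lfunP => x; rewrite lmulE mul1m id_lfunE. Qed.

Lemma comulM_sum (W : vectType k) (F : C -> C -> W) a b :
  (forall y, linear (F ^~ y)) -> (forall x, linear (F x)) ->
  tlift F (comul C (a ** b)) =
  \sum_i \sum_j F (bvec i ** bvec j) (lop (bfun i) a ** lop (bfun j) b).
Proof.
move=> Fl Fr; rewrite /mul comulM linear_tlift /=.
rewrite (eq_tlift (b' := fun a1 a2 => \sum_j F (a1 ** bvec j) (a2 ** lop (bfun j) b))).
  rewrite tlift_lop // => [y|x] t u v; rewrite scaler_sumr -big_split;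
    by apply: eq_bigr => j _ /=; rewrite mul_linl ?Fl ?Fr.
move=> a1 a2; rewrite linear_tlift tlift_lop => [|y|x] /=.
- by apply: eq_bigr => j _; rewrite tlift_tens.
- by move=> t u v; rewrite !tlift_tens // -Fl -mul_linr.
- by move=> t u v; rewrite !tlift_tens // -Fr -mul_linr.
Qed.

Lemma lop_mul f a b : lop f (a ** b) =
  \sum_i \sum_j (f (bvec i ** bvec j) : k) *: (lop (bfun i) a ** lop (bfun j) b).
Proof.
rewrite lopE lslE comulM_sum // => [y|x] t u v; first by rewrite linearP scalerDl scalerA.
by rewrite scalerDr !scalerA mulrC.
Qed.

Lemma counit_mul a b : counit C (a ** b) = (counit C a : k) * (counit C b : k).
Proof. exact: counitM. Qed.

Lemma antipode_l a : \sum_i S (bvec i) ** lop (bfun i) a = counit C a *: one.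
Proof.
rewrite -antipodel tlift_lop // => [y|x] t u v; last exact: mul_linr.
by rewrite linearP; exact: mul_linl.
Qed.

Lemma antipode_r a : \sum_i bvec i ** S (lop (bfun i) a) = counit C a *: one.
Proof.
rewrite -antipoder tlift_lop // => [y|x] t u v; first exact: mul_linl.
by rewrite linearP; exact: mul_linr.
Qed.

Lemma antipode1 : S one = one.
Proof.
have := antipodel H one; rewrite (comul1 H) (counit1 H) scale1r tlift_tens => [|y|x].
- by rewrite -/(mul _ _) mulm1.
- by move=> t u v; rewrite linearP; exact: mul_linl.
- by move=> t u v; exact: mul_linr.
Qed.

Lemma sum_lop_counit a : \sum_p (counit C (bvec p) : k) *: lop (bfun p) a = a.
Proof. by rewrite -lop_sum lop_counit. Qed.

Lemma sum_counit_lop a : \sum_p (counit C (lop (bfun p) a) : k) *: bvec p = a.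
Proof. by rewrite [RHS]bvec_sum; apply: eq_bigr => i _; rewrite counit_lop. Qed.

(** X is S(a_1 b_1) a_2 b_2 S(b_3) S(a_3). Contracting a_2 b_2 S(b_3) S(a_3) leaves S(ab);
    contracting S(a_1 b_1) a_2 b_2 leaves S(b) S(a). *)
Lemma antipodeM a b : S (a ** b) = S b ** S a.
Proof.
pose X := \sum_i \sum_p \sum_j \sum_q S (bvec i ** bvec j) **
  ((bvec p ** bvec q) ** (S (lop (bfun q) (lop (bfun j) b)) ** S (lop (bfun p) (lop (bfun i) a)))).
transitivity X.
  rewrite -{1}(sum_counit_lop a) mul_suml linear_sum /X; apply: eq_bigr => i _ /=.
  rewrite exchange_big /=.
  rewrite mulZl linearZ /= -{1}(sum_counit_lop b) mul_sumr linear_sum scaler_sumr.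
  apply: eq_bigr => j _ /=; rewrite mulZr linearZ /=.
  under [RHS]eq_bigr => p _.
    under eq_bigr => q _ do rewrite mulmA -(mulmA (bvec q)).
    rewrite -mul_sumr -mul_sumr -mul_suml antipode_r mulZl mul1m mulZr mulZr; over.
  rewrite -scaler_sumr -mul_sumr antipode_r mulZr mulm1 !scalerA.
  by rewrite mulrC.
pose G x y z := \sum_j \sum_q S (x ** bvec j) **
  ((y ** bvec q) ** (S (lop (bfun q) (lop (bfun j) b)) ** S z)).
have -> : X = \sum_p \sum_i G (bvec i) (lop (bfun i) (bvec p)) (lop (bfun p) a).
  rewrite -coassoc_sum // => x y t u v; rewrite /G scaler_sumr -big_split;
    apply: eq_bigr => j _ /=; rewrite scaler_sumr -big_split;
    apply: eq_bigr => q _ /=; first by rewrite !(mul_linl, mul_linr).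
  by rewrite linearP !mul_linr.
rewrite -{2}(sum_lop_counit a) linear_sum mul_sumr; apply: eq_bigr => p _ /=.
rewrite linearZ mulZr /= -{1}(sum_lop_counit b) linear_sum mul_suml scaler_sumr.
transitivity (\sum_i \sum_q \sum_j S (bvec i ** bvec j) **
  ((lop (bfun i) (bvec p) ** lop (bfun j) (bvec q)) ** (S (lop (bfun q) b) ** S (lop (bfun p) a)))).
  apply: eq_bigr => i _; rewrite /G.
  pose K x y z := S (bvec i ** x) **
    ((lop (bfun i) (bvec p) ** y) ** (S z ** S (lop (bfun p) a))).
  rewrite (coassoc_sum (F := K)) // => x y t u v; rewrite /K.
    by rewrite !(mul_linl, mul_linr).
  by rewrite linearP mul_linl !mul_linr.
rewrite exchange_big; apply: eq_bigr => q _ /=.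
rewrite linearZ mulZl /= scalerA -counit_mul.
rewrite -[S _ ** S _ in RHS]mul1m -mulZl -(antipodel H) comulM_sum => [|y|x] /=.
- rewrite mul_suml; apply: eq_bigr => i _; rewrite mul_suml; apply: eq_bigr => j _.
  by rewrite -/(mul _ _) !mulmA.
- by move=> t u v; rewrite linearP -/(mul _ _) mul_linl.
- by move=> t u v; rewrite -/(mul _ _) mul_linr.
Qed.


End HopfBasics.

(** * Integrals and the antipode *)

Section Integral.
Variables (k : fieldType) (C : coalgebra k) (H : hopf_structure C).
Notation A := 'Hom(C, k^o).
Implicit Types (a b c x y : C) (f g : A).
Local Notation "a ** b" := (mul H a b) (at level 40, left associativity).
Local Notation S := (antipode H).
Local Notation one := (hone H).

Let S2 : 'End(C) := (S \o S)%VF.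
Let S2E a : S2 a = S (S a).
Proof. exact: comp_lfunE. Qed.
Let S2M a b : S2 (a ** b) = S2 a ** S2 b.
Proof. by rewrite !S2E !antipodeM. Qed.

Let twisted x f : 'End(C) := (rmul H x \o (S2 \o lop f))%VF.

Let twistedE x f y : twisted x f y = S2 (lop f y) ** x.
Proof. by rewrite comp_lfunE rmulE comp_lfunE. Qed.

(** The left side is S(S(a_1) a_2). *)
Lemma antipode_shift a : \sum_i S (lop (bfun i) a) ** S2 (bvec i) = counit C a *: one.
Proof.
under eq_bigr do rewrite S2E -antipodeM.
by rewrite -linear_sum antipode_l linearZ /= antipode1.
Qed.

(** Insert S(a_3) S^2(a_2) into f(a y_1) S^2(y_2) x to get S(a_3) S^2(a_2 y_2) f(a_1 y_1) x; here
    a_1 y_1 and a_2 y_2 recombine into the comultiplication of a product. *)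
Lemma twisted_lmul x f a :
  twisted x (f \o lmul H a)%VF =
  \sum_i (lmul H (S (lop (bfun i) a)) \o (twisted x f \o lmul H (bvec i)))%VF.
Proof.
apply/lfunP => y; rewrite twistedE sum_lfunE lop_sum linear_sum mul_suml.
transitivity (\sum_j \sum_p \sum_i (f (bvec p ** bvec j) : k) *:
   (S (lop (bfun i) (lop (bfun p) a)) ** (S2 (bvec i) ** (S2 (lop (bfun j) y) ** x)))).
  apply: eq_bigr => j _; rewrite comp_lfunE lmulE linearZ mulZl /=.
  rewrite -{1}(sum_counit_lop a) mul_suml linear_sum scaler_suml; apply: eq_bigr => p _ /=.
  rewrite -scaler_sumr mulZl linearZ /=.
  under [in RHS]eq_bigr do rewrite -mulmA.
  rewrite -mul_suml antipode_shift mulZl mul1m scalerA; congr (_ *: _); exact: mulrC.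
transitivity (\sum_j \sum_p \sum_i (f (bvec i ** bvec j) : k) *:
   (S (lop (bfun p) a) ** (S2 (lop (bfun i) (bvec p)) ** (S2 (lop (bfun j) y) ** x)))).
  apply: eq_bigr => j _.
  pose F a1 a2 a3 := (f (a1 ** bvec j) : k) *: (S a3 ** (S2 a2 ** (S2 (lop (bfun j) y) ** x))).
  rewrite (coassoc_sum (F := F)) // => a1 a2 t u v; rewrite /F.
    by rewrite linearP mul_linl mul_linr scalerDr !scalerA (mulrC t).
  by rewrite linearP mul_linl scalerDr !scalerA (mulrC t).
rewrite exchange_big; apply: eq_bigr => p _ /=.
rewrite exchange_big comp_lfunE lmulE comp_lfunE twistedE lmulE lop_mul linear_sum.
rewrite mul_suml mul_sumr; apply: eq_bigr => i _ /=.
rewrite linear_sum mul_suml mul_sumr; apply: eq_bigr => j _ /=.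
by rewrite linearZ mulZl mulZr /= S2M mulmA.
Qed.

(* Larson and Sweedler's projection onto the left integrals, written as a trace. *)
Definition integral_of x : C := \sum_i ltr (twisted x (bfun i)) *: bvec i.

Lemma integral_ofE x f : f (integral_of x) = ltr (twisted x f) :> k.
Proof.
rewrite linear_sum.
have -> : twisted x f = \sum_i (f (bvec i) : k) *: twisted x (bfun i).
  apply/lfunP => y; rewrite twistedE lop_sum linear_sum mul_suml sum_lfunE.
  by apply: eq_bigr => i _; rewrite linearZ mulZl scale_lfunE twistedE.
rewrite ltr_sum; apply: eq_bigr => i _; rewrite ltrZ linearZ /=; exact: mulrC.
Qed.

Definition left_integral c := forall a, a ** c = (counit C a : k) *: c.

(** After [twisted_lmul], cyclicity of the trace brings S(a_2) next to a_1, and a_1 S(a_2) collapses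
    to the counit. *)
Lemma integral_of_left x : left_integral (integral_of x).
Proof.
move=> a; apply: functional_ext => f; rewrite -lmulE -comp_lfunE.
rewrite [LHS]integral_ofE linearZ /= integral_ofE twisted_lmul ltr_sum.
under eq_bigr do rewrite ltrC -comp_lfunA -lmulM.
pose T := twisted x f.
have -> : \sum_i ltr (T \o lmul H (bvec i ** S (lop (bfun i) a)))%VF =
    ltr (T \o lmul H (\sum_i bvec i ** S (lop (bfun i) a)))%VF.
  rewrite -ltr_sum; congr ltr; apply/lfunP => z.
  rewrite sum_lfunE comp_lfunE lmulE mul_suml linear_sum.
  by apply: eq_bigr => i _; rewrite comp_lfunE lmulE.
by rewrite antipode_r linearZ /= lmul1 -comp_lfunZr comp_lfun1r ltrZ.
Qed.

(** If the construction gave only 0, all the twisted maps would have trace 0. But the map y |->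
    counit(y) 1, which equals S^2(y_2) S(y_1), is a sum of them, and its trace is counit(1) = 1. *)
Lemma left_integral_exists : exists2 c, c != 0 & left_integral c.
Proof.
suff [x x0] : exists x, integral_of x <> 0.
  by exists (integral_of x); [exact/eqP|exact: integral_of_left].
apply: contrapT => H0.
have T0 x f : ltr (twisted x f) = 0.
  rewrite -integral_ofE; suff -> : integral_of x = 0 by rewrite linear0.
  by apply: contrapT => x0; apply: H0; exists x.
pose T : 'End(C) := linfun (fun y => (counit C y : k) *: one).
have TE : T = \sum_i twisted (S (bvec i)) (bfun i).
  apply/lfunP => y; rewrite sum_lfunE.
  under eq_bigr do rewrite twistedE S2E -antipodeM.
  rewrite -linear_sum antipode_r linearZ /= antipode1 linfunK // => a u v.
  by rewrite linearP scalerDl scalerA.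
have := ltr_rank1 (counit C) one; rewrite -/T TE ltr_sum big1 // (counit1 H).
by move/esym/eqP; rewrite oner_eq0.
Qed.

Section FrobeniusIntegral.
Variables (La : C) (La0 : La != 0) (LaI : left_integral La).

(** Write a La_2 f(La_1) as f(S(a_1) a_2 La_1) a_3 La_2; the factors a_2 La_1 and a_3 La_2 come from
    the comultiplication of a_2 La, which is counit(a_2) La. *)
Lemma mul_lop_integral a f : a ** lop f La = lop (f \o lmul H (S a))%VF La.
Proof.
transitivity (\sum_i lop (f \o lmul H (S (bvec i)))%VF (lop (bfun i) a ** La)); last first.
  under eq_bigr do rewrite LaI linearZ /= -scale_lfunE -linearZ /=.
  rewrite -sum_lfunE -linear_sum; congr (lop _ _); apply/lfunP => z.
  rewrite sum_lfunE comp_lfunE lmulE -{2}(sum_counit_lop a) linear_sum mul_suml linear_sum.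
  apply: eq_bigr => i _; rewrite scale_lfunE [(_ \o lmul _ _)%VF _]comp_lfunE lmulE.
  by rewrite linearZ /= mulZl linearZ.
pose F x y z := \sum_j (f (S x ** (y ** bvec j)) : k) *: (z ** lop (bfun j) La).
transitivity (\sum_i \sum_j F (bvec i) (bvec j) (lop (bfun j) (lop (bfun i) a))); last first.
  apply: eq_bigr => i _; rewrite lop_mul; apply: eq_bigr => j _; apply: eq_bigr => l _.
  by rewrite comp_lfunE lmulE.
rewrite coassoc_sum => [|x z t u v|x y t u v].
- rewrite -{1}(sum_lop_counit a) mul_suml; apply: eq_bigr => p _.
  rewrite mulZl (lop_sum f) mul_sumr scaler_sumr exchange_big; apply: eq_bigr => l _ /=.
  rewrite mulZr scalerA -scaler_suml; congr (_ *: _).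
  under eq_bigr do rewrite -mulmA.
  have /(congr1 (fun x => f (x ** bvec l) : k)) := antipode_l H (bvec p).
  by rewrite mulZl mul1m linearZ mul_suml linear_sum => ->.
- rewrite scaler_sumr -big_split; apply: eq_bigr => j _.
  by rewrite mul_linl mul_linr linearP scalerDl scalerA.
- rewrite scaler_sumr -big_split; apply: eq_bigr => j _.
  by rewrite mul_linl scalerDr !scalerA (mulrC t).
Qed.

(** By [mul_lop_integral] the image W is a left ideal. It contains 1: for x = [lop f La] with f La
    <> 0, all x_2 are in W and S(x_1) x_2 = f(La) 1. *)
Lemma lam_map_full : limg (lam_map La) = fullv.
Proof.
set W := limg _.
have WP x : x \in W -> exists f, x = lop f La.
  by move=> /memv_imgP[f _ ->]; exists f; rewrite lam_mapE.
have Wlop f : lop f La \in W by rewrite -lam_mapE memv_img ?memvf.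
have Wmul a x : x \in W -> a ** x \in W by move=> /WP[f ->]; rewrite mul_lop_integral.
have [f f0] := functional_nz La0.
have one_W : one \in W.
  have : \sum_i S (bvec i) ** lop (bfun i) (lop f La) \in W.
    by apply: memv_suml => i _; rewrite lop_lop Wmul.
  rewrite antipode_l counit_lop => /(memvZ (f La : k)^-1).
  by rewrite scalerA mulVf ?scale1r //; exact/eqP.
by apply/eqP; rewrite eqEsubv subvf; apply/subvP => x _; rewrite -(mulm1 H x) Wmul.
Qed.

(** Write 1 as [lop f La]; then a = a 1 depends only on S(a). *)
Lemma antipode_inj : lker S == 0%VS.
Proof.
rewrite -subv0; apply/subvP => a; rewrite memv_ker memv0 => /eqP a0.
have [f fE] := lam_mapP lam_map_full one.
rewrite -(mulm1 H a) fE mul_lop_integral a0 linear0 comp_lfun0r linear0.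
by rewrite zero_lfunE.
Qed.

Lemma rop_one g : rop g one = (g one : k) *: one.
Proof. by rewrite ropE (comul1 H) rsl_tens. Qed.

(* a_1 S(a_2)_2 (x) S(a_2)_1 = 1 (x) S(a): apply lop g to both sides of mul_lop_integral
   and compare the functionals applied to La. *)
Lemma sum_lop_antipode f a :
  \sum_i bvec i ** lop f (S (lop (bfun i) a)) = (f (S a) : k) *: one.
Proof.
apply: functional_ext => g.
have : conv (f \o lmul H (S a))%VF g =
    \sum_i \sum_j (g (bvec i ** bvec j) : k) *:
      (conv f (bfun j) \o lmul H (S (lop (bfun i) a)))%VF.
  apply: (lam_map_inj lam_map_full).
  rewrite -lop_lop -mul_lop_integral lop_mul linear_sum sum_lfunE; apply: eq_bigr => i _ /=.
  rewrite linear_sum sum_lfunE; apply: eq_bigr => j _ /=.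
  by rewrite linearZ scale_lfunE /= -mul_lop_integral lop_lop.
move/(congr1 (fun h : A => h one)); rewrite convE rop_one linearZ /=.
rewrite [(f \o lmul _ _)%VF _]comp_lfunE lmulE mulm1.
rewrite sum_lfunE linearZ /= linear_sum => E.
rewrite (_ : f (S a) *: g one = g one *: f (S a)); last exact: mulrC.
rewrite E; apply: eq_bigr => i _ /=; set z := S (lop _ _).
have -> : g (bvec i ** lop f z) = conv f (g \o lmul H (bvec i))%VF z.
  by rewrite convEl [RHS]comp_lfunE lmulE.
rewrite convE rop_sum linear_sum sum_lfunE; apply: eq_bigr => j _ /=.
rewrite scale_lfunE [(conv _ _ \o _)%VF _]comp_lfunE lmulE mulm1 convE linearZ /=.
by rewrite [(g \o _)%VF _]comp_lfunE lmulE.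
Qed.

Lemma rop_bvec h a : rop h a = \sum_p (h (lop (bfun p) a) : k) *: bvec p.
Proof.
apply: functional_ext => g; rewrite -convE convEl lop_sum !linear_sum.
by apply: eq_bigr => p _; rewrite !linearZ; exact: mulrC.
Qed.

(** Multiply [sum_lop_antipode] at a_2 by S(a_1) on the left: S(a_1) a_2 cancels by coassociativity
    and [lop f (S a)] remains. *)
Lemma lop_antipode f a : lop f (S a) = S (rop (f \o S)%VF a).
Proof.
rewrite rop_bvec linear_sum.
transitivity (\sum_p S (bvec p) ** ((f (S (lop (bfun p) a)) : k) *: one)); last first.
  by apply: eq_bigr => p _; rewrite mulZr mulm1 linearZ /= [(f \o S)%VF _]comp_lfunE.
under eq_bigr do rewrite -sum_lop_antipode mul_sumr.
rewrite (coassoc_sum (F := fun x y z => S x ** (y ** lop f (S z)))) => [|x z t u v|x y t u v].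
- rewrite -{1}(sum_lop_counit a) !linear_sum; apply: eq_bigr => q _ /=.
  under eq_bigr do rewrite -mulmA.
  by rewrite -mul_suml antipode_l mulZl mul1m !linearZ.
- by rewrite mul_linl mul_linr.
- by rewrite !linearP /= !mul_linr.
Qed.

Lemma rop_antipode f a : rop f (S a) = S (lop (f \o S)%VF a).
Proof.
apply: functional_ext => g; rewrite -convE convEl lop_antipode.
by rewrite -comp_lfunE -convE convEl comp_lfunE.
Qed.

Lemma antipode_comorph : comorph true S.
Proof.
split=> [|[] f c]; [exact: antipode_inj|exact: rop_antipode|exact: lop_antipode].
Qed.

End FrobeniusIntegral.
End Integral.

(** * Divisibility by the number of group-likes *)

Section RootsOfUnity.
Variables (k : closedFieldType) (k0 : [pchar k] =i pred0).

Lemma natr_inj : injective (fun n : nat => n%:R : k).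
Proof.
suff H m n : (m <= n)%N -> m%:R = n%:R :> k -> m = n.
  by move=> m n; case: (leqP m n) => [/H //|/ltnW/H nm /esym/nm].
move=> le mn; apply/eqP; rewrite eqn_leq le -subn_eq0.
by rewrite -((pcharf0P k).1 k0) natrB // mn subrr eqxx.
Qed.

Lemma natr_neq0 n : (0 < n)%N -> n%:R != 0 :> k.
Proof. by rewrite ((pcharf0P k).1 k0) lt0n. Qed.

Lemma prim_root_exists N : (0 < N)%N -> exists z : k, N.-primitive_root z.
Proof.
pose p : {poly k} := 'X^N - 1; have [r Dp] := closed_field_poly_normal p.
move=> N_gt0; rewrite (monicP _) ?monicXnsubC // scale1r in Dp.
have rn1 : all N.-unity_root r by apply/allP=> z; rewrite -root_prod_XsubC -Dp.
have sz_r : (N < (size r).+1)%N.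
  by rewrite -(size_prod_XsubC r id) -Dp size_XnsubC.
have [|z] := hasP (cyclic.has_prim_root N_gt0 rn1 _ sz_r); last by exists z.
by rewrite -separable.separable_prod_XsubC -Dp cyclotomic.separable_Xn_sub_1 // natr_neq0.
Qed.

Lemma geometric_root_sum N (w : k) : w ^+ N = 1 ->
  \sum_(a < N) w ^+ a = if w == 1 then N%:R else 0.
Proof.
move=> wN; have [->|w1] := eqVneq w 1.
  by under eq_bigr do rewrite expr1n; rewrite sumr_const card_ord.
apply: (mulfI (_ : w - 1 != 0)); first by rewrite subr_eq0.
by rewrite mulr0 -subrX1 wN subrr.
Qed.

(* If all the multiplicities m(w) are positive and m * m = n m, then at a    *)
(* point where m is minimal the convolution forces m to be constant.         *)
Lemma idempotent_multiplicities N n (p : nat -> k) : (1 < N)%N -> p 0%N = n%:R ->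
  (forall j, (j < N)%N -> p j * p j = n%:R * p j) ->
  (forall w : k, w ^+ N = 1 ->
     exists2 m, (0 < m)%N & \sum_(j < N) p j * w ^+ j = N%:R * m%:R) ->
  p 1%N = 0.
Proof.
move=> N1 p0 pp pm; have N0 : (0 < N)%N by exact: ltnW.
have [z zP] := prim_root_exists N0.
have zN : z ^+ N = 1 by exact: prim_expr_order.
have z0 : z != 0 by apply: contra_eq_neq zN => ->; rewrite expr0n -leqn0 leqNgt N0 eq_sym oner_neq0.
have NN : N%:R != 0 :> k by exact: natr_neq0.
pose P : {poly k} := \poly_(j < N) p j.
have PE w : P.[w] = \sum_(j < N) p j * w ^+ j by exact: horner_poly.
have [m mP] : exists m : k -> nat, forall w, w ^+ N = 1 ->
    (0 < m w)%N /\ P.[w] = N%:R * (m w)%:R.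
  have /choice[m mP] : forall w, exists m, w ^+ N = 1 -> (0 < m)%N /\ P.[w] = N%:R * m%:R.
    move=> w; have [/pm[m m0 mE]|wN] := pselect (w ^+ N = 1); last by exists 0%N.
    by exists m; rewrite PE.
  by exists m.
have orth (i j : 'I_N) : \sum_(a < N) (z ^+ a) ^+ i * (z^-1 ^+ a) ^+ j = if i == j then N%:R else 0.
  have -> : \sum_(a < N) (z ^+ a) ^+ i * (z^-1 ^+ a) ^+ j = \sum_(a < N) (z ^+ i / z ^+ j) ^+ a.
    by apply: eq_bigr => a _; rewrite (exprAC z) (exprAC z^-1) -exprMn exprVn.
  rewrite geometric_root_sum; last by rewrite exprMn exprVn !(exprAC _ _ N) zN !expr1n divr1.
  congr (if _ then _ else _); rewrite -subr_eq0.
  rewrite -(inj_eq (mulIf (expf_neq0 j z0))) mulrBl divfK ?expf_neq0 // mul1r mul0r subr_eq0.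
  by rewrite (eq_prim_root_expr zP) !modn_small.
have rootz a w : w ^+ N = 1 -> (w * z^-1 ^+ a) ^+ N = 1.
  by move=> wN; rewrite exprMn wN mul1r -exprM mulnC exprM exprVn zN invr1 expr1n.
have rootz1 a : (z ^+ a) ^+ N = 1 by rewrite -exprM mulnC exprM zN expr1n.
(* The discrete Fourier transform of the pointwise identity p j * p j = n p j. *)
have P_conv w : \sum_(a < N) P.[z ^+ a] * P.[w * z^-1 ^+ a] = N%:R * n%:R * P.[w].
  transitivity (\sum_(i < N) \sum_(j < N) p i * p j * w ^+ j *
      \sum_(a < N) (z ^+ a) ^+ i * (z^-1 ^+ a) ^+ j).
    under eq_bigr => a _.
      rewrite !PE big_distrlr /=; over.
    rewrite exchange_big; apply: eq_bigr => i _ /=.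
    rewrite exchange_big; apply: eq_bigr => j _ /=.
    rewrite mulr_sumr; apply: eq_bigr => a _; rewrite exprMn.
    by rewrite mulrACA [X in _ * X = _]mulrCA -[RHS]mulrA.
  rewrite PE mulr_sumr; apply: eq_bigr => i _.
  rewrite (bigD1 i) //= [X in _ + X]big1 => [|j ji]; last by rewrite orth eq_sym (negPf ji) mulr0.
  by rewrite orth eqxx addr0 pp // mulrC !mulrA.
have conv_m w : w ^+ N = 1 ->
    (\sum_(a < N) m (z ^+ a) * m (w * z^-1 ^+ a)%R)%N = (n * m w)%N.
  move=> wN; apply: natr_inj; rewrite natr_sum natrM.
  apply: (mulfI NN); apply: (mulfI NN).
  transitivity (N%:R * n%:R * P.[w]); last first.
    by rewrite (mP _ wN).2 -!mulrA; congr (_ * _); exact: mulrCA.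
  rewrite -P_conv !mulr_sumr; apply: eq_bigr => a _.
  by rewrite (mP _ (rootz1 a)).2 (mP _ (rootz a w wN)).2 natrM [RHS]mulrACA mulrA.
(* Summing P over all N-th roots of unity isolates the coefficient p 0 = n. *)
have sum_m : (\sum_(a < N) m (z ^+ a) = n)%N.
  apply: natr_inj; rewrite natr_sum; apply: (mulfI NN); rewrite mulr_sumr.
  under eq_bigr do rewrite -(mP _ (rootz1 _)).2 PE.
  rewrite exchange_big /= -p0.
  have orth0 (i : 'I_N) : \sum_(a < N) (z ^+ a) ^+ i = if i == Ordinal N0 then N%:R else 0.
    by rewrite -orth; apply: eq_bigr => a _; rewrite expr0 mulr1.
  under eq_bigr do rewrite -mulr_sumr orth0.
  rewrite (bigD1 (Ordinal N0)) //= big1 => [|i /negPf ->]; last by rewrite mulr0.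
  by rewrite addr0 mulrC.
have [w1 w1N w1min] : exists2 w1, w1 ^+ N = 1 & forall w, w ^+ N = 1 -> (m w1 <= m w)%N.
  have ex : exists v, `[< exists2 w, w ^+ N = 1 & m w = v >].
    by exists (m 1); apply/asboolP; exists 1 => //; exact: expr1n.
  case: (ex_minnP ex) => v /asboolP[w1 w1N <-] min; exists w1 => // w wN.
  by apply: min; apply/asboolP; exists w.
have const a : (a < N)%N -> m (w1 * z^-1 ^+ a) = m w1.
  move=> aN; apply/eqP; rewrite eqn_leq w1min ?rootz // andbT leqNgt; apply/negP => lt.
  have : (\sum_(b < N) m (z ^+ b) * m w1 < \sum_(b < N) m (z ^+ b) * m (w1 * z^-1 ^+ b)%R)%N.
    rewrite (bigD1 (Ordinal aN)) //= [X in (_ < X)%N](bigD1 (Ordinal aN)) //= -addSn.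
    apply: leq_add; first by rewrite ltn_pmul2l // (mP _ (rootz1 a)).1.
    by apply: leq_sum => b _; rewrite leq_mul2l w1min ?orbT // rootz.
  by rewrite conv_m // -big_distrl /= sum_m ltnn.
(* P has degree less than N and takes one value at N distinct points, so it is constant and its
   coefficient p 1 vanishes. *)
pose R := P - (N%:R * (m w1)%:R)%:P.
have R0 : R = 0.
  apply: (@roots_geq_poly_eq0 _ _ [seq w1 * z^-1 ^+ a | a <- iota 0 N]).
  - apply/allP => x /mapP[a]; rewrite mem_iota add0n => /andP[_ aN] ->.
    by rewrite rootE /R hornerD hornerN hornerC (mP _ (rootz a _ w1N)).2 const // subrr.
  - rewrite map_inj_in_uniq ?iota_uniq // => a b.
    rewrite !mem_iota !add0n /= => aN bN.
    have w10 : w1 != 0.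
      by apply: contra_eq_neq w1N => ->; rewrite expr0n -leqn0 leqNgt N0 eq_sym oner_neq0.
    move/(mulfI w10)/eqP; rewrite !exprVn (inj_eq invr_inj) (eq_prim_root_expr zP).
    by rewrite !modn_small // => /eqP.
  - rewrite size_map size_iota (leq_trans (size_polyD _ _)) // geq_max size_poly size_polyN.
    by rewrite (leq_trans (size_polyC_leq1 _)).
have /(congr1 (fun q : {poly k} => q`_1)) := R0.
by rewrite coefB coef_poly N1 coefC subr0 coef0.
Qed.

End RootsOfUnity.

(** With p the projection, X p Y = p X p Y because X preserves M; cyclicity moves the first p to the
    end, and p Y p = Y p. *)
Lemma tr_proj_sub (k : fieldType) (V : vectType k) (M : {vspace V}) (X Y : 'End(V)) :
  (X @: M <= M)%VS -> (Y @: M <= M)%VS ->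
  ltr (X \o (projv M \o Y))%VF = ltr (X \o (Y \o projv M))%VF.
Proof.
move=> /limg_subP XM /limg_subP YM; set p := projv M.
have -> : (X \o (p \o Y) = p \o (X \o (p \o Y)))%VF.
  by apply/lfunP => x; rewrite !comp_lfunE [RHS]projv_id // XM ?memv_proj.
rewrite [LHS]ltrC; congr ltr; apply/lfunP => x.
have Yx : Y (p x) \in M by apply: YM; exact: memv_proj.
by rewrite !comp_lfunE (projv_id Yx).
Qed.

Section Grouplikes.
Variables (k : fieldType) (C : coalgebra k) (H : hopf_structure C).
Notation A := 'Hom(C, k^o).
Implicit Types (a b c x y g h : C) (f : A).
Local Notation "a ** b" := (mul H a b) (at level 40, left associativity).
Local Notation S := (antipode H).
Local Notation one := (hone H).
Local Notation glike := (@grouplikes k C).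

Lemma lop_grouplike f g : glike g -> lop f g = (f g : k) *: g.
Proof. by move=> [gD _]; rewrite lopE gD lsl_tens. Qed.

Lemma lop_gmul f g x : glike g -> lop f (g ** x) = g ** lop (f \o lmul H g)%VF x.
Proof.
move=> gG; rewrite lop_mul [lop (_ \o _)%VF _]lop_sum mul_sumr.
rewrite exchange_big; apply: eq_bigr => j _ /=.
rewrite mulZr [(f \o _)%VF _]comp_lfunE lmulE.
under eq_bigr do rewrite (lop_grouplike _ gG) mulZl scalerA mulrC -scalerA.
have -> : (f (g ** bvec j) : k) = \sum_i (bfun i g : k) * (f (bvec i ** bvec j) : k).
  rewrite {1}(bvec_sum g) mul_suml linear_sum; apply: eq_bigr => i _.
  by rewrite mulZl linearZ.
by rewrite scaler_suml; apply: eq_bigr => i _; rewrite scalerA.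
Qed.

Lemma rop_gmul f g x : glike g -> rop f (g ** x) = g ** rop (f \o lmul H g)%VF x.
Proof.
move=> gG; apply: functional_ext => h.
rewrite -convE convEl (lop_gmul _ _ gG) -lmulE -comp_lfunE -convEl.
by rewrite convE comp_lfunE lmulE.
Qed.

Lemma antipode_grouplike g : glike g -> S g ** g = one /\ g ** S g = one.
Proof.
move=> [gD ge]; have l := antipodel H g; have r := antipoder H g.
move: l r; rewrite gD ge scale1r !tlift_tens // => [z t u v|x t u v|z t u v|x t u v];
  rewrite -!/(mul H _ _) ?linearP; by [exact: mul_linl|exact: mul_linr].
Qed.

Lemma lmul_grouplike_inj g : glike g -> lker (lmul H g) == 0%VS.
Proof.
move=> /antipode_grouplike[gS _]; apply/lker0P => x y.
by rewrite !lmulE => /(congr1 (mul H (S g))); rewrite -!mulmA gS !mul1m.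
Qed.

Lemma lmul_comorph g : glike g -> comorph false (lmul H g).
Proof.
move=> gG; split=> [|a f c]; first exact: lmul_grouplike_inj.
by rewrite addbF /xop !lmulE; case: a; [exact: rop_gmul|exact: lop_gmul].
Qed.

Lemma grouplikeM g h : glike g -> glike h -> glike (g ** h).
Proof.
move=> gG [hD he]; split.
  apply: lsl_ext => f; rewrite -lopE (lop_gmul _ _ gG) lopE hD !lsl_tens.
  by rewrite mulZr comp_lfunE lmulE.
by case: gG => _ ge; rewrite counit_mul ge he mul1r.
Qed.

Lemma grouplike1 : glike one.
Proof. by split; [exact: comul1|exact: counit1]. Qed.

Lemma antipode_l_rop a : \sum_i S (rop (bfun i) a) ** bvec i = counit C a *: one.
Proof.
rewrite -antipodel comul_rop linear_sum; apply: eq_bigr => i _ /=.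
rewrite tlift_tens // => [y|x] t u v; last exact: mul_linr.
by rewrite linearP; exact: mul_linl.
Qed.

(* For a Hopf module M the map x (x) y |-> x_1 (x) x_2 y is an isomorphism   *)
(* between M (x) H with g acting on M only and M (x) H with diagonal action; *)
(* this compares the traces.                                                 *)
Lemma hopf_module_trace (M : {vspace C}) g : glike g -> right_stable M ->
  (lmul H g @: M <= M)%VS ->
  ltr (lmul H g \o projv M)%VF * ltr (lmul H g) =
  ltr (lmul H g \o projv M)%VF * (\dim {:C})%:R.
Proof.
move=> gG rM gM; set L := lmul H g; set p := projv M.
have RM f : (rop f @: M <= M)%VS by apply/limg_subP => x; exact: rM.
pose al : 'Hom(A, k^o) := linfun (fun f => ltr (L \o (rop f \o p))%VF : k^o).
have alE f : al f = ltr (L \o (rop f \o p))%VF.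
  rewrite linfunK // => t f1 f2; rewrite -[RHS]/(t * ltr _ + ltr _) -ltrZ -ltrD.
  apply: (f_equal (@ltr k C)); apply/lfunP => x.
  rewrite add_lfunE scale_lfunE ![(L \o _)%VF _]comp_lfunE ![(_ \o p)%VF _]comp_lfunE.
  by rewrite ropP linearP.
pose tr (T : 'End(C)) : 'Hom(C, k^o) := linfun (fun b => ltr (T \o lmul H b)%VF : k^o).
have trE T b : tr T b = ltr (T \o lmul H b)%VF.
  rewrite linfunK // => t b1 b2; rewrite -[RHS]/(t * ltr _ + ltr _) -ltrZ -ltrD.
  apply: (f_equal (@ltr k C)); apply/lfunP => x.
  by rewrite add_lfunE scale_lfunE ![(T \o _)%VF _]comp_lfunE !lmulE mul_linl linearP.
(* The trace form [al] on the dual algebra is evaluation at an element of C, the character of M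
   twisted by the action of g. *)
have [a aE] : exists a, forall f, al f = f a.
  exists (\sum_q (al (bfun q) : k) *: bvec q) => f; rewrite {1}(bfun_sum f) !linear_sum.
  by apply: eq_bigr => q _; rewrite !linearZ; exact: mulrC.
have al1 : ltr (L \o p)%VF = counit C a.
  rewrite -aE alE; congr ltr; apply/lfunP => x.
  by rewrite ![(L \o _)%VF _]comp_lfunE [(_ \o p)%VF _]comp_lfunE rop_counit.
(* Both sides reduce to this sum: one by expanding a_1 S(a_2) = counit(a) 1, the other by expanding
   S(g a_1) g a_2, which equals S(a_1) a_2 = counit(a) 1. *)
transitivity (\sum_i \sum_j ltr (L \o (rop (bfun i) \o (p \o rop (bfun j))))%VF *
    ltr (L \o lmul H (bvec i ** S (bvec j)))%VF).
  transitivity ((counit C a : k) * (tr L one : k)); first by rewrite al1 trE lmul1 comp_lfun1r.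
  rewrite -[LHS]linearZ -antipode_r linear_sum; apply: eq_bigr => i _ /=.
  rewrite {1}(bvec_sum (lop (bfun i) a)) linear_sum mul_sumr linear_sum; apply: eq_bigr => j _ /=.
  rewrite linearZ mulZr linearZ /= trE -convEl -aE alE; congr (_ * _).
  rewrite [in RHS]comp_lfunA tr_proj_sub //.
    congr ltr; apply/lfunP => x; rewrite [((L \o _) \o _)%VF _]comp_lfunE.
    by rewrite ![(L \o _)%VF _]comp_lfunE ![(_ \o p)%VF _]comp_lfunE rop_rop.
  apply/limg_subP => x xM; rewrite [(L \o _)%VF _]comp_lfunE.
  by rewrite (subvP gM) // memv_img // rM.
transitivity ((counit C a : k) * (tr \1%VF one : k)); last first.
  by rewrite al1 trE lmul1 comp_lfun1r ltr1.
rewrite -[RHS]linearZ -antipode_l_rop linear_sum; apply: eq_bigr => i _ /=.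
have -> : S (rop (bfun i) a) ** bvec i = S (g ** rop (bfun i) a) ** (g ** bvec i).
  by rewrite antipodeM mulmA -(mulmA H (S g)) (antipode_grouplike gG).1 mul1m.
rewrite {1}(bvec_sum (g ** rop (bfun i) a)) linear_sum mul_suml linear_sum.
apply: eq_bigr => j _ /=.
have -> : bfun j (g ** rop (bfun i) a) = al (conv (bfun j \o L)%VF (bfun i)).
  by rewrite aE convE [RHS]comp_lfunE lmulE.
rewrite linearZ mulZl linearZ /= trE alE; congr (_ * _).
  have -> : (L \o (rop (bfun i) \o (p \o rop (bfun j))) =
             (L \o (rop (bfun i) \o p)) \o rop (bfun j))%VF by rewrite !comp_lfunA.
  rewrite ltrC; congr ltr; apply/lfunP => x; rewrite [(rop _ \o (L \o _))%VF _]comp_lfunE.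
  rewrite ![(L \o _)%VF _]comp_lfunE ![(_ \o p)%VF _]comp_lfunE -rop_rop.
  by rewrite !lmulE rop_gmul.
by rewrite comp_lfun1l !lmulM comp_lfunA [LHS]ltrC.
Qed.

End Grouplikes.

(** * The group of group-likes acting by left multiplication *)

Section GroupAction.
Variables (k : closedFieldType) (k0 : [pchar k] =i pred0).
Variables (C : coalgebra k) (H : hopf_structure C).
Implicit Types (a b c x y g h : C).
Local Notation "a ** b" := (mul H a b) (at level 40, left associativity).
Local Notation one := (hone H).
Local Notation glike := (@grouplikes k C).

Lemma grouplike_list : exists gs : seq C,
  [/\ uniq gs, forall g, g \in gs <-> glike g & size gs = card_grouplikes C].
Proof.
exists (enum_fset (fset_set glike)); split; first exact: fset_uniq.
  move=> g; rewrite -[_ \in _]/(g \in fset_set glike).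
  by rewrite in_fset_set ?in_setE //; exact: grouplikes_finite.
by rewrite /card_grouplikes cardfE.
Qed.

Lemma mul_grouplike_inj g : glike g -> injective (mul H g).
Proof.
by move=> /(lmul_grouplike_inj H)/lker0P gi x y; rewrite -!lmulE => /gi.
Qed.

Definition gpow g j : C := iter j (mul H g) one.
Arguments gpow : simpl never.

Lemma gpow_grouplike g j : glike g -> glike (gpow g j).
Proof. by move=> gG; elim: j => [|j IH]; [exact: grouplike1|exact: grouplikeM]. Qed.

Lemma gpow_cancel g i j : glike g -> (i <= j)%N -> gpow g i = gpow g j -> gpow g (j - i) = one.
Proof.
move=> gG; elim: i j => [|i IH] [|j] //.
by rewrite ltnS subSS => ij /(mul_grouplike_inj gG); exact: IH.
Qed.

Lemma gpow_order g : glike g -> exists N, [/\ (0 < N)%N, gpow g N = one &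
  forall i j, (i < N)%N -> (j < N)%N -> gpow g i = gpow g j -> i = j].
Proof.
move=> gG; have [gs [_ gsP _]] := grouplike_list.
have ex : exists N, (0 < N)%N && (gpow g N == one).
  have : ~~ uniq [seq gpow g j | j <- iota 0 (size gs).+1].
    apply/negP => /uniq_leq_size H0.
    have /H0 : {subset [seq gpow g j | j <- iota 0 (size gs).+1] <= gs}.
      by move=> _ /mapP[j _ ->]; apply/gsP/gpow_grouplike.
    by rewrite size_map size_iota ltnn.
  move=> /(uniqPn one)[i [j []]]; rewrite size_map size_iota => ij jN.
  rewrite !(nth_map 0%N) ?size_iota ?(ltn_trans ij) // !nth_iota ?(ltn_trans ij) // !add0n.
  move=> E; exists (j - i)%N; rewrite subn_gt0 ij /=.
  by apply/eqP/gpow_cancel => //; exact: ltnW.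
case: (ex_minnP ex) => N /andP[N0 /eqP gN] Nmin; exists N; split => // i j.
wlog ij : i j / (i <= j)%N.
  by move=> W iN jN E; case: (leqP i j) => [|/ltnW] ij; [exact: W|apply/esym/W].
move=> iN jN /(gpow_cancel gG ij) E; apply/eqP; rewrite eqn_leq ij -subn_eq0 -leqn0 leqNgt.
apply/negP => ji; have := Nmin (j - i)%N; rewrite ji E eqxx => /(_ isT).
by rewrite leqNgt (leq_ltn_trans (leq_subr _ _)).
Qed.

(** The trace comparison for the Hopf module C itself. *)
Lemma ltr_grouplike_sqr g : glike g ->
  ltr (lmul H g) * ltr (lmul H g) = (\dim {:C})%:R * ltr (lmul H g).
Proof.
move=> gG; have := @hopf_module_trace k C H fullv g gG.
have -> : (lmul H g \o projv fullv)%VF = lmul H g.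
  by apply/lfunP => x; rewrite comp_lfunE projv_id ?memvf.
move=> E; rewrite E ?subvf //; first exact: mulrC.
by move=> f x _; exact: memvf.
Qed.

(** Let N be the order of g. For w^N = 1 the element e is the idempotent of the cyclic group
    projecting onto the eigenspace of g for w^-1. It is nonzero because group-likes are linearly
    independent, so its rank is a positive multiplicity, as [idempotent_multiplicities] requires. *)
Lemma ltr_grouplike g : glike g -> g <> one -> ltr (lmul H g) = 0.
Proof.
move=> gG g1; have [N [N0 gN Ninj]] := gpow_order gG.
have N1 : (1 < N)%N.
  rewrite ltn_neqAle N0 andbT; apply/eqP => N1; apply: g1.
  by rewrite -gN -N1 /gpow /= mulm1.
have NN : N%:R != 0 :> k by exact: natr_neq0.
have <- : gpow g 1 = g by rewrite /gpow /= mulm1.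
apply: (idempotent_multiplicities k0 (n := \dim {:C}) (p := fun j => ltr (lmul H (gpow g j))) N1).
- by rewrite /gpow /= lmul1 ltr1.
- by move=> j _; apply: ltr_grouplike_sqr; exact: gpow_grouplike.
move=> w wN; pose e : C := N%:R^-1 *: \sum_(j < N) w ^+ j *: gpow g j.
have ge : w *: (g ** e) = e.
  rewrite /e mulZr scalerA mulrC -scalerA; congr (_ *: _).
  rewrite mul_sumr scaler_sumr.
  transitivity (\sum_(j < N) w ^+ j.+1 *: gpow g j.+1).
    by apply: eq_bigr => j _; rewrite mulZr scalerA exprS.
  case: N N0 gN wN {N1 NN Ninj e} => // N _ gN wN.
  by rewrite big_ord_recr [RHS]big_ord_recl /= wN gN expr0 addrC.
have gje j : w ^+ j *: (gpow g j ** e) = e.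
  elim: j => [|j IH]; first by rewrite scale1r mul1m.
  by rewrite exprS -scalerA /gpow iterS mulmA -mulZr IH ge.
have ee : e ** e = e.
  rewrite {1}/e mulZl mul_suml.
  under eq_bigr do rewrite mulZl gje.
  by rewrite sumr_const card_ord -scaler_nat scalerA mulVf // scale1r.
have e0 : e != 0.
  rewrite scaler_eq0 invr_eq0 (negPf NN) /=; apply/negP => /eqP s0.
  pose X := [tuple gpow g i | i < N].
  have Xi (i : 'I_N) : X`_i = gpow g i by rewrite -tnth_nth tnth_mktuple.
  have /freeP : free X.
    apply: grouplikes_free => [|h /mapP[i _ ->]]; last exact: gpow_grouplike.
    by rewrite map_inj_uniq ?enum_uniq // => i j /Ninj E; apply/val_inj/E.
  move=> /(_ (fun i => w ^+ i)) /(_ _ (Ordinal N0)) /eqP.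
  rewrite expr0 oner_eq0 => F; apply/notF/F.
  by rewrite -[RHS]s0; apply: eq_bigr => i _; rewrite Xi.
exists (\dim (limg (lmul H e))).
  rewrite lt0n dimv_eq0; apply: contra e0 => /eqP e0.
  by rewrite -memv0 -e0 -{1}(mulm1 H e) -lmulE memv_img ?memvf.
rewrite -ltr_idem; last by rewrite -lmulM ee.
rewrite /e linearZ ltrZ mulrA divff // mul1r linear_sum ltr_sum.
by apply: eq_bigr => j _; rewrite linearZ ltrZ mulrC.
Qed.

(** On M the averaging idempotent of the group has trace dim M / |G(C)|, as only g = 1 contributes
    to it; this trace is also a rank, hence an integer. *)
Lemma hopf_module_dvd (M : {vspace C}) : right_stable M ->
  (forall g, glike g -> (lmul H g @: M <= M)%VS) ->
  (card_grouplikes C %| \dim M)%N.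
Proof.
move=> rM gM; have [gs [gs_uniq gsP <-]] := grouplike_list.
have gs0 : (0 < size gs)%N.
  by have := (gsP one).2 (grouplike1 H); case: (gs).
have n0 : (\dim {:C})%:R != 0 :> k.
  apply: natr_neq0 => //; rewrite lt0n dimv_eq0; apply/negP => /eqP C0.
  have : one \in fullv by exact: memvf.
  rewrite C0 memv0 => /eqP one0; have := counit1 H; rewrite one0 linear0.
  by move/esym/eqP; rewrite oner_eq0.
have tr0 g : glike g -> g <> one -> ltr (lmul H g \o projv M)%VF = 0.
  move=> gG g1; have := hopf_module_trace gG rM (gM g gG).
  by rewrite (ltr_grouplike gG g1) mulr0 => /esym/eqP; rewrite mulf_eq0 (negPf n0) orbF => /eqP.
have NN : (size gs)%:R != 0 :> k by exact: natr_neq0.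
pose e : C := (size gs)%:R^-1 *: \sum_(g <- gs) g.
have ge g : glike g -> g ** e = e.
  move=> gG; rewrite /e mulZr mul_sumr; congr (_ *: _).
  rewrite -(big_map (mul H g) predT id); apply: perm_big.
  have gu : uniq (map (mul H g) gs) by rewrite map_inj_uniq //; exact: mul_grouplike_inj.
  apply: uniq_perm => //.
  have [] := uniq_min_size gu (_ : {subset map (mul H g) gs <= gs}) _; rewrite ?size_map //.
  by move=> _ /mapP[h /gsP hG ->]; apply/gsP/grouplikeM.
have ee : e ** e = e.
  rewrite {1}/e mulZl mul_suml big_seq.
  rewrite (eq_bigr (fun=> e)) => [|g /gsP /ge //].
  by rewrite -big_seq big_const_seq count_predT iter_addr_0 -scaler_nat scalerA mulVf // scale1r.
pose T := (lmul H e \o projv M)%VF.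
have eM x : x \in M -> e ** x \in M.
  move=> xM; rewrite /e mulZl mul_suml memvZ // big_seq; apply: memv_suml => g /gsP gG.
  by rewrite -lmulE (subvP (gM g gG)) // memv_img.
have TT : (T \o T)%VF = T.
  apply/lfunP => x; rewrite !comp_lfunE !lmulE projv_id ?eM ?memv_proj //.
  by rewrite -mulmA ee.
apply/dvdnP; exists (\dim (limg T)); apply: (natr_inj k0).
rewrite natrM -(ltr_idem TT) mulrC.
have -> : T = (size gs)%:R^-1 *: \sum_(g <- gs) (lmul H g \o projv M)%VF.
  apply/lfunP => x; rewrite comp_lfunE lmulE scale_lfunE sum_lfunE /e mulZl mul_suml.
  by congr (_ *: _); apply: eq_bigr => g _; rewrite comp_lfunE lmulE.
rewrite ltrZ mulrA divff // mul1r ltr_sum.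
rewrite (bigD1_seq one) //=; last exact/gsP/grouplike1.
rewrite big_seq_cond big1 ?addr0 => [|g /andP[/gsP gG /eqP g1]]; last exact: tr0.
rewrite lmul1 comp_lfun1l ltr_idem ?limg_proj //.
by apply/lfunP => x; rewrite comp_lfunE projv_proj.
Qed.

End GroupAction.

(** * Dimensions of isotypic pieces as traces *)

Section Multiplicities.
Variables (k : closedFieldType) (k0 : [pchar k] =i pred0) (C : coalgebra k).
Variables (pi : 'End(C)) (Q : nat -> {vspace C}) (piQ : block_data pi Q).
Variables (s : seq {vspace C}) (s_uniq : uniq s).
Hypothesis sP : forall D, D \in s <-> simple_subcoalgebra D.
Implicit Types (D E M : {vspace C}) (P R : pred {vspace C}).
Let piP : coradical_projection pi := piQ.1.
Local Notation e := (eidem pi s).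

Lemma ltr_idem_proj (V : vectType k) (X : 'End(V)) (M : {vspace V}) :
  (X @: M <= M)%VS -> {in M, forall x, X (X x) = X x} ->
  ltr (X \o projv M)%VF = (\dim (X @: M))%:R.
Proof.
move=> /limg_subP XM XX; rewrite ltr_idem; last first.
  apply/lfunP => x; rewrite !comp_lfunE [projv M (X _)]projv_id ?XM ?memv_proj //.
  by rewrite XX ?memv_proj.
by rewrite limg_comp limg_proj.
Qed.

Lemma dim_eproj_ltr M P R : subbicomodule pi M ->
  (\dim (eproj pi s P R @: M))%:R = ltr (eproj pi s P R \o projv M)%VF.
Proof.
move=> sM; rewrite ltr_idem_proj // => [|x _]; first exact: (eproj_sub piQ s P R sM).
rewrite (eproj_eproj piQ s_uniq sP).
by rewrite (@eq_eproj _ _ pi s _ P _ R) // => D _ /=; rewrite andbb.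
Qed.

Lemma dim_eproj_sum M P R : subbicomodule pi M ->
  \dim (eproj pi s P R @: M) =
  (\sum_(D <- s | P D) \sum_(E <- s | R E) \dim (eproj pi s (pred1 D) (pred1 E) @: M))%N.
Proof.
move=> sM; apply: (natr_inj k0); rewrite dim_eproj_ltr //.
have -> : (eproj pi s P R \o projv M)%VF =
    \sum_(D <- s | P D) \sum_(E <- s | R E) (eproj pi s (pred1 D) (pred1 E) \o projv M)%VF.
  apply/lfunP => x; rewrite comp_lfunE (eproj_sum _ s_uniq).
  rewrite sum_lfunE; apply: eq_bigr => D _; rewrite sum_lfunE; apply: eq_bigr => E _.
  by rewrite comp_lfunE.
rewrite ltr_sum natr_sum; apply: eq_bigr => D _.
rewrite ltr_sum natr_sum; apply: eq_bigr => E _.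
by rewrite dim_eproj_ltr.
Qed.

(** The idempotent of D is a sum of d diagonal matrix units. The off-diagonal ones conjugate them
    into each other, so all have the same trace on M, and the dimension is d times the rank of one
    of them. *)
Lemma dvd_dim_eproj M d D R : subbicomodule pi M -> D \in s -> dimsq d D ->
  (d %| \dim (eproj pi s (pred1 D) R @: M))%N.
Proof.
move=> sM Ds /eqP dD; have [n [c [u [n0 cP uP Dc]]]] := simple_comatrix ((sP D).1 Ds).
have -> : d = n.
  by apply/eqP; rewrite -eqn_sqr -dD Dc (dim_cospan uP).
pose U := munit pi s D u; pose i0 := Ordinal n0; pose p := projv M.
have Uconv := munit_conv piP sP Ds cP uP Dc.
have Up i j := pifun_munit piP s D u i j.
have sM' := (subbicomoduleP piP _).1 sM.
have UM i j : (lop (U i j) @: M <= M)%VS.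
  by apply/limg_subP => x xM; have [] := sM' _ _ (Up i j) xM.
have RM : (rop (e R) @: M <= M)%VS.
  by apply/limg_subP => x xM; have [_] := sM' _ _ (pifun_eidem piP s R) xM.
have tr_eq i : ltr (lop (U i i) \o (rop (e R) \o p))%VF =
    ltr (lop (U i0 i0) \o (rop (e R) \o p))%VF.
  have -> : (lop (U i i) \o (rop (e R) \o p) =
      lop (U i0 i) \o (lop (U i i0) \o rop (e R) \o p))%VF.
    apply/lfunP => x; rewrite ![(lop _ \o _)%VF _]comp_lfunE ![(_ \o p)%VF _]comp_lfunE.
    by rewrite [(lop _ \o _)%VF _]comp_lfunE lop_lop Uconv eqxx.
  rewrite ltrC -comp_lfunA tr_proj_sub //.
    congr ltr; apply/lfunP => x; rewrite [LHS]comp_lfunE [(lop _ \o _)%VF _]comp_lfunE.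
    rewrite [(_ \o p)%VF _]comp_lfunE -[rop _ (lop _ _)]lop_rop lop_lop Uconv eqxx.
    by rewrite [RHS]comp_lfunE [(_ \o p)%VF _]comp_lfunE.
  apply/limg_subP => x xM; rewrite comp_lfunE.
  by rewrite (subvP (UM i i0)) // memv_img // (subvP RM) // memv_img.
apply/dvdnP; exists (\dim ((lop (U i0 i0) \o rop (e R)) @: M)); apply: (natr_inj k0).
rewrite natrM dim_eproj_ltr // -ltr_idem_proj.
- have -> : (eproj pi s (pred1 D) R \o p = \sum_i (lop (U i i) \o (rop (e R) \o p)))%VF.
    apply/lfunP => x; rewrite comp_lfunE eprojE -(munit_sum piP s_uniq sP Ds cP uP Dc).
    rewrite linear_sum !sum_lfunE; apply: eq_bigr => i _.
    by rewrite [RHS]comp_lfunE [(_ \o p)%VF _]comp_lfunE.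
  rewrite ltr_sum (eq_bigr _ (fun i _ => tr_eq i)) sumr_const card_ord comp_lfunA.
  by rewrite mulr_natr.
- apply/limg_subP => x xM; rewrite comp_lfunE.
  by rewrite (subvP (UM i0 i0)) // memv_img // (subvP RM) // memv_img.
- move=> x _; rewrite ![(lop _ \o _)%VF _]comp_lfunE -[rop _ (lop _ _)]lop_rop.
  rewrite lop_lop rop_rop Uconv eqxx (conv_eidem piP s_uniq sP).
  by rewrite (@eq_eidem _ _ pi s _ R) // => E _ /=; rewrite andbb.
Qed.


End Multiplicities.

(** * Blocks of a coalgebra that carries a Hopf algebra structure *)

Section Admissible.
Variables (k : closedFieldType) (k0 : [pchar k] =i pred0).
Variables (C : coalgebra k) (H : hopf_structure C).
Variables (pi : 'End(C)) (Q : nat -> {vspace C}) (piQ : block_data pi Q).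
Variables (s : seq {vspace C}) (s_uniq : uniq s).
Hypothesis sP : forall D, D \in s <-> simple_subcoalgebra D.
Implicit Types (D E : {vspace C}) (P R : pred {vspace C}) (g h x : C).
Let piP : coradical_projection pi := piQ.1.
Local Notation e := (eidem pi s).
Local Notation B := (block pi Q).
Local Notation glike := (@grouplikes k C).
Local Notation one := (hone H).

Lemma grouplike_neq0 g : glike g -> g != 0.
Proof.
move=> [_ ge]; apply/eqP => g0; move: ge; rewrite g0 linear0.
by move/esym/eqP; rewrite oner_eq0.
Qed.

Lemma grouplike_simple g : glike g -> simple_subcoalgebra <[g]>%VS.
Proof.
move=> gG; have g0 := grouplike_neq0 gG.
have dg : \dim <[g]> = 1%N by rewrite dim_vline g0.
split; last 1 first.
- move=> E sE Eg; have [|E0] := eqVneq E 0%VS; [by left|right].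
  by apply/eqP; rewrite eqEdim Eg dg lt0n dimv_eq0.
- apply/subcoalgebraP; split=> f _ /vlineP[a ->]; rewrite linearZ memvZ //=.
    by rewrite (lop_grouplike _ gG) memvZ ?memv_line.
  by case: gG => gD _; rewrite ropE gD rsl_tens memvZ ?memv_line.
- by rewrite -dimv_eq0 dg.
Qed.

Lemma simple_dim1 D : simple_subcoalgebra D -> \dim D = 1%N ->
  exists2 g, glike g & D = <[g]>%VS.
Proof.
move=> [/subcoalgebraP[lD _] D0 _] D1.
pose x := vpick D; have xD : x \in D := memv_pick D.
have x0 : x != 0 by rewrite vpick0.
have DE : D = <[x]>%VS by apply/esym/eqP; rewrite eqEdim -memvE xD D1 dim_vline x0.
have lx f : exists a, lop f x = a *: x by apply/vlineP; rewrite -DE lD.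
have ex : (counit C x : k) != 0.
  apply: contra x0 => /eqP ex; apply/eqP/functional_ext => f.
  by rewrite linear0 -counit_lop; have [a ->] := lx f; rewrite linearZ /= ex scaler0.
pose g := (counit C x : k)^-1 *: x.
have ge : counit C g = (1 : k) by rewrite linearZ; exact: mulVf.
have Dg : D = <[g]>%VS.
  apply/esym/eqP; rewrite eqEdim -memvE memvZ // D1 dim_vline.
  by rewrite scaler_eq0 invr_eq0 (negPf ex) (negPf x0).
exists g => //; split=> //; apply: lsl_ext => f; rewrite -lopE lsl_tens.
have [a fE] : exists a, lop f g = a *: g.
  by apply/vlineP; rewrite -Dg lD // Dg memv_line.
by have := counit_lop f g; rewrite fE linearZ /= ge => <-; congr (_ *: _); rewrite -[LHS]mulr1.
Qed.

Lemma vline_grouplike_inj g h : glike g -> glike h -> <[g]>%VS = <[h]>%VS -> g = h.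
Proof.
move=> [_ ge] [_ he] gh; have /vlineP[a gE] : g \in <[h]>%VS by rewrite -gh memv_line.
have : counit C g = (a : k) by rewrite gE linearZ /= he; exact: mulr1.
by rewrite ge gE => <-; rewrite scale1r.
Qed.

Lemma grouplike_lines : exists gs : seq C,
  [/\ uniq gs, forall g, g \in gs <-> glike g, size gs = card_grouplikes C &
      perm_eq [seq D <- s | dimsq 1 D] [seq <[g]>%VS | g <- gs]].
Proof.
have [gs [gs_uniq gsP gs_size]] := grouplike_list C; exists gs; split => //.
apply: uniq_perm; first exact: filter_uniq.
  by rewrite map_inj_in_uniq // => g h /gsP gG /gsP hG; exact: vline_grouplike_inj.
move=> D; rewrite mem_filter; apply/andP/mapP => [[/eqP D1 /sP sD]|[g /gsP gG ->]].
  by have [g gG DE] := simple_dim1 sD D1; exists g => //; exact/gsP.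
split; last exact/sP/grouplike_simple.
by rewrite /dimsq dim_vline grouplike_neq0.
Qed.

Lemma count_dimsq1 : count (dimsq 1) s = card_grouplikes C.
Proof.
have [gs [_ _ <- /perm_size]] := grouplike_lines.
by rewrite size_filter size_map.
Qed.

Lemma dim_block01 : \dim (B 0 1 1) = card_grouplikes C.
Proof.
have [gs [gs_uniq gsP <- gsE]] := grouplike_lines.
rewrite (block0 pi Q sP) -big_filter (perm_big _ gsE) big_map -span_def.
by apply/eqP; apply: grouplikes_free => // g /gsP.
Qed.

Lemma dimsq_lmul d g D : glike g -> dimsq d (lmul H g @: D)%VS = dimsq d D.
Proof. by move=> gG; rewrite /dimsq (comorph_dim (lmul_comorph H gG)). Qed.

Lemma dvd_block0 d : (card_grouplikes C %| \dim (B 0 d d))%N.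
Proof.
rewrite (block0 pi Q sP); set M := (\sum_(D <- s | _) D)%VS.
have sub_M D : D \in s -> dimsq d D -> (D <= M)%VS.
  by move=> Ds dD; rewrite /M (big_rem D) //= dD addvSl.
have /subcoalgebraP[_ rM] : subcoalgebra M.
  rewrite /M big_seq_cond; elim/big_rec: _ => [|D W /andP[/sP[sD _ _] _] sW].
    exact: subcoalgebra0.
  exact: subcoalgebraD.
apply: (hopf_module_dvd k0 (H := H)) => // g gG.
rewrite {1}/M limg_sum big_seq_cond; elim/big_rec: _ => [|D W /andP[Ds dD] WM].
  exact: sub0v.
rewrite subv_add WM andbT sub_M ?dimsq_lmul //.
exact/sP/(comorph_simple (lmul_comorph H gG))/sP.
Qed.

(** Moving f past the idempotent of R costs an error in the radical, whose effect falls into C_n, a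
    part of the layer. *)
Lemma right_stable_layer n P R : right_stable (layer n (e P) (e R)).
Proof.
have [lC rC] := corad_filt_stable C n; have [_ rC1] := corad_filt_stable C n.+1.
move=> f x /memv_addP[_ /memv_imgP[y yC ->] [z zC ->]].
rewrite comp_lfunE linearD memvD //=; last first.
  by apply: (subvP (corad_filt_layer _ _ _)); exact: rC.
rewrite -lop_rop rop_rop.
rewrite -(subrK (rop (conv (e R) f) y) (rop (conv f _) y)) linearD memvD //=.
  apply: (subvP (corad_filt_layer _ _ _)); apply: lC; apply: rop_mod yC.
  exact: (eidem_central piP s_uniq sP).
by rewrite -rop_rop lop_layer // rC1.
Qed.

(** Translation permutes the simple subcoalgebras and keeps their dimensions, so it fixes the
    idempotents e_d modulo the radical. *)
Lemma lmul_layer n d1 d2 g : glike g ->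
  (lmul H g @: layer n (e (dimsq d1)) (e (dimsq d2)) <=
   layer n (e (dimsq d1)) (e (dimsq d2)))%VS.
Proof.
move=> gG; have gC := lmul_comorph H gG.
have eE d : radfun (e (dimsq d) - (e (dimsq d) \o lmul H g)%VF).
  apply: radfunN; have := comorph_eidem piP s_uniq sP (dimsq d) gC.
  by rewrite (@eq_eidem _ _ pi s _ (dimsq d)) // => D _; rewrite dimsq_lmul.
have -> : layer n (e (dimsq d1)) (e (dimsq d2)) =
    layer n (e (dimsq d1) \o lmul H g)%VF (e (dimsq d2) \o lmul H g)%VF.
  exact: layer_mod.
apply: subv_trans (comorph_layer_sub _ _ _ gC) _.
by rewrite (layer_mod n (eE d1) (eE d2)).
Qed.

(** In positive degree the dimension of a block is the difference between those of two Hopf modules,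
    the layer and C_n. *)
Lemma dvd_block n d1 d2 : (card_grouplikes C %| \dim (B n d1 d2))%N.
Proof.
case: n => [|n].
  have [->|d12] := eqVneq d1 d2; first exact: dvd_block0.
  by rewrite /block (negPf d12) eqxx dimv0 dvdn0.
have dC : (card_grouplikes C %| \dim (corad_filt C n))%N.
  apply: (hopf_module_dvd k0 (H := H)) => [|g gG]; first exact: (corad_filt_stable C n).2.
  by apply/limg_subP => x; exact: comorph_filt (lmul_comorph H gG).
rewrite -(dvdn_addl _ dC) (dim_block piQ s_uniq sP).
by apply: (hopf_module_dvd k0 (H := H)) => [|g]; [exact: right_stable_layer|exact: lmul_layer].
Qed.

Lemma dim_block_sym n d1 d2 : \dim (B n.+1 d1 d2) = \dim (B n.+1 d2 d1).
Proof.
have [La La0 LaI] := left_integral_exists H.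
have SC := antipode_comorph La0 LaI.
apply/eqP; rewrite -(eqn_add2r (\dim (corad_filt C n))) !(dim_block piQ s_uniq sP).
rewrite -(comorph_block_dim piP s_uniq sP n (dimsq d2) (dimsq d1) SC).
apply/eqP; congr (\dim (layer n _ _)); apply: eq_eidem => D _;
  by rewrite /dimsq (comorph_dim SC).
Qed.

Lemma dvd_block_line n d : (d * card_grouplikes C %| \dim (B n.+1 d 1))%N.
Proof.
have [gs [gs_uniq gsP gs_size gsE]] := grouplike_lines.
have sQ := block_subbicomodule piQ (ltn0Sn n).
pose r E := \dim (eproj pi s (dimsq d) (pred1 E) @: Q n.+1).
have rE g : glike g -> r <[g]>%VS = r <[one]>%VS.
  move=> gG; have gC := lmul_comorph H gG.
  apply: (@addIn (\dim (corad_filt C n))); rewrite /r !(dim_eproj piQ s).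
  have := comorph_block_dim piP s_uniq sP n (dimsq d) (pred1 <[g]>%VS) gC => /= <-.
  congr (\dim (layer n _ _)); apply: eq_eidem => D _ /=.
    by rewrite dimsq_lmul.
  (* Translation by g carries the line of 1 to the line of g, so the condition g D = <[g]> singles
     out D = <[one]>. *)
  have -> : <[g]>%VS = (lmul H g @: <[one]>)%VS by rewrite limg_line lmulE mulm1.
  by rewrite eq_limg_ker0 // lmul_grouplike_inj.
have sumE : \dim (B n.+1 d 1) = (\sum_(E <- s | dimsq 1 E) r E)%N.
  rewrite (block_eproj piQ s_uniq sP) // (dim_eproj_sum k0 piQ s_uniq sP _ _ sQ) exchange_big /=.
  rewrite big_seq_cond [RHS]big_seq_cond; apply: eq_bigr => E /andP[Es _].
  rewrite /r (dim_eproj_sum k0 piQ s_uniq sP _ _ sQ); apply: eq_bigr => D _.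
  by rewrite -[RHS]big_filter filter_pred1_uniq // big_seq1.
have dr E : (d %| r E)%N.
  rewrite /r (dim_eproj_sum k0 piQ s_uniq sP _ _ sQ) big_seq_cond.
  apply: dvdn_sum => D /andP[Ds dD]; apply: dvdn_sum => F _.
  exact: (dvd_dim_eproj k0 piQ s_uniq sP _ sQ Ds dD).
rewrite sumE -big_filter (perm_big _ gsE) big_map big_seq.
rewrite (eq_bigr (fun=> r <[one]>%VS)) => [|g /gsP]; last exact: rE.
rewrite -big_seq big_const_seq count_predT iter_addn_0 gs_size dvdn_mul //.
Qed.

End Admissible.

Theorem theorem2p7 (k : closedFieldType) (k0 : [pchar k] =i pred0)
    (C : coalgebra k) (Cnss : ~ cosemisimple C) (Cadm : admissible C)
    (pi : 'End(C)) (Q : nat -> {vspace C}) (piQ : block_data pi Q) :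
  let B := block pi Q in
  let g := card_grouplikes C in
  [/\ (* (i) *)
      \dim (B 0%N 1%N 1%N) = g /\
      (forall n d1 d2 : nat, (1 <= d1)%N -> (1 <= d2)%N ->
         (\dim (B 0%N 1%N 1%N) %| \dim (B n d1 d2))%N),
      (* (ii) *)
      forall n d : nat, (1 <= n)%N -> (1 <= d)%N ->
        (d * g %| \dim (B n d 1%N))%N /\ (d * g %| \dim (B n 1%N d))%N,
      (* (iii) *)
      forall n d1 d2 : nat, (1 <= n)%N -> (1 <= d1)%N -> (1 <= d2)%N ->
        B n d1 d2 != 0%VS -> B n d2 d1 != 0%VS,
      (* (iv) *)
      forall n1 d1 d2 : nat, (1 <= n1)%N -> (1 <= d1)%N -> (1 <= d2)%N ->
        d1 <> d2 -> B n1 d1 d2 != 0%VS ->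
        exists d3 n2 : nat,
          [/\ (1 <= d3)%N, (n1.+1 <= n2)%N & B n2 d1 d3 != 0%VS] &
      (* (v) *)
      exists m : nat,
        [/\ B m 1%N 1%N != 0%VS,
            forall m' : nat, B m' 1%N 1%N != 0%VS -> (m' <= m)%N &
            \dim (B m 1%N 1%N) = g]].
Proof.
move=> B g; have [H] := Cadm.
have [s s_uniq sP] := simple_list C.
have [La La0 LaI] := left_integral_exists H.
have La_full := lam_map_full La0 LaI.
have g_gt0 : (0 < g)%N.
  have [gs [_ gsP gsE]] := grouplike_list C; rewrite /g -gsE.
  by have := (gsP (hone H)).2 (grouplike1 H); case: (gs).
have d01 : \dim (B 0%N 1%N 1%N) = g by exact: (dim_block01 pi Q s_uniq sP).
have dvdB n d1 d2 : (g %| \dim (B n d1 d2))%N by exact: (dvd_block k0 H piQ s_uniq sP).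
have symB n d1 d2 : \dim (B n.+1 d1 d2) = \dim (B n.+1 d2 d1).
  exact: (dim_block_sym H piQ s_uniq sP).
have lineB n d : (d * g %| \dim (B n.+1 d 1))%N.
  exact: (dvd_block_line k0 H piQ s_uniq sP).
split.
- by split=> // n d1 d2 _ _; rewrite d01.
- by case=> // n d _ _; split=> //; rewrite symB.
- by case=> // n d1 d2 _ _ _; rewrite -!dimv_eq0 symB.
- case=> // n d1 d2 _ d10 d20 d12 Bn.
  have [d3 [m [d30 nm Bm]]] := block_next piQ s_uniq sP La_full d10 d20 d12 Bn.
  by exists d3, m.
have [m [mmax mtop]] := top_block piQ s_uniq sP La_full.
(* In degree 0 the block is spanned by the group-likes and (i) settles it; [top_block] bounds the
   dimension only for m > 0. *)
exists m; have [m0|m0] := eqVneq m 0%N.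
  split; [|by case=> // m' /mmax|by rewrite m0].
  by rewrite m0 -dimv_eq0 d01 -lt0n.
have [Bm dB] := mtop (elimN eqP m0); split; [exact: Bm|by case=> // m' /mmax|].
apply/eqP; rewrite eqn_leq; apply/andP; split.
  by apply: leq_trans dB _; rewrite (count_dimsq1 s_uniq sP).
by apply: dvdn_leq; rewrite ?lt0n ?dimv_eq0.
Qed.
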